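(* Let $\mathcal S$ be a finite dimensional operator system, let $\{s_1,\dots,s_n\}$ be a basis of $\mathcal S$ and let $\{\delta_1,\dots,\delta_n\}\subset\mathcal S^*$ be the dual basis, $\delta_i(s_j)=\delta_{ij}$. The following are equivalent: (1) $\mathcal S$ is C*-nuclear; (2) the maximally entangled element $s_1\otimes\delta_1+\cdots+s_n\otimes\delta_n$ is positive in $\mathcal S\otimes_{\rm c}\mathcal S^*$; (3) $\mathcal S^*$ is C*-nuclear.
   Context: An operator system is a unital $*$-closed subspace of some $B(H)$ (equivalently, abstractly, a $*$-vector space with a compatible family of proper matrix cones and an Archimedean matrix order unit). ucp means unital completely positive. Dual: for an operator system $\mathcal S$ with $\dim\mathcal S<\infty$, $\mathcal S^*$ carries the involution $f^*(s)=\overline{f(s^* )}$ and the matrix cones for which $(f_{ij})\in M_r(\mathcal S^* )$ is positive iff $s\mapsto(f_{ij}(s))\in M_r$ is completely positive; fixing any faithful state on $\mathcal S$ as Archimedean matrix order unit makes $\mathcal S^*$ an operator system (a different choice of faithful state changes only the unit, not the cones). Tensor products on the algebraic tensor product $\mathcal S\otimes\mathcal T$, all with unit $1_{\mathcal S}\otimes1_{\mathcal T}$: - $\mathcal S\otimes_{\min}\mathcal T$ has cones $C_r^{\min}=\{[x_{ij}]\in M_r(\mathcal S\otimes\mathcal T): [(\phi\otimes\psi)(x_{ij})]\ge0$ for all ucp $\phi:\mathcal S\to M_p$, $\psi:\mathcal T\to M_q$, all $p,q\}$. - $\mathcal S\otimes_{\max}\mathcal T$ has cones $C_r^{\max}=\{Y: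 Y+\epsilon(1\otimes1)_r\in D_r^{\max}\ \forall\epsilon>0\}$, where $(1\otimes1)_r=I_r\otimes(1\otimes1)$ and $D_r^{\max}=\{X^*(S\otimes T)X: S\in M_p(\mathcal S)^+, T\in M_q(\mathcal T)^+, X \text{ a } pq\times r \text{ scalar matrix}, p,q\in\mathbb N\}$. - The commuting tensor product $\mathcal S\otimes_{\rm c}\mathcal T$ has cones $C_r^{\rm com}=\{X\in M_r(\mathcal S\otimes\mathcal T): (\phi\cdot\psi)_r(X)\ge0$ for all Hilbert spaces $H$ and all ucp maps $\phi:\mathcal S\to B(H)$, $\psi:\mathcal T\to B(H)$ with commuting ranges$\}$, where $(\phi\cdot\psi)(s\otimes t)=\phi(s)\psi(t)$. An operator system $\mathcal S$ is C*-nuclear if for every unital C*-algebra $\mathcal A$ the identity $\mathcal S\otimes_{\min}\mathcal A\to\mathcal S\otimes_{\max}\mathcal A$ is a complete order isomorphism. *)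

(* Defs.v *)
From HB Require Import structures.
From mathcomp Require Import all_boot all_order all_algebra.
From mathcomp Require Import complex mxtens.
From mathcomp Require Import boolp classical_sets functions reals.
From mathcomp Require Import topology normedtype.

Set Implicit Arguments.
Unset Strict Implicit.
Unset Printing Implicit Defensive.

Import Order.TTheory GRing.Theory Num.Theory Num.Def.
Import numFieldNormedType.Exports.

Local Open Scope ring_scope.
Local Open Scope quotient_scope.

(** * Algebraic tensor product

   An element of [tensor S T] is a class of formal sums of elementary tensors,
   a sum being encoded as the list of its terms (scalars are absorbed in the
   left factor).  Two formal sums are identified when every bilinear map takes
   the same value on both; [tensor_universal] below is the resulting universal
   property. *)
Section FormalSum.
Variables (K : fieldType) (S T : lmodType K).

Definition fsum_eval (U : lmodType K) (b : S -> T -> U) (x : seq (S * T)) : U :=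
  \sum_(st <- x) b st.1 st.2.

Definition fsum_eqv (x y : seq (S * T)) : bool :=
  `[< forall (U : lmodType K) (b : {bilinear S -> T -> U}),
        fsum_eval b x = fsum_eval b y >].

Lemma fsum_eqv_refl : reflexive fsum_eqv.
Proof. by move=> x; apply/asboolP. Qed.

Lemma fsum_eqv_sym : symmetric fsum_eqv.
Proof. by move=> x y; apply/asboolP/asboolP => h U b; rewrite h. Qed.

Lemma fsum_eqv_trans : transitive fsum_eqv.
Proof.
by move=> y x z /asboolP xy /asboolP yz; apply/asboolP => U b; rewrite xy yz.
Qed.

Canonical fsum_equiv :=
  EquivRel fsum_eqv fsum_eqv_refl fsum_eqv_sym fsum_eqv_trans.

Definition tensor := {eq_quot fsum_equiv}.

HB.instance Definition _ : EqQuotient _ fsum_equiv tensor :=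
  EqQuotient.on tensor.
HB.instance Definition _ := Choice.on tensor.

(* Meaningful for bilinear [b] only: the value on a representative. *)
Definition tensor_lift (U : lmodType K) (b : S -> T -> U) (x : tensor) : U :=
  fsum_eval b (repr x).

Definition tens (s : S) (t : T) : tensor := \pi_tensor [:: (s, t)].

Lemma tensor_lift_pi (U : lmodType K) (b : {bilinear S -> T -> U}) x :
  tensor_lift b (\pi_tensor x) = fsum_eval b x.
Proof.
have /eqmodP/asboolP h : repr (\pi_tensor x) = x %[mod tensor] by rewrite reprK.
exact: h.
Qed.

Lemma tensor_ext (x y : tensor) :
  (forall (U : lmodType K) (b : {bilinear S -> T -> U}),
     tensor_lift b x = tensor_lift b y) -> x = y.
Proof. by move=> h; rewrite -[x]reprK -[y]reprK; apply/eqmodP/asboolP. Qed.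

Let tzero : tensor := \pi_tensor [::].
Let tadd (x y : tensor) : tensor := \pi_tensor (repr x ++ repr y).
Let tscale (a : K) (x : tensor) : tensor :=
  \pi_tensor [seq (a *: st.1, st.2) | st <- repr x].
Let topp (x : tensor) : tensor := tscale (-1) x.

Let lift0 (U : lmodType K) (b : {bilinear S -> T -> U}) :
  tensor_lift b tzero = 0.
Proof. by rewrite tensor_lift_pi /fsum_eval big_nil. Qed.

Let liftD (U : lmodType K) (b : {bilinear S -> T -> U}) x y :
  tensor_lift b (tadd x y) = tensor_lift b x + tensor_lift b y.
Proof. by rewrite tensor_lift_pi /fsum_eval big_cat. Qed.

Let liftZ (U : lmodType K) (b : {bilinear S -> T -> U}) a x :
  tensor_lift b (tscale a x) = a *: tensor_lift b x.
Proof.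
rewrite tensor_lift_pi /fsum_eval big_map scaler_sumr.
by apply: eq_bigr => st _; rewrite linearZl_LR.
Qed.

Let taddA : associative tadd.
Proof. by move=> x y z; apply: tensor_ext => U b; rewrite !liftD addrA. Qed.
Let taddC : commutative tadd.
Proof. by move=> x y; apply: tensor_ext => U b; rewrite !liftD addrC. Qed.
Let tadd0 : left_id tzero tadd.
Proof. by move=> x; apply: tensor_ext => U b; rewrite liftD lift0 add0r. Qed.
Let taddN : left_inverse tzero topp tadd.
Proof.
move=> x; apply: tensor_ext => U b.
by rewrite liftD liftZ lift0 scaleN1r addNr.
Qed.

HB.instance Definition _ := GRing.isZmodule.Build tensor taddA taddC tadd0 taddN.

Let tscaleA a c (x : tensor) : tscale a (tscale c x) = tscale (a * c) x.
Proof. by apply: tensor_ext => U b; rewrite !liftZ scalerA. Qed.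
Let tscale1 : left_id 1 tscale.
Proof. by move=> x; apply: tensor_ext => U b; rewrite liftZ scale1r. Qed.
Let tscaleDr : right_distributive tscale +%R.
Proof.
move=> a x y; apply: tensor_ext => U b.
by rewrite liftD !liftZ liftD scalerDr.
Qed.
Let tscaleDl x : {morph tscale^~ x : a c / a + c}.
Proof.
by move=> a c; apply: tensor_ext => U b; rewrite liftD !liftZ scalerDl.
Qed.

HB.instance Definition _ :=
  GRing.Zmodule_isLmodule.Build K tensor tscaleA tscale1 tscaleDr tscaleDl.

Lemma tensor_lift_linear (U : lmodType K) (b : {bilinear S -> T -> U}) :
  linear (tensor_lift b).
Proof. by move=> a x y; rewrite [LHS]liftD liftZ. Qed.

Lemma tensor_lift_tens (U : lmodType K) (b : {bilinear S -> T -> U}) s t :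
  tensor_lift b (tens s t) = b s t.
Proof. by rewrite tensor_lift_pi /fsum_eval big_seq1. Qed.

Lemma tens_bilinear : bilinear_for *:%R *:%R tens.
Proof.
split=> [t a x y | s a x y]; apply: tensor_ext => U b.
  by rewrite (tensor_lift_linear b) !tensor_lift_tens linearPl.
by rewrite (tensor_lift_linear b) !tensor_lift_tens linearPr.
Qed.

Lemma tensor_span (x : tensor) : x = \sum_(st <- repr x) tens st.1 st.2.
Proof.
apply: tensor_ext => U b; rewrite {1}/tensor_lift /fsum_eval.
elim: (repr x) => [|st l IH]; first by rewrite !big_nil [RHS]lift0.
by rewrite !big_cons [RHS]liftD -IH tensor_lift_tens.
Qed.

Lemma tensor_universal (U : lmodType K) (b : {bilinear S -> T -> U}) :
  exists! h : tensor -> U, linear h /\ forall s t, h (tens s t) = b s t.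
Proof.
exists (tensor_lift b); split.
  by split; [exact: tensor_lift_linear | exact: tensor_lift_tens].
move=> h [hl ht]; apply/funext => x.
have h0 : h 0 = 0 by have := hl (-1) 0 0; rewrite !scaleN1r !addNr.
rewrite [x in h x]tensor_span /tensor_lift /fsum_eval.
elim: (repr x) => [|st l IH]; first by rewrite !big_nil.
by rewrite !big_cons -[tens _ _]scale1r hl scale1r ht IH.
Qed.

End FormalSum.

Notation "s ⊗ t" := (tens s t) (at level 40, left associativity) : ring_scope.

Section Matrices.
Variables (R : realType) (V : lmodType R[i]).

(* I_r ⊗ e *)
Definition amp_mx r (e : V) : 'M[V]_r := \matrix_(i, j) (e *+ (i == j)).

Definition scale_vmx m n (a : R[i]) (A : 'M[V]_(m, n)) : 'M[V]_(m, n) :=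
  map_mx ( *:%R a) A.

(* X^* A X *)
Definition compress m r (X : 'M[R[i]]_(m, r)) (A : 'M[V]_m) : 'M[V]_r :=
  \matrix_(i, j) \sum_k \sum_l ((X k i)^* * X l j) *: A k l.

Definition star_mx m n (star : V -> V) (A : 'M[V]_(m, n)) : 'M[V]_(n, m) :=
  (map_mx star A)^T.

End Matrices.

(** * Operator systems *)

(* Complete positivity and the tensor products only involve the matrix cones and
   the unit, so these are separated from the involution. *)
Record mcones (R : realType) (V : lmodType R[i]) := MCones {
  mpos : forall r, 'M[V]_r -> Prop;
  munit : V }.

Record opsys_data (R : realType) (V : lmodType R[i]) := OpsysData {
  ops_cones :> mcones V;
  ops_star : V -> V }.

(* In [R[i]], [0 <= a] means that [a] is real and nonnegative, so that scalars
   bounded below by [0] range over the nonnegative reals. *)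
Record is_opsys (R : realType) (V : lmodType R[i]) (o : opsys_data V) : Prop :=
  IsOpsys {
  ops_star_conjlinear : forall (a : R[i]) x y,
    ops_star o (a *: x + y) = a^* *: ops_star o x + ops_star o y;
  ops_starK : involutive (ops_star o);
  ops_pos_herm : forall r (A : 'M[V]_r),
    mpos o A -> star_mx (ops_star o) A = A;
  ops_pos0 : forall r, mpos o (0 : 'M[V]_r);
  ops_posD : forall r (A B : 'M[V]_r), mpos o A -> mpos o B -> mpos o (A + B);
  ops_posZ : forall r (a : R[i]) (A : 'M[V]_r),
    0 <= a -> mpos o A -> mpos o (scale_vmx a A);
  ops_proper : forall r (A : 'M[V]_r), mpos o A -> mpos o (- A) -> A = 0;
  ops_compress : forall m r (X : 'M[R[i]]_(m, r)) (A : 'M[V]_m),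
    mpos o A -> mpos o (compress X A);
  ops_order_unit : forall r (A : 'M[V]_r), star_mx (ops_star o) A = A ->
    exists2 t : R[i], 0 < t & mpos o (scale_vmx t (amp_mx r (munit o)) - A);
  ops_archimedean : forall r (A : 'M[V]_r),
    (forall t : R[i], 0 < t ->
       mpos o (scale_vmx t (amp_mx r (munit o)) + A)) -> mpos o A }.

Definition cp (R : realType) (V W : lmodType R[i])
    (oV : mcones V) (oW : mcones W) (f : V -> W) : Prop :=
  linear f /\ forall r (A : 'M[V]_r), mpos oV A -> mpos oW (map_mx f A).

Definition ucp (R : realType) (V W : lmodType R[i])
    (oV : mcones V) (oW : mcones W) (f : V -> W) : Prop :=
  cp oV oW f /\ f (munit oV) = munit oW.

Definition complete_order_iso (R : realType) (V W : lmodType R[i])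
    (oV : mcones V) (oW : mcones W) (f : V -> W) : Prop :=
  cp oV oW f /\ exists g : W -> V, [/\ cancel f g, cancel g f & cp oW oV g].

(** * Scalar matrices, bounded operators, C*-algebras *)

Definition mx_cones (R : realType) (p : nat) : mcones 'M[R[i]]_p :=
  {| mpos r A := forall v : 'I_r -> 'cV[R[i]]_p,
       0 <= \sum_i \sum_j (map_mx conjC (v i)^T *m A i j *m v j) 0 0;
     munit := 1%:M |}.

Record hilbert (R : realType) := Hilbert {
  hilb_sort :> completeNormedModType R[i];
  hilb_dot : {dot hilb_sort for conjC};
  hilb_normE : forall x : hilb_sort, `|x| ^+ 2 = hilb_dot x x }.

Section BoundedOperators.
Variables (R : realType) (H : hilbert R).

Definition is_bounded_op (f : H -> H) : bool :=
  `[< linear f /\ continuous f >].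

Record bounded_op := BoundedOp {
  bop_fun :> H -> H;
  bop_subproof : is_bounded_op bop_fun }.

HB.instance Definition _ := [isSub for bop_fun].
HB.instance Definition _ := [Choice of bounded_op by <:].

Lemma is_bounded_op_submod : submod_closed is_bounded_op.
Proof.
split=> [|a f g /asboolP[fl fc] /asboolP[gl gc]]; apply/asboolP; split.
- by move=> a x y /=; rewrite scaler0 addr0.
- by move=> x; exact: cvg_cst.
- move=> c x y /=; rewrite !fctE fl gl !scalerDr !scalerA [c * a]mulrC.
  by rewrite addrACA.
- move=> x; apply: cvgD; last exact: gc.
  by apply: cvgZr; exact: fc.
Qed.

HB.instance Definition _ :=
  GRing.isSubmodClosed.Build R[i] (H -> H) is_bounded_op is_bounded_op_submod.
HB.instance Definition _ := [SubChoice_isSubLmodule of bounded_op by <:].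

Lemma bop_id_subproof : is_bounded_op idfun.
Proof. by apply/asboolP; split=> [a x y //|x]; exact: cvg_id. Qed.

Definition bop_id : bounded_op := BoundedOp bop_id_subproof.

Lemma bop_comp_subproof (f g : bounded_op) : is_bounded_op (f \o g).
Proof.
have /asboolP[fl fc] := bop_subproof f.
have /asboolP[gl gc] := bop_subproof g.
apply/asboolP; split=> [a x y|x] /=; first by rewrite gl fl.
by apply: continuous_comp; [exact: gc | exact: fc].
Qed.

Definition bop_comp (f g : bounded_op) : bounded_op :=
  BoundedOp (bop_comp_subproof f g).

(* Positivity of an operator matrix as an operator on H^r. *)
Definition bop_cones : mcones bounded_op :=
  {| mpos r (A : 'M[bounded_op]_r) := forall v : 'I_r -> H,
       0 <= \sum_i \sum_j hilb_dot H (A i j (v j)) (v i);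
     munit := bop_id |}.

End BoundedOperators.

(* The product is a plain field: the ring and normed module hierarchies have no
   common extension with a vector-valued norm.  A unit is required, and the zero
   algebra is allowed. *)
Record cstarAlg (R : realType) := CStarAlg {
  cstar_sort :> completeNormedModType R[i];
  cstar_mul : cstar_sort -> cstar_sort -> cstar_sort;
  cstar_one : cstar_sort;
  cstar_star : cstar_sort -> cstar_sort;
  cstar_mul_bilinear : bilinear_for *:%R *:%R cstar_mul;
  cstar_mulA : associative cstar_mul;
  cstar_mul1l : left_id cstar_one cstar_mul;
  cstar_mul1r : right_id cstar_one cstar_mul;
  cstar_star_conjlinear : forall (a : R[i]) x y,
    cstar_star (a *: x + y) = a^* *: cstar_star x + cstar_star y;
  cstar_starK : involutive cstar_star;
  cstar_starM : forall x y,
    cstar_star (cstar_mul x y) = cstar_mul (cstar_star y) (cstar_star x);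
  cstar_normM : forall x y, `|cstar_mul x y| <= `|x| * `|y|;
  cstar_normE : forall x, `|cstar_mul (cstar_star x) x| = `|x| ^+ 2 }.

(* The positive elements of the C*-algebra M_r(A) are the products Y^* Y. *)
Definition cstar_cones (R : realType) (A : cstarAlg R) : mcones A :=
  {| mpos r (X : 'M[A]_r) := exists Y : 'M[A]_r,
       X = \matrix_(i, j) \sum_k cstar_mul (cstar_star (Y k i)) (Y k j);
     munit := cstar_one A |}.

(** * Tensor products *)

Section TensorProducts.
Variables (R : realType) (S T : lmodType R[i]).
Variables (oS : mcones S) (oT : mcones T).

Let unit_ST : tensor S T := munit oS ⊗ munit oT.

Definition min_tensor : mcones (tensor S T) :=
  {| mpos r X := forall p q (phi : S -> 'M[R[i]]_p) (psi : T -> 'M[R[i]]_q),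
       ucp oS (mx_cones R p) phi -> ucp oT (mx_cones R q) psi ->
       mpos (mx_cones R (p * q))
         (map_mx (tensor_lift (fun s t => phi s *t psi t)) X);
     munit := unit_ST |}.

Definition tens_mx p q (A : 'M[S]_p) (B : 'M[T]_q) : 'M[tensor S T]_(p * q) :=
  \matrix_(i, j) (A (mxtens_unindex i).1 (mxtens_unindex j).1
                    ⊗ B (mxtens_unindex i).2 (mxtens_unindex j).2).

Definition Dmax r (Y : 'M[tensor S T]_r) : Prop :=
  exists p q (A : 'M[S]_p) (B : 'M[T]_q) (X : 'M[R[i]]_(p * q, r)),
    [/\ mpos oS A, mpos oT B & Y = compress X (tens_mx A B)].

Definition max_tensor : mcones (tensor S T) :=
  {| mpos r Y := forall eps : R[i], 0 < eps ->
       Dmax (Y + scale_vmx eps (amp_mx r unit_ST));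
     munit := unit_ST |}.

Definition com_tensor : mcones (tensor S T) :=
  {| mpos r X := forall (H : hilbert R)
         (phi : S -> bounded_op H) (psi : T -> bounded_op H),
       ucp oS (bop_cones H) phi -> ucp oT (bop_cones H) psi ->
       (forall s t,
          bop_comp (phi s) (psi t) = bop_comp (psi t) (phi s)) ->
       mpos (bop_cones H)
         (map_mx (tensor_lift (fun s t => bop_comp (phi s) (psi t))) X);
     munit := unit_ST |}.

End TensorProducts.

Definition Cstar_nuclear (R : realType) (S : lmodType R[i]) (oS : mcones S) :
    Prop :=
  forall A : cstarAlg R,
    complete_order_iso (min_tensor oS (cstar_cones A))
      (max_tensor oS (cstar_cones A)) idfun.

(** * Dual *)

Section Dual.
Variables (R : realType) (S : vectType R[i]) (oS : opsys_data S).

Definition faithful_state (w : 'Hom(S, R[i]^o)) : Prop :=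
  [/\ forall x, mpos oS (const_mx x : 'M_1) -> 0 <= (w x : R[i]),
      w (munit oS) = 1
    & forall x, mpos oS (const_mx x : 'M_1) -> w x = 0 -> x = 0].

Definition dual_star (f : 'Hom(S, R[i]^o)) : 'Hom(S, R[i]^o) :=
  linfun (fun s => (f (ops_star oS s) : R[i])^* : R[i]^o).

Lemma dual_starE (hS : is_opsys oS) f s :
  dual_star f s = (f (ops_star oS s) : R[i])^*.
Proof.
pose g s : R[i]^o := (f (ops_star oS s) : R[i])^*.
have gl : linear g.
  move=> a x y; rewrite /g ops_star_conjlinear // linearP rmorphD rmorphM /=.
  by rewrite conjCK.
pose gL := HB.pack g (GRing.isLinear.Build _ _ _ _ g gl) : {linear S -> R[i]^o}.
exact: (lfunE gL s).
Qed.

Definition dual (w : 'Hom(S, R[i]^o)) : opsys_data 'Hom(S, R[i]^o) :=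
  {| ops_cones :=
       {| mpos r (F : 'M['Hom(S, R[i]^o)]_r) :=
            cp oS (mx_cones R r) (fun s => \matrix_(i, j) (F i j s : R[i]));
          munit := w |};
     ops_star := dual_star |}.

End Dual.

(* Main.v *)
(* The equivalences rest on two facts about a pair (V, W) of finite dimensional
   operator systems in duality, with dual bases v_k and w_k.

   If V is C*-nuclear and phi, psi are commuting ucp maps of V and W into B(H),
   then psi takes values in the C*-algebra A of operators commuting with phi(V),
   and X = sum_k v_k (x) psi(w_k) is positive in the minimal tensor product of V
   and A because psi is completely positive.  Hence X is positive in the maximal
   one, and the functional v (x) a |-> <phi(v) a xi, xi>, which is positive on
   D^max, shows that sum_k phi(v_k) psi(w_k) >= 0.

   Conversely let X in M_r(V (x) A) be positive for min but not for max, and let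
   f be a functional that is positive on D^max and negative at X.  Then
   Phi_v(a, b) = f(v (x) b^* a) is a form on M_r(A) for each v in V, and each w in
   W acts on M_r(A) by left multiplication with the slice of X at w.  Positivity
   of X for min makes these two families jointly completely positive, so that they
   come from commuting ucp maps into B(H), and positivity of the maximally
   entangled element at the vector 1 gives f(X) >= 0. *)

Require Import Defs.
From HB Require Import structures.
From mathcomp Require Import all_boot all_order all_algebra.
From mathcomp Require Import complex mxtens.
From mathcomp Require Import boolp classical_sets functions reals.
From mathcomp Require Import topology normedtype ring.

Set Implicit Arguments.
Unset Strict Implicit.
Unset Printing Implicit Defensive.

Import Order.TTheory GRing.Theory Num.Theory Num.Def.
Import numFieldNormedType.Exports.
Local Open Scope ring_scope.

(** * Scalars and completeness *)

(** Both facts apply to the two members of the pair, because the matrix cones of a finite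
    dimensional system are recovered from those of its dual ([bidual_posP]) and because positivity
    of the maximally entangled element is symmetric in V and W. In the converse fact, the slice of X
    at the unit of W need not be 1, so left multiplications represent W by a completely positive map
    that is not unital. Rather than inverting its value at the unit, a second completion, under the
    inner product which that value defines, makes both families ucp ([absorb_unit]). Moreover D^max
    is not known to be closed and separation gives only a weak inequality; it is applied to X + eps
    1, so that the functional is strictly negative at X. In the direct fact, positivity over A means
    a factorisation Y^* Y with entries in A, so that a positive operator matrix over the commutant
    needs a square root with entries in that same commutant. In C*-algebras, spectral theory is
    replaced by one explicit iteration for square roots and by separation of cones with an order
    unit, which rests on Zorn's lemma and uses no topology. *)

Section Rate.
Variable R : realType.
Local Notation C := R[i].
Implicit Types x y e k : C.

Definition rate (n : nat) : C := n.+1%:R^-1.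

Lemma rate_gt0 n : 0 < rate n.
Proof. by rewrite invr_gt0 ltr0Sn. Qed.

Lemma rate_ge0 n : 0 <= rate n.
Proof. exact/ltW/rate_gt0. Qed.

Lemma le_rate_anti m n : (m <= n)%N -> rate n <= rate m.
Proof. by move=> mn; rewrite lef_pV2 ?posrE ?ltr0Sn// ler_nat. Qed.

Lemma gt0_ReE e : 0 < e -> e = real_complex R (complex.Re e).
Proof. by move=> /gtr0_real/RRe_real. Qed.

Lemma ge0_ReE e : 0 <= e -> e = real_complex R (complex.Re e).
Proof. by move=> /ger0_real/RRe_real. Qed.

Lemma norm_real_complex (r : R) : `|real_complex R r| = real_complex R `|r|.
Proof. by rewrite normc_def /= expr0n/= addr0 sqrtr_sqr. Qed.

Lemma rate_lt e : 0 < e -> exists n, rate n < e.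
Proof.
move=> e0; set r := complex.Re e.
have r0 : 0 < r by rewrite -ltcR -(gt0_ReE e0).
exists (Num.bound r^-1).
rewrite -[e]invrK ltf_pV2 ?posrE ?ltr0Sn ?invr_gt0//.
have lt := archi_boundP (ltW (etrans (invr_gt0 r) r0)).
rewrite (gt0_ReE e0) -fmorphV -(rmorph_nat (real_complex R)).
by rewrite ltcR; apply: lt_trans lt _; rewrite ltr_nat.
Qed.

Lemma ler_rate x y k : (forall n, x <= y + k * rate n) -> x <= y.
Proof.
move=> h; apply/ler_addgt0Pr => e e0.
have [n hn] : exists n, rate n < e / (`|k| + 1).
  by apply: rate_lt; rewrite divr_gt0// ltr_wpDl.
(* Over [R[i]] the relation [<=] also asserts that the difference is real. Comparing n = 0 with n =
   1 shows that [k] is real, and then so is [x - y]. *)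
have yx : x - y \is Num.real.
  have h0 := h 0%N; have h1 := h 1%N.
  have k0 : k * rate 0 - k * rate 1 \is Num.real.
    have -> : k * rate 0 - k * rate 1 = (y + k * rate 0 - x) - (y + k * rate 1 - x).
      by ring.
    by rewrite rpredB// ger0_real// subr_ge0.
  have kr : k \is Num.real.
    have d0 : 0 < rate 0 - rate 1.
      by rewrite subr_gt0 ltf_pV2 ?posrE ?ltr0Sn// ltr_nat.
    by rewrite -[k](mulfK (lt0r_neq0 d0)) rpredM// ?mulrBr// realV gtr0_real.
  have -> : x - y = k * rate 0 - (y + k * rate 0 - x).
    by ring.
  by rewrite rpredB// ?(rpredM kr)// ger0_real ?rate_ge0// subr_ge0.
rewrite (le_trans (h n))// lerD2l.
apply: le_trans (_ : `|k| * rate n <= _).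
  have kr : k * rate n \is Num.real.
    have -> : k * rate n = (y + k * rate n - x) + (x - y).
      by ring.
    by rewrite rpredD// ger0_real// subr_ge0.
  by rewrite (le_trans (real_ler_norm kr))// normrM (ger0_norm (rate_ge0 n)).
apply: le_trans (_ : (`|k| + 1) * (e / (`|k| + 1)) <= _).
  by apply: ler_pM => //; [exact: rate_ge0 | rewrite lerDl | exact: ltW].
by rewrite mulrC divfK// lt0r_neq0// ltr_wpDl.
Qed.

Lemma ge0_limit x k : (forall n, exists2 y, 0 <= y & `|x - y| <= k * rate n) ->
  0 <= x.
Proof.
move=> h.
(* As [y] is real, the imaginary part of [x] is that of [x - y], which tends to 0. *)
have xE : `|x - real_complex R (complex.Re x)| <= 0.
  apply: (@ler_rate _ _ (2%:R * k)) => n; rewrite add0r; have [y y0 hy] := h n.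
  have -> : x - real_complex R (complex.Re x) =
      (x - y) - real_complex R (complex.Re (x - y)).
    have -> : complex.Re (x - y) = complex.Re x - complex.Re y by case: (x); case: (y).
    by rewrite rmorphB/= -(ge0_ReE y0) /=; ring.
  rewrite (le_trans (ler_normB _ _))// mulr2n !mulrDl !mul1r lerD//.
  apply: le_trans hy; rewrite (le_trans _ (normc_ge_Re (x - y)))//.
  by rewrite norm_real_complex.
have xR : x \is Num.real.
  move: xE; rewrite normr_le0 subr_eq0 => /eqP ->.
  by apply/complex_realP; eexists.
apply: (@ler_rate _ _ k) => n; have [y y0 hy] := h n.
have yr := ger0_real y0.
have : - (x - y) <= k * rate n.
  by apply: le_trans hy; rewrite -normrN real_ler_norm// rpredN rpredB.
by rewrite opprB lerBlDr addrC; apply: le_trans.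
Qed.

Lemma eq_limit x y k : (forall n, `|x - y| <= k * rate n) -> x = y.
Proof.
move=> h; apply/eqP; rewrite -subr_eq0 -normr_le0.
by apply: (@ler_rate _ _ k) => n; rewrite add0r.
Qed.

End Rate.

Section SeqComplete.
Variable R : realType.
Local Notation C := R[i].

(* Convergence is handled through sequences with the explicit modulus [rate]. *)
Definition seq_complete (E : normedZmodType C) : Prop :=
  forall u : nat -> E, (forall m n, `|u m - u n| <= rate R m + rate R n) ->
    exists l, forall n, `|u n - l| <= rate R n.

Lemma cauchy_seq_complete (E : completeNormedModType C) : seq_complete E.
Proof.
move=> u hu; have uc : cauchy (u @ \oo)%classic.
  apply/cauchyP => e e0; have [N hN] := rate_lt (divr_gt0 e0 (ltr0Sn _ 1)).
  exists (u N); exists N => // n /= Nn; rewrite -ball_normE /=.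
  apply: le_lt_trans (hu _ _) _.
  rewrite [e in _ < e]splitr ltrD// (le_lt_trans _ hN)// le_rate_anti//.
have /cvg_ex[l ul] : cvg (u @ \oo)%classic by exact: cauchy_cvg uc.
exists l => n; apply/ler_addgt0Pr => e e0.
have e2 : 0 < e / 2 by rewrite divr_gt0// ltr0Sn.
have [N hN] := rate_lt e2.
move/cvgrPdist_le: ul => /(_ _ e2) [N' _ hN'].
set k := maxn N N'.
have -> : u n - l = (u n - u k) - (l - u k) by rewrite opprB addrA addrNK.
rewrite (le_trans (ler_normB _ _))// [e in _ <= _ + e]splitr addrA lerD//.
  rewrite (le_trans (hu _ _))// lerD2l (le_trans _ (ltW hN))// le_rate_anti//.
  exact: leq_maxl.
by apply: hN'; exact: leq_maxr.
Unshelve. all: by end_near.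
Qed.

(** The sequence consists of centres of balls of radius [rate R n] that belong to the filter; two
    such balls meet, which gives the modulus. This makes the spaces built below instances of
    complete normed modules. *)
Lemma seq_complete_cauchy (E : normedModType C) : seq_complete E ->
  forall F : set_system E, ProperFilter F -> cauchy F -> cvg F.
Proof.
move=> cE F FF /cauchyP hF.
have [u hu] : exists u : nat -> E, forall n, F (ball (u n) (rate R n)).
  have [u hu] := choice (fun n => hF _ (rate_gt0 R n)).
  by exists u.
have [l hl] : exists l, forall n, `|u n - l| <= rate R n.
  apply: cE => m n; have [z []] := filter_ex (filterI (hu m) (hu n)).
  rewrite -ball_normE /= => /ltW h1 /ltW h2.
  have -> : u m - u n = (u m - z) - (u n - z) by rewrite opprB addrA addrNK.
  by rewrite (le_trans (ler_normB _ _))// lerD.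
apply/cvg_ex; exists l; apply/cvgrPdist_le => e e0.
have [N hN] := rate_lt (divr_gt0 e0 (ltr0Sn _ 1)).
near=> z; have : ball (u N) (rate R N) z by near: z; exact: hu.
rewrite -ball_normE /= => /ltW h1.
have -> : l - z = (u N - z) - (u N - l) by rewrite opprB [RHS]addrC addrA addrNK.
rewrite (le_trans (ler_normB _ _))// [e]splitr lerD//.
  exact: le_trans h1 (ltW hN).
exact: le_trans (hl N) (ltW hN).
Unshelve. all: by end_near.
Qed.

Lemma seq_complete_scaled (E : normedModType C) : seq_complete E ->
  forall (c : C) (u : nat -> E), 0 <= c ->
  (forall m n, `|u m - u n| <= c * (rate R m + rate R n)) ->
  exists l, forall n, `|u n - l| <= c * rate R n.
Proof.
move=> cE c u; rewrite le_eqVlt => /orP[/eqP <-|c0] hu.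
  exists (u 0%N) => n; rewrite mul0r (le_trans (hu _ 0%N))//.
  by rewrite mul0r.
have [|l hl] := cE (fun n => c^-1 *: u n).
  move=> m n; rewrite -scalerBr normrZ gtr0_norm ?invr_gt0//.
  by rewrite ler_pdivrMl.
exists (c *: l) => n.
rewrite -[u n](scalerKV (lt0r_neq0 c0)) -scalerBr normrZ gtr0_norm//.
by rewrite ler_pM2l// hl.
Qed.

(** Real and imaginary parts converge in R, without a rate. The rate for [u] is read off its own
    modulus by comparing [u n] with a far term [u k]. *)
Lemma complex_seq_complete : seq_complete (C^o : normedModType C).
Proof.
move=> u hu.
pose re n := complex.Re (u n); pose im n := complex.Im (u n).
have key (v : nat -> R) : (forall m n, real_complex R `|v m - v n| <= rate R m + rate R n) ->
    exists l, forall n e, 0 < e -> exists N, forall k, (N <= k)%N -> real_complex R `|v k - l| <= e.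
  move=> hv; have vc : cauchy (v @ \oo)%classic.
    apply/cauchyP => e e0.
    have e0' : 0 < real_complex R (e / 2) by rewrite ltcR divr_gt0// ltr0Sn.
    have [N hN] := rate_lt e0'.
    exists (v N); exists N => // n /= Nn; rewrite -ball_normE /= -ltcR.
    apply: le_lt_trans (hv _ _) _.
    rewrite [e in _ < real_complex R e]splitr rmorphD/= ltrD// (le_lt_trans _ hN)// le_rate_anti//.
  have /cvg_ex[l vl] : cvg (v @ \oo)%classic by exact: cauchy_cvg vc.
  exists l => _ e e0.
  have e0' : 0 < complex.Re e by rewrite -ltcR -(gt0_ReE e0).
  move/cvgrPdist_le: vl => /(_ _ e0') [N' _ hN'].
  exists N' => k hk; rewrite (gt0_ReE e0) lecR distrC; exact: hN'.
have [a ha] : exists l, forall (n : nat) e, 0 < e -> exists N, forall k, (N <= k)%N -> real_complex R `|re k - l| <= e.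
  apply: key => m n; apply: le_trans (hu m n).
  apply: le_trans (normc_ge_Re (u m - u n)); rewrite /re.
  by case: (u m) => ? ?; case: (u n) => ? ? /=.
have [b hb] : exists l, forall (n : nat) e, 0 < e -> exists N, forall k, (N <= k)%N -> real_complex R `|im k - l| <= e.
  apply: key => m n; apply: le_trans (hu m n).
  have := normc_ge_Re ((u m - u n) * (Complex 0 (-1))); rewrite normrM.
  have -> : `|Complex 0 (-1 : R)| = 1 :> C.
    by rewrite normc_def/= expr0n add0r sqrrN expr1n sqrtr1.
  have -> : complex.Re ((u m - u n) * Complex 0 (-1)) = im m - im n.
    by rewrite /im; case: (u m) => ? ?; case: (u n) => ? ? /=; ring.
  by rewrite mulr1.
exists (Complex a b) => n; apply/ler_addgt0Pr => e e0.
have e3 : 0 < e / 3%:R by rewrite divr_gt0// ltr0Sn.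
have [N1 h1] := ha 0%N _ e3; have [N2 h2] := hb 0%N _ e3; have [N3 h3] := rate_lt e3.
set k := maxn N1 (maxn N2 N3).
have kl : `|u k - Complex a b| <= e / 3%:R + e / 3%:R.
  have -> : u k - Complex a b = real_complex R (re k - a) + Complex 0 1 * real_complex R (im k - b).
    rewrite /re /im; case: (u k) => x y; apply/eqP; rewrite eq_complex /=.
    by apply/andP; split; apply/eqP; ring.
  rewrite (le_trans (ler_normD _ _))// normrM.
  have -> : `|Complex 0 (1 : R)| = 1 :> C.
    by rewrite normc_def/= expr0n add0r expr1n sqrtr1.
  rewrite mul1r !norm_real_complex lerD// ?h1 ?h2//; first exact: leq_maxl.
  by rewrite (leq_trans (leq_maxl _ _) (leq_maxr _ _)).
have -> : u n - Complex a b = (u n - u k) + (u k - Complex a b) by rewrite addrA addrNK.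
rewrite (le_trans (ler_normD _ _))// (le_trans (lerD (hu _ _) kl))// -addrA lerD2l.
have -> : rate R k + (e / 3%:R + e / 3%:R) <= e = (rate R k <= e / 3%:R).
  by rewrite -lerBrDr; congr (_ <= _); field.
rewrite (le_trans _ (ltW h3))// le_rate_anti//.
by rewrite (leq_trans (leq_maxr _ _) (leq_maxr _ _)).
Qed.

End SeqComplete.

(* A space of functions bounded by a multiple of a weight, closed under weighted
   limits; it serves both for Hilbert space completions (bounded antilinear
   functionals) and for algebras of operators. *)
Record gauge (R : realType) (X : Type) (E : normedModType R[i]) := Gauge {
  gw : X -> R[i];
  gdom : (X -> E) -> Prop;
  gcomplete : seq_complete E;
  gw_ge0 : forall x, 0 <= gw x;
  gdom0 : gdom 0;
  gdomP : forall (a : R[i]) f g, gdom f -> gdom g -> gdom (a *: f + g);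
  gdom_lim : forall (u : nat -> X -> E) f, (forall n, gdom (u n)) ->
    (forall x n, `|u n x - f x| <= gw x * rate R n) -> gdom f }.

Section GaugeSpace.
Variables (R : realType) (X : Type) (E : normedModType R[i]) (G : gauge X E).
Local Notation C := R[i].

Definition gbounded (f : X -> E) (M : C) : Prop :=
  forall x, `|f x| <= M * gw G x.

Definition gmem (f : X -> E) : bool :=
  `[< gdom G f /\ exists2 M : C, 0 <= M & gbounded f M >].

Record gspace := GSpace { gfun :> X -> E; gspace_subproof : gmem gfun }.

HB.instance Definition _ := [isSub for gfun].
HB.instance Definition _ := [Choice of gspace by <:].

Lemma gmem_submod : submod_closed gmem.
Proof.
split=> [|a f g /asboolP[fd [M M0 fM]] /asboolP[gd [N N0 gN]]]; apply/asboolP; split.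
- exact: gdom0.
- by exists 0 => // x; rewrite normr0 mul0r.
- exact: gdomP.
exists (`|a| * M + N) => [|x]; first by rewrite addr_ge0// mulr_ge0.
rewrite mulrDl (le_trans (ler_normD _ _))// lerD//.
by rewrite normrZ -mulrA ler_wpM2l.
Qed.

HB.instance Definition _ :=
  GRing.isSubmodClosed.Build R[i] (X -> E) gmem gmem_submod.
HB.instance Definition _ := [SubChoice_isSubLmodule of gspace by <:].

Lemma gspace_eq (f g : gspace) : (forall x, f x = g x) -> f = g.
Proof. by move=> fg; apply/val_inj/funext. Qed.

Lemma gfunD (f g : gspace) x : (f + g) x = f x + g x. Proof. by []. Qed.
Lemma gfunB (f g : gspace) x : (f - g) x = f x - g x. Proof. by []. Qed.
Lemma gfunZ a (f : gspace) x : (a *: f) x = a *: f x. Proof. by []. Qed.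

Lemma gspace_dom (f : gspace) : gdom G f.
Proof. by have /asboolP[] := gspace_subproof f. Qed.

Let bset (f : gspace) : set R :=
  [set m : R | 0 <= m /\ gbounded f (real_complex R m)]%classic.

Definition gnorm (f : gspace) : C := real_complex R (inf (bset f)).

Let bset_inf f : has_inf (bset f).
Proof.
have /asboolP[_ [M M0 fM]] := gspace_subproof f.
split; last by exists 0 => m [].
exists (complex.Re M); rewrite /bset /=; split; last by rewrite -ge0_ReE.
by rewrite -lecR -ge0_ReE.
Qed.

Lemma gnorm_ge0 f : 0 <= gnorm f.
Proof.
rewrite -[0]/(real_complex R 0) lecR.
by have [ne _] := bset_inf f; apply: lb_le_inf => // m [].
Qed.

Lemma gnorm_ge (f : gspace) x : `|f x| <= gnorm f * gw G x.
Proof.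
apply: (@ler_rate _ _ _ (gw G x)) => n; rewrite [gw G x * _]mulrC -mulrDl.
have e0 : 0 < complex.Re (rate R n) by rewrite -ltcR -gt0_ReE ?rate_gt0.
have [m [m0 fm] lm] := inf_adherent e0 (bset_inf f).
apply: le_trans (fm x) _; rewrite ler_wpM2r ?gw_ge0//.
by rewrite (gt0_ReE (rate_gt0 R n)) -rmorphD /= lecR ltW.
Qed.

Lemma gnorm_le (f : gspace) M : 0 <= M -> gbounded f M -> gnorm f <= M.
Proof.
move=> M0 fM; rewrite (ge0_ReE M0) lecR; apply: ge_inf.
  by have [] := bset_inf f.
by split; [rewrite -lecR -ge0_ReE | rewrite -ge0_ReE].
Qed.

Let gnormD (f g : gspace) : gnorm (f + g) <= gnorm f + gnorm g.
Proof.
apply: gnorm_le => [|x]; first by rewrite addr_ge0 ?gnorm_ge0.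
by rewrite mulrDl (le_trans (ler_normD _ _))// lerD ?gnorm_ge.
Qed.

Let gnormZ_le a (f : gspace) : gnorm (a *: f) <= `|a| * gnorm f.
Proof.
apply: gnorm_le => [|x]; first by rewrite mulr_ge0 ?gnorm_ge0.
by rewrite normrZ -mulrA ler_wpM2l ?gnorm_ge.
Qed.

Let gnormZ a (f : gspace) : gnorm (a *: f) = `|a| * gnorm f.
Proof.
apply/eqP; rewrite eq_le gnormZ_le /=; have [->|a0] := eqVneq a 0.
  by rewrite normr0 mul0r gnorm_ge0.
by rewrite -ler_pdivlMl ?normr_gt0// -{1}[f](scalerK a0) -normfV gnormZ_le.
Qed.

Let gnorm_eq0 (f : gspace) : gnorm f = 0 -> f = 0.
Proof.
move=> f0; apply: gspace_eq => x; apply/eqP; rewrite -normr_le0.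
by rewrite (le_trans (gnorm_ge f x))// f0 mul0r.
Qed.

HB.instance Definition _ :=
  Lmodule_isNormed.Build C gspace gnormD gnormZ gnorm_eq0.


Lemma gspace_normP (f : gspace) x : `|f x| <= `|f| * gw G x.
Proof. exact: gnorm_ge. Qed.

Lemma gspace_norm_le (f : gspace) M :
  0 <= M -> (forall x, `|f x| <= M * gw G x) -> `|f| <= M.
Proof. exact: gnorm_le. Qed.

Lemma gspace_seq_complete : seq_complete gspace.
Proof.
move=> u hu.
have ul x : exists y, forall n, `|u n x - y| <= gw G x * rate R n.
  apply: (seq_complete_scaled (gcomplete G) (gw_ge0 G x)) => m n.
  by rewrite mulrC (le_trans (gspace_normP (u m - u n) x))// ler_wpM2r ?gw_ge0.
have [l hl] := choice ul.
have lm : gmem l.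
  apply/asboolP; split.
    by apply: (gdom_lim (fun n => gspace_dom (u n))).
  exists (`|u 0%N| + rate R 0) => [|x]; first by rewrite addr_ge0 ?rate_ge0.
  have -> : l x = u 0%N x - (u 0%N x - l x) by rewrite opprB addrC addrNK.
  rewrite (le_trans (ler_normB _ _))// mulrDl lerD ?gspace_normP//.
  by rewrite mulrC hl.
exists (GSpace lm) => n; apply: gspace_norm_le => [|x]; first exact: rate_ge0.
by rewrite mulrC hl.
Qed.

HB.instance Definition _ :=
  Uniform_isComplete.Build gspace (seq_complete_cauchy gspace_seq_complete).

End GaugeSpace.

(** * Positive sesquilinear forms and the Cauchy-Schwarz inequality *)

Section Sesquilinear.
Variables (R : realType) (V : lmodType R[i]).
Local Notation C := R[i].
Implicit Types (B : V -> V -> C) (x y z : V) (a : C).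

Definition sesquiform B : Prop :=
  (forall a x y z, B (a *: x + y) z = a * B x z + B y z) /\
  (forall a x y z, B z (a *: x + y) = a^* * B z x + B z y).

Definition psd B : Prop := forall x, 0 <= B x x.

Section Sesqui.
Variables (B : V -> V -> C) (hB : sesquiform B).

Lemma sesquiDl x y z : B (x + y) z = B x z + B y z.
Proof. by have := hB.1 1 x y z; rewrite scale1r mul1r. Qed.
Lemma sesquiDr x y z : B z (x + y) = B z x + B z y.
Proof. by have := hB.2 1 x y z; rewrite scale1r conjC1 mul1r. Qed.
Lemma sesqui0l z : B 0 z = 0.
Proof. by apply: (addrI (B 0 z)); rewrite -sesquiDl !addr0. Qed.
Lemma sesqui0r z : B z 0 = 0.
Proof. by apply: (addrI (B z 0)); rewrite -sesquiDr !addr0. Qed.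
Lemma sesquiZl a x z : B (a *: x) z = a * B x z.
Proof. by have := hB.1 a x 0 z; rewrite sesqui0l !addr0. Qed.
Lemma sesquiZr a x z : B z (a *: x) = a^* * B z x.
Proof. by have := hB.2 a x 0 z; rewrite sesqui0r !addr0. Qed.
Lemma sesquiNl x z : B (- x) z = - B x z.
Proof. by rewrite -scaleN1r sesquiZl mulN1r. Qed.
Lemma sesquiNr x z : B z (- x) = - B z x.
Proof. by rewrite -scaleN1r sesquiZr rmorphN1 mulN1r. Qed.
Lemma sesquiBl x y z : B (x - y) z = B x z - B y z.
Proof. by rewrite sesquiDl sesquiNl. Qed.
Lemma sesquiBr x y z : B z (x - y) = B z x - B z y.
Proof. by rewrite sesquiDr sesquiNr. Qed.
Lemma sesqui_suml I r (P : pred I) (F : I -> V) z :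
  B (\sum_(i <- r | P i) F i) z = \sum_(i <- r | P i) B (F i) z.
Proof.
by elim/big_rec2: _ => [|i y x _ <-]; rewrite ?sesqui0l// sesquiDl.
Qed.
Lemma sesqui_sumr I r (P : pred I) (F : I -> V) z :
  B z (\sum_(i <- r | P i) F i) = \sum_(i <- r | P i) B z (F i).
Proof.
by elim/big_rec2: _ => [|i y x _ <-]; rewrite ?sesqui0r// sesquiDr.
Qed.

Hypothesis Bpos : psd B.

(** Positivity at [u + v], [u] and [v] makes [B u v + B v u] real. The pairs [x, y] and [x, 'i *: y]
    then give the two halves of the identity. *)
Lemma psd_herm x y : B y x = (B x y)^*.
Proof.
have pol u v : B u v + B v u \is Num.real.
  have := ger0_real (Bpos (u + v)).
  rewrite sesquiDl !sesquiDr => r.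
  have -> : B u v + B v u = B u u + B u v + (B v u + B v v) - B u u - B v v by ring.
  by rewrite !rpredB// ger0_real ?Bpos.
have /CrealP e1 := pol x y; have /CrealP e2 := pol x ('i *: y).
rewrite sesquiZl sesquiZr conjCi in e2.
rewrite rmorphD /= in e1; rewrite rmorphD !rmorphM rmorphN /= conjCi opprK in e2.
have {}e2 : (B x y)^* - (B y x)^* = B y x - B x y.
  by apply: (mulfI (neq0Ci C)); rewrite -[RHS]opprK; transitivity ('i * (B x y)^* + - 'i * (B y x)^*);
    [ring | rewrite e2; ring].
apply: (mulfI (_ : 2 != 0 :> C)); first by rewrite pnatr_eq0.
transitivity (B x y + B y x + (B y x - B x y)); first by ring.
by rewrite -e1 -e2; ring.
Qed.

Lemma psd_CS x y : `|B x y| ^+ 2 <= B x x * B y y.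
Proof.
apply: (@ler_rate _ _ _ (B x x)) => n; rewrite -mulrDr.
(* The usual minimiser divides by [B y y], which may vanish for a semi-inner product; hence the
   shift, which [ler_rate] removes. *)
set b := B y y + rate R n.
have b0 : 0 < b by rewrite ltr_wpDl ?rate_gt0 ?Bpos.
rewrite -ler_pdivrMr// -subr_ge0.
have := Bpos (x - (B x y / b) *: y).
rewrite !(sesquiBl, sesquiBr, sesquiZl, sesquiZr) (psd_herm x y) rmorphM /= fmorphV /=.
rewrite (conj_Creal (gtr0_real b0)) normCK => h.
apply: le_trans h _; rewrite -subr_ge0.
suff -> : B x x - B x y * (B x y)^* / b -
  (B x x - (B x y)^* / b * B x y - B x y / b * ((B x y)^* - (B x y)^* / b * B y y))
  = (B x y * (B x y)^*) * rate R n / b ^+ 2.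
  by rewrite mulr_ge0 ?invr_ge0 ?exprn_ge0 ?(ltW b0)// mulr_ge0 ?rate_ge0 ?mul_conjC_ge0.
have -> : rate R n = b - B y y by rewrite /b; ring.
by field; rewrite lt0r_neq0.
Qed.

Definition snorm x : C := sqrtC (B x x).

Lemma snorm_ge0 x : 0 <= snorm x.
Proof. by rewrite sqrtC_ge0. Qed.

Lemma snormK x : snorm x ^+ 2 = B x x.
Proof. exact: sqrtCK. Qed.

Lemma psd_CS_norm x y : `|B x y| <= snorm x * snorm y.
Proof.
rewrite -ler_sqr ?nnegrE ?mulr_ge0 ?snorm_ge0// exprMn !snormK.
exact: psd_CS.
Qed.

Lemma snormZ a x : snorm (a *: x) = `|a| * snorm x.
Proof.
apply/eqP; rewrite -(@eqrXn2 _ 2) ?mulr_ge0 ?snorm_ge0//.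
by rewrite exprMn !snormK sesquiZl sesquiZr mulrA normCK.
Qed.

End Sesqui.
End Sesquilinear.

(** * The Hilbert space of a semi-inner product *)

(* The completion of a space under a semi-inner product is realised as the space
   of bounded antilinear functionals; [sip_ray] sends [x] to [B x]. *)
Section SipHilbert.
Variables (R : realType) (V : lmodType R[i]) (B : V -> V -> R[i]).
Local Notation C := R[i].
Hypotheses (hB : sesquiform B) (Bpos : psd B).

Let adom (f : V -> C^o) : Prop := forall a x y, f (a *: x + y) = a^* * f x + f y.

Let adom0 : adom 0.
Proof. by move=> a x y; rewrite /= mulr0 addr0. Qed.

Let adomP (a : C) f g : adom f -> adom g -> adom (a *: f + g).
Proof.
move=> fd gd c x y; rewrite !fctE fd gd.
by rewrite /GRing.scale /=; ring.
Qed.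

Let adom_lim (u : nat -> V -> C^o) f : (forall n, adom (u n)) ->
  (forall x n, `|u n x - f x| <= snorm B x * rate R n) -> adom f.
Proof.
move=> ud uf a x y.
apply: (@eq_limit _ _ _ (snorm B (a *: x + y) + `|a| * snorm B x + snorm B y)) => n.
have -> : f (a *: x + y) - (a^* * f x + f y) =
  - (u n (a *: x + y) - f (a *: x + y)) + a^* * (u n x - f x) + (u n y - f y).
  by rewrite ud; ring.
rewrite (le_trans (ler_normD _ _))// mulrDl lerD//.
rewrite (le_trans (ler_normD _ _))// mulrDl lerD ?normrN//.
by rewrite normrM norm_conjC -mulrA ler_wpM2l.
Qed.

Definition sip_gauge : gauge V (C^o : normedModType C) :=
  Gauge (@complex_seq_complete R) (snorm_ge0 Bpos) adom0 adomP adom_lim.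

Definition sip_space := gspace sip_gauge.
Implicit Types f g h : sip_space.

Lemma sip_funP f a x y : f (a *: x + y) = a^* * f x + f y.
Proof. exact: (gspace_dom f). Qed.

Lemma sip_fun0 f : f 0 = 0.
Proof.
have := sip_funP f 1 0 0; rewrite scale1r addr0 conjC1 mul1r => f00.
by apply: (addrI (f 0)); rewrite -f00 addr0.
Qed.

Lemma sip_funD f x y : f (x + y) = f x + f y.
Proof. by rewrite -[x]scale1r sip_funP conjC1 scale1r mul1r. Qed.

Lemma sip_funZ f a x : f (a *: x) = a^* * f x.
Proof. by rewrite -[a *: x]addr0 sip_funP sip_fun0 addr0. Qed.

Lemma sip_norm_ge f x : `|f x| <= `|f| * snorm B x.
Proof. exact: gspace_normP. Qed.

Lemma sip_norm_le f (M : C) : 0 <= M -> (forall x, `|f x| <= M * snorm B x) -> `|f| <= M.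
Proof. exact: gspace_norm_le. Qed.

Lemma sip_memP (f : V -> C) (M : C) : 0 <= M ->
  (forall a x y, f (a *: x + y) = a^* * f x + f y) ->
  (forall x, `|f x| <= M * snorm B x) -> gmem sip_gauge f.
Proof. by move=> M0 fl fM; apply/asboolP; split=> //; exists M. Qed.

Lemma sip_ray_mem x : gmem sip_gauge (B x).
Proof.
apply: (sip_memP (snorm_ge0 Bpos x)) => [a y z|y]; first exact: hB.2.
exact: psd_CS_norm.
Qed.

Definition sip_ray x : sip_space := GSpace (sip_ray_mem x).
Local Notation j := sip_ray.

Lemma sip_ray_linear a x y : j (a *: x + y) = a *: j x + j y.
Proof. by apply: gspace_eq => z; rewrite gfunD gfunZ /= hB.1. Qed.


Lemma sip_ray_norm x : `|j x| = snorm B x.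
Proof.
apply/eqP; rewrite eq_le; apply/andP; split.
  by apply: sip_norm_le => [|y]; [exact: snorm_ge0 | exact: psd_CS_norm].
have [->//|xn0] := eqVneq (snorm B x) 0.
have x0 : 0 < snorm B x by rewrite lt_def xn0 snorm_ge0.
rewrite -(ler_pM2r x0) -expr2 (le_trans _ (sip_norm_ge _ x))// snormK.
by rewrite ger0_norm ?Bpos.
Qed.

Let sip_norm_attained f e : 0 < e -> e < `|f| ->
  exists y, [/\ B y y = 1, 0 <= f y & `|f| - e <= f y].
Proof.
move=> e0 ef.
have [y hy] : exists y, ~ `|f y| <= (`|f| - e) * snorm B y.
  apply: contrapT => h; have : `|f| <= `|f| - e.
    apply: sip_norm_le; first by rewrite subr_ge0 ltW.
    by move=> x; apply: contrapT => hx; apply: h; exists x.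
  by rewrite -subr_ge0 addrAC subrr sub0r oppr_ge0 lt_geF.
have y0 : snorm B y != 0.
  apply/eqP => y0; apply: hy; have := sip_norm_ge f y.
  by rewrite y0 !mulr0.
have yp : 0 < snorm B y by rewrite lt_def y0 snorm_ge0.
have fy0 : f y != 0.
  apply/eqP => fy; apply: hy; rewrite fy normr0 mulr_ge0 ?snorm_ge0//.
  by rewrite subr_ge0 ltW.
have fyp : 0 < `|f y| by rewrite normr_gt0.
pose a := f y / (`|f y| * snorm B y).
have fa : f (a *: y) = `|f y| / snorm B y.
  rewrite sip_funZ /a rmorphM fmorphV /= rmorphM /= (conj_Creal (gtr0_real yp)).
  rewrite (conj_Creal (gtr0_real fyp)).
  transitivity ((f y * (f y)^*) / (`|f y| * snorm B y)); first by ring.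
  by rewrite -normCK; field; rewrite y0 lt0r_neq0.
exists (a *: y); split.
- rewrite -snormK//; have -> : snorm B (a *: y) = 1; last by rewrite expr1n.
  rewrite snormZ// /a normrM normfV normrM normr_id (gtr0_norm yp).
  by field; rewrite y0 lt0r_neq0.
- by rewrite fa divr_ge0 ?ltW.
rewrite fa ler_pdivlMr//.
have r : `|f y| \is Num.real by rewrite normr_real.
have r' : (`|f| - e) * snorm B y \is Num.real.
  by rewrite rpredM ?rpredB ?normr_real// gtr0_real.
by case: (real_leP r r') hy => // /ltW.
Qed.

Let conj_aux (a t g M p : C) :
  a \is Num.real -> t \is Num.real -> g \is Num.real -> M \is Num.real ->
  (a + t * (g + M * p))^* = a + t * (g + M * p^*).
Proof.
move=> ar tr gr Mr.
by rewrite rmorphD /= rmorphM /= rmorphD /= rmorphM /= (conj_Creal ar) (conj_Creal tr) (conj_Creal gr) (conj_Creal Mr).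
Qed.

Let unit_conj (w : C) : w != 0 -> (w / `|w|)^* * w = `|w|.
Proof.
move=> w0; have nw : `|w| != 0 by rewrite normr_eq0.
rewrite rmorphM fmorphV /= (conj_Creal (normr_real _)).
transitivity ((w * w^*) / `|w|); first by ring.
by rewrite -normCK; field.
Qed.

(** An approximate Riesz argument. If a unit vector [y] almost attains the norm [M] of [f], the
    bound of [f] by [M] times the seminorm along [y + t *: z] forces [f] to be close to
    [M *: j y]. *)
Lemma sip_ray_dense f n : exists x, `|f - j x| <= rate R n.
Proof.
set M := `|f|.
case: (real_leP (normr_real f) (gtr0_real (rate_gt0 R n))) => [fn|nf].
  exists 0; have -> : j 0 = 0 by apply: gspace_eq => y; rewrite /= sesqui0l.
  by rewrite subr0.
have M0 : 0 < M by apply: lt_trans nf; exact: rate_gt0.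
(* [f y] may fall short of [M] by [d ^+ 2]. The resulting error is [d * (1 + M)], which this choice
   makes equal to [rate R n]. *)
pose d := rate R n / (1 + M).
have M1 : 0 < 1 + M by rewrite ltr_wpDl.
have d0 : 0 < d by rewrite divr_gt0 ?rate_gt0.
have dr : d <= rate R n.
  by rewrite ler_pdivrMr// ler_peMr ?rate_ge0// lerDl ltW.
have r1 : rate R n <= 1 by rewrite invf_le1 ?ltr0Sn// ler1n.
have d2 : d ^+ 2 < M.
  apply: le_lt_trans nf; rewrite expr2 (le_trans _ dr)// ler_piMr ?(ltW d0)//.
  exact: le_trans dr r1.
have [y [yy fy fM]] := sip_norm_attained (exprn_gt0 2 d0) d2.
exists (M *: y); have jM : j (M *: y) = M *: j y.
  by rewrite -[M *: y]addr0 sip_ray_linear (_ : j 0 = 0) ?addr0//; apply: gspace_eq => z; rewrite /= sesqui0l.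
rewrite jM; set g := f - M *: j y.
have key z : 0 <= g z -> g z <= (d * (1 + M)) * snorm B z.
  move=> gz; have [z0|z0] := eqVneq (snorm B z) 0.
    have := sip_norm_ge g z; rewrite z0 !mulr0 normr_le0 => /eqP ->; exact: lexx.
  have zp : 0 < snorm B z by rewrite lt_def z0 snorm_ge0.
  (* After division by [t], this step length balances the defect [d ^+ 2 / t] against the second
     order term, which is proportional to [t]. *)
  pose t := d / snorm B z; have t0 : 0 < t by rewrite divr_gt0.
  pose bz : C := (B y z + B z y) / 2.
  have zy : B z y = (B y z)^* by rewrite (psd_herm hB Bpos y z).
  have bzr : bz \is Num.real.
    by apply/CrealP; rewrite /bz rmorphM fmorphV rmorphD /= conjC_nat zy conjCK addrC.
  pose a := t * bz + t ^+ 2 * B z z / 2.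
  have ar : a \is Num.real.
    apply: rpredD; first by apply: rpredM => //; exact: gtr0_real.
    by rewrite ger0_real// divr_ge0 ?ler0n// mulr_ge0// exprn_ge0// ltW.
  have sq : B (y + t *: z) (y + t *: z) = 1 + 2 * a.
    rewrite (sesquiDl hB) !(sesquiDr hB) !(sesquiZl hB) !(sesquiZr hB) (conj_Creal (gtr0_real t0)) yy.
    by rewrite /a /bz; field.
  have s0 : snorm B (y + t *: z) <= 1 + a.
    have a0 : 0 <= 1 + a.
      have : 0 <= 1 + 2 * a by rewrite -sq.
      move=> h; have -> : 1 + a = (1 + (1 + 2 * a)) / 2 by field.
      by rewrite divr_ge0 ?ler0n// addr_ge0.
    rewrite -ler_sqr ?nnegrE ?snorm_ge0// snormK sq -subr_ge0.
    have -> : (1 + a) ^+ 2 - (1 + 2 * a) = a ^+ 2 by ring.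
    by rewrite -realEsqr.
  have fe : f (y + t *: z) = f y + t * f z.
    by rewrite sip_funD sip_funZ (conj_Creal (gtr0_real t0)).
  have fz : f z = g z + M * B y z by rewrite /g gfunB gfunZ /GRing.scale/= subrK.
  have ineq : t * g z <= d ^+ 2 + M * (t ^+ 2 * B z z / 2).
    have h1 : f y + t * g z + M * t * bz <= M * (1 + a).
      have h2 : f y + t * g z + M * t * bz =
          (f (y + t *: z) + (f (y + t *: z))^*) / 2.
        have -> : (f (y + t *: z))^* = f y + t * (g z + M * B z y).
          rewrite fe fz zy; apply: conj_aux; first exact: ger0_real.
          - exact: gtr0_real.
          - exact: ger0_real.
          - exact: gtr0_real.
        by rewrite fe fz /bz; field.
      rewrite h2; apply: le_trans (_ : `|f (y + t *: z)| <= _); last first.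
        apply: le_trans (sip_norm_ge _ _) _; rewrite ler_wpM2l//.
      rewrite ler_pdivrMr ?ltr0Sn//.
      have nr : f (y + t *: z) + (f (y + t *: z))^* \is Num.real.
        by apply/CrealP; rewrite rmorphD /= conjCK addrC.
      apply: le_trans (real_ler_norm nr) _; apply: le_trans (ler_normD _ _) _.
      by rewrite norm_conjC mulr_natr mulr2n.
    have h3 : M - d ^+ 2 + t * g z + M * t * bz <= M * (1 + a).
      by apply: le_trans h1; rewrite !lerD2r.
    move: h3; rewrite -subr_ge0 => h3; rewrite -subr_ge0.
    by apply: le_trans h3 _; rewrite le_eqVlt; apply/orP; left; apply/eqP; rewrite /a; ring.
  have tz : t * snorm B z = d by rewrite /t divfK.
  rewrite -(ler_pM2l t0) (le_trans ineq)//.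
  rewrite [leRHS]mulrCA tz -(snormK B z) -exprMn ?tz.
  rewrite mulrA.
  have -> : d * (1 + M) * d = d ^+ 2 + M * d ^+ 2 by ring.
  rewrite lerD2l ler_pdivrMr ?ltr0Sn// ler_peMr// ?ler1n//.
  by rewrite mulr_ge0 ?exprn_ge0 ?ltW.
have dM : d * (1 + M) = rate R n by rewrite /d divfK ?lt0r_neq0.
apply: sip_norm_le => [|z]; first exact: rate_ge0.
have [->|gz0] := eqVneq (g z) 0.
  by rewrite normr0 mulr_ge0 ?rate_ge0 ?snorm_ge0.
(* Rotating [z] by the phase of [g z] makes the value nonnegative, as [key] requires. *)
pose u := g z / `|g z|.
have gu : g (u *: z) = `|g z|.
  by rewrite sip_funZ; exact: (unit_conj gz0).
have := key (u *: z); rewrite gu dM => /(_ (normr_ge0 _)) h.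
apply: le_trans h _; rewrite snormZ// /u normrM normfV normr_id divff ?normr_eq0// mul1r.
exact: lexx.
Qed.

End SipHilbert.

Section SipDot.
Variables (R : realType) (V : lmodType R[i]) (B : V -> V -> R[i]).
Local Notation C := R[i].
Hypotheses (hB : sesquiform B) (Bpos : psd B).
Local Notation H := (sip_space Bpos).
Local Notation j := (sip_ray hB Bpos).
Implicit Types f g h : H.

(** Polarisation of the norm, which is all that the gauge construction provides. On rays it gives
    back [B], and its algebraic properties then pass to the limit along approximating rays. *)
Definition sip_dot f g : C :=
  (`|f + g| ^+ 2 - `|f - g| ^+ 2 + 'i * `|f + 'i *: g| ^+ 2
   - 'i * `|f - 'i *: g| ^+ 2) / 4%:R.

Lemma sip_ray_normK x : `|j x| ^+ 2 = B x x.
Proof. by rewrite sip_ray_norm snormK. Qed.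

Let jD x y : j (x + y) = j x + j y.
Proof. by rewrite -[x in LHS]scale1r sip_ray_linear scale1r. Qed.
Let j0 : j 0 = 0.
Proof. by apply: (addrI (j 0)); rewrite -jD !addr0. Qed.
Let jZ a x : j (a *: x) = a *: j x.
Proof. by rewrite -[a *: x]addr0 sip_ray_linear j0 addr0. Qed.
Let jN x : j (- x) = - j x.
Proof. by rewrite -scaleN1r jZ scaleN1r. Qed.

Let sip_dot_ray x y : sip_dot (j x) (j y) = B x y.
Proof.
rewrite /sip_dot -!jZ -!jN -!jD !sip_ray_normK.
rewrite !(sesquiDl hB) !(sesquiDr hB) !(sesquiNl hB) !(sesquiNr hB)
  !(sesquiZl hB) !(sesquiZr hB) conjCi.
have i2 : 'i * 'i = -1 :> C by rewrite -expr2 sqrCi.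
transitivity ((2 * B x y + 2 * B y x - 2 * ('i * 'i) * B x y + 2 * ('i * 'i) * B y x) / 4%:R).
  by field.
by rewrite i2; field.
Qed.

Let normsq_approx h h' (K r : C) : `|h| <= K -> `|h'| <= K -> `|h - h'| <= r ->
  `|(`|h| ^+ 2 - `|h'| ^+ 2)| <= 2 * K * r.
Proof.
move=> hK hK' hr; rewrite subr_sqr normrM mulrC.
apply: ler_pM => //; first by rewrite ger0_norm ?addr_ge0// mulr2n mulrDl mul1r lerD.
exact: le_trans (ler_dist_dist _ _) hr.
Qed.

Let four_terms (p1 p2 p3 p4 q1 q2 q3 q4 D : C) :
  `|p1 - q1| <= D -> `|p2 - q2| <= D -> `|p3 - q3| <= D -> `|p4 - q4| <= D ->
  `|(p1 - p2 + 'i * p3 - 'i * p4) / 4%:R - (q1 - q2 + 'i * q3 - 'i * q4) / 4%:R| <= D.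
Proof.
move=> h1 h2 h3 h4; rewrite -mulrBl normrM normfV (ger0_norm (ler0n C 4)).
rewrite ler_pdivrMr ?ltr0Sn//.
have -> : p1 - p2 + 'i * p3 - 'i * p4 - (q1 - q2 + 'i * q3 - 'i * q4) =
  (p1 - q1) - (p2 - q2) + 'i * (p3 - q3) - 'i * (p4 - q4) by ring.
have -> : D * 4%:R = D + D + D + D by ring.
rewrite (le_trans (ler_normB _ _))// lerD ?normrM ?normCi ?mul1r//.
rewrite (le_trans (ler_normD _ _))// lerD ?normrM ?normCi ?mul1r//.
by rewrite (le_trans (ler_normB _ _))// lerD.
Qed.

Let sip_dot_approx f g x y k n : 0 <= k ->
  `|f - j x| <= k * rate R n -> `|g - j y| <= k * rate R n ->
  `|sip_dot f g - B x y| <= (4%:R * (`|f| + `|g| + 2 * k) * k) * rate R n.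
Proof.
move=> k0 fx gy; rewrite -sip_dot_ray /sip_dot.
set r := k * rate R n.
have rk : r <= k.
  by rewrite ler_piMr// invf_le1 ?ltr0Sn// ler1n.
set K := `|f| + `|g| + 2 * k.
have le_j (u : H) z : `|u - j z| <= r -> `|j z| <= `|u| + k.
  move=> uz; have -> : j z = u - (u - j z) by rewrite opprB addrC addrNK.
  by rewrite (le_trans (ler_normB _ _))// lerD2l (le_trans uz).
have key (u : C) : `|u| = 1 ->
    `|(`|f + u *: g| ^+ 2 - `|j x + u *: j y| ^+ 2)| <= 4%:R * K * r.
  move=> u1; have -> : 4%:R * K * r = 2 * K * (r + r) by ring.
  apply: normsq_approx.
  - rewrite (le_trans (ler_normD _ _))// normrZ u1 mul1r /K lerDl.
    by rewrite mulr_ge0 ?ler0n.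
  - rewrite (le_trans (ler_normD _ _))// normrZ u1 mul1r /K.
    rewrite mulr2n mulrDl mul1r addrACA.
    by apply: lerD; exact: le_j.
  rewrite opprD addrACA -scalerBr (le_trans (ler_normD _ _))//.
  by rewrite normrZ u1 mul1r lerD.
have k1 := key 1 (normr1 _); have k2 := key (-1); have k3 := key 'i (normCi _).
have k4 := key (- 'i).
rewrite !scale1r in k1; rewrite !scaleN1r normrN1 in k2; rewrite !scaleNr normrN normCi in k4.
have {}k2 := k2 erefl; have {}k4 := k4 erefl.
have -> : 4%:R * K * k * rate R n = 4%:R * K * r by rewrite /r mulrA.
exact (four_terms k1 k2 k3 k4).
Qed.

Lemma sip_dot_limit f g x y n :
  `|f - j x| <= rate R n -> `|g - j y| <= rate R n ->
  `|sip_dot f g - B x y| <= (4%:R * (`|f| + `|g| + 2)) * rate R n.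
Proof.
move=> fx gy; have := @sip_dot_approx f g x y 1 n ler01.
by rewrite !mul1r !mulr1; apply.
Qed.

Let three_terms (p a q r c d D1 D2 D3 t : C) : `|p - (a * c + d)| <= D1 * t ->
  `|q - c| <= D2 * t -> `|r - d| <= D3 * t ->
  `|p - (a * q + r)| <= (D1 + `|a| * D2 + D3) * t.
Proof.
move=> h1 h2 h3; rewrite 2!mulrDl -mulrA.
have -> : p - (a * q + r) = (p - (a * c + d)) - a * (q - c) - (r - d) by ring.
rewrite (le_trans (ler_normB _ _))// lerD//.
rewrite (le_trans (ler_normB _ _))// lerD//.
by rewrite normrM ler_wpM2l.
Qed.

Let conj_sub (p q : C) : `|p^* - q^*| = `|p - q|.
Proof. by rewrite -rmorphB norm_conjC. Qed.

Let conj_terms (p q c d D1 D2 t : C) : d = c^* -> `|p - c| <= D1 * t ->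
  `|q - d| <= D2 * t -> `|p - q^*| <= (D1 + D2) * t.
Proof.
move=> -> h1 h2; rewrite mulrDl; have -> : p - q^* = (p - c) - (q - c^*)^*.
  by rewrite rmorphB /= conjCK; ring.
by rewrite (le_trans (ler_normB _ _))// norm_conjC lerD.
Qed.

Lemma sip_dot_linear a f g h :
  sip_dot (a *: f + g) h = a * sip_dot f h + sip_dot g h.
Proof.
(* [a *: x + y] approximates [a *: f + g] only up to this multiple of the rate, which is why
   [sip_dot_approx] carries a constant. *)
pose k := `|a| + 1; have k1 : 1 <= k by rewrite lerDr.
have k0 : 0 <= k by rewrite (le_trans ler01).
pose K1 := 4%:R * (`|a *: f + g| + `|h| + 2 * k) * k.
pose K2 := 4%:R * (`|f| + `|h| + 2); pose K3 := 4%:R * (`|g| + `|h| + 2).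
apply: (@eq_limit _ _ _ (K1 + `|a| * K2 + K3)) => n.
have [x fx] := sip_ray_dense hB f n; have [y gy] := sip_ray_dense hB g n.
have [z hz] := sip_ray_dense hB h n.
have e1 := sip_dot_limit fx hz; have e2 := sip_dot_limit gy hz.
have {}hz : `|h - j z| <= k * rate R n.
  by rewrite (le_trans hz)// ler_peMl ?rate_ge0.
have fgx : `|a *: f + g - j (a *: x + y)| <= k * rate R n.
  rewrite sip_ray_linear opprD addrACA -scalerBr (le_trans (ler_normD _ _))//.
  rewrite /k mulrDl mul1r; apply: lerD => //.
  by rewrite normrZ; exact: ler_wpM2l.
have e3 := sip_dot_approx k0 fgx hz.
rewrite hB.1 in e3; exact (three_terms e3 e1 e2).
Qed.

Lemma sip_dot_herm f g : sip_dot f g = (sip_dot g f)^*.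
Proof.
pose K1 := 4%:R * (`|f| + `|g| + 2); pose K2 := 4%:R * (`|g| + `|f| + 2).
apply: (@eq_limit _ _ _ (K1 + K2)) => n.
have [x fx] := sip_ray_dense hB f n; have [y gy] := sip_ray_dense hB g n.
have e1 := sip_dot_limit fx gy; have e2 := sip_dot_limit gy fx.
exact: (conj_terms (psd_herm hB Bpos x y) e1 e2).
Qed.

Lemma sip_dot_normE f : `|f| ^+ 2 = sip_dot f f.
Proof.
have i1 : `|1 + 'i : C| ^+ 2 = `|1 - 'i : C| ^+ 2.
  by rewrite -[in RHS]conjCi -[1 in RHS]conjC1 -rmorphD norm_conjC.
have e : forall u : C, `|f + u *: f| ^+ 2 = `|1 + u| ^+ 2 * `|f| ^+ 2.
  by move=> u; rewrite -{1}[f]scale1r -scalerDl normrZ exprMn.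
have e1 : `|f + f| = 2 * `|f| by rewrite -mulr2n normrMn mulr_natl.
have e2 : `|f - f| = 0 by rewrite subrr normr0.
have e3 := e 'i; have e4 := e (- 'i); rewrite scaleNr in e4.
rewrite /sip_dot e1 e2 e3 e4 i1; move: (`|f|) (`|1 - 'i| ^+ 2) => N M.
by field.
Qed.

Lemma sip_dotl_linear h : GRing.linear_for *%R (sip_dot ^~ h).
Proof. by move=> a f g; rewrite sip_dot_linear. Qed.

Lemma sip_dotr_linear f : GRing.linear_for (conjC \; *%R) (sip_dot f).
Proof.
move=> a g h /=; rewrite (sip_dot_herm f (a *: g + h)) sip_dot_linear rmorphD rmorphM /=.
by rewrite (sip_dot_herm f g) (sip_dot_herm f h).
Qed.

Let sip_dot_hermitian f g : sip_dot f g = (-1) ^+ false * (sip_dot g f)^*.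
Proof. by rewrite expr0 mul1r sip_dot_herm. Qed.

Let sip_dot_gt0 f : f != 0 -> 0 < sip_dot f f.
Proof. by move=> f0; rewrite -sip_dot_normE exprn_gt0// normr_gt0. Qed.

(** The reproducing property: pairings with rays can be computed by evaluating the functional that a
    vector is. *)
Lemma sip_dotr f x : sip_dot f (j x) = f x.
Proof.
pose K1 := 4%:R * (`|f| + `|j x| + 2).
apply: (@eq_limit _ _ _ (K1 + snorm B x)) => n.
have [y fy] := sip_ray_dense hB f n.
have jx : `|j x - j x| <= rate R n by rewrite subrr normr0 rate_ge0.
have e1 := sip_dot_limit fy jx.
have e2 := sip_norm_ge (f - j y) x; rewrite gfunB in e2.
have {}e2 : `|f x - B y x| <= snorm B x * rate R n.
  by rewrite mulrC; apply: le_trans e2 _; rewrite ler_wpM2r ?snorm_ge0.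
rewrite -[f x]conjCK; apply: (conj_terms (erefl (B y x)^*) e1).
by rewrite conj_sub.
Qed.

Definition sip_form : {dot H for conjC} :=
  HB.pack_for (@Dot.type C H conjC) sip_dot
   (bilinear_isBilinear.Build C H H C *%R (conjC \; *%R) sip_dot (sip_dotl_linear, sip_dotr_linear))
   (isHermitianSesquilinear.Build C H false conjC sip_dot sip_dot_hermitian)
   (isDotProduct.Build C H sip_dot sip_dot_gt0).

Definition sip_hilbert : hilbert R := @Hilbert R H sip_form sip_dot_normE.

End SipDot.

(** * Bounded operators, and operators defined by bounded forms *)

Section HilbertFacts.
Variables (R : realType) (H : hilbert R).
Local Notation C := R[i].
Implicit Types (x y z : H) (T : bounded_op H).

Lemma hdot_sesqui : sesquiform (hilb_dot H).
Proof.
split=> [a x y z|a x y z]; first by rewrite linearPl.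
by rewrite linearPr.
Qed.

Lemma hdot_psd : psd (hilb_dot H).
Proof. by move=> x; rewrite -hilb_normE exprn_ge0. Qed.

Lemma hdot_norm_le x y : `|hilb_dot H x y| <= `|x| * `|y|.
Proof.
rewrite -ler_sqr ?nnegrE ?mulr_ge0// exprMn !hilb_normE.
exact: (psd_CS hdot_sesqui hdot_psd).
Qed.

Lemma hdot_herm x y : hilb_dot H y x = (hilb_dot H x y)^*.
Proof. exact: (psd_herm hdot_sesqui hdot_psd). Qed.

Lemma hdot_ext x y : (forall z, hilb_dot H x z = hilb_dot H y z) -> x = y.
Proof.
move=> xy; apply/eqP; rewrite -subr_eq0 -normr_eq0 -sqrf_eq0 hilb_normE.
by rewrite (sesquiBl hdot_sesqui) xy subrr.
Qed.

Lemma bop_linear T a x y : T (a *: x + y) = a *: T x + T y.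
Proof. by have /asboolP[Tl _] := bop_subproof T; exact: Tl. Qed.

Lemma bopD T x y : T (x + y) = T x + T y.
Proof. by have := bop_linear T 1 x y; rewrite !scale1r. Qed.
Lemma bop0 T : T 0 = 0.
Proof. by apply: (addrI (T 0)); rewrite -bopD !addr0. Qed.
Lemma bopZ T a x : T (a *: x) = a *: T x.
Proof. by have := bop_linear T a x 0; rewrite bop0 !addr0. Qed.
Lemma bopN T x : T (- x) = - T x.
Proof. by rewrite -scaleN1r bopZ scaleN1r. Qed.
Lemma bopB T x y : T (x - y) = T x - T y.
Proof. by rewrite bopD bopN. Qed.

Lemma bop_ext T T' : (forall x, T x = T' x) -> T = T'.
Proof. by move=> TT'; apply/val_inj/funext. Qed.

Lemma bop_bound T : exists2 M : C, 0 <= M & forall x, `|T x| <= M * `|x|.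
Proof.
have /asboolP[Tl Tc] := bop_subproof T.
pose f := HB.pack (bop_fun T) (GRing.isLinear.Build _ _ _ _ (bop_fun T) Tl) : {linear H -> H}.
have /linear_boundedP [r [rr hr]] : bounded_near f (nbhs (0 : H)).
  apply: continuous_linear_bounded; exact: (Tc 0).
have k0 : r < `|r| + 1 by rewrite (le_lt_trans (real_ler_norm rr))// ltrDl.
by exists (`|r| + 1); [rewrite addr_ge0 | exact: hr k0].
Qed.

Lemma linear_bounded_op (f : H -> H) (M : C) : linear f -> 0 <= M ->
  (forall x, `|f x| <= M * `|x|) -> is_bounded_op f.
Proof.
move=> fl M0 fM; apply/asboolP; split=> //.
pose g := HB.pack f (GRing.isLinear.Build _ _ _ _ f fl) : {linear H -> H}.
apply: (@bounded_linear_continuous _ _ _ g); apply/linear_boundedP.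
exists M; split=> [|r Mr x]; first exact: ger0_real.
by rewrite (le_trans (fM x))// ler_wpM2r// ltW.
Qed.

Section Dense.
Variables (V : Type) (j : V -> H).
Hypothesis j_dense : forall x n, exists v, `|x - j v| <= rate R n.

Lemma bop_dense_ext T T' :
  (forall u v, hilb_dot H (T (j u)) (j v) = hilb_dot H (T' (j u)) (j v)) -> T = T'.
Proof.
move=> TT'; apply: bop_ext => x; apply: hdot_ext => y.
have [S SE] : exists S : bounded_op H, forall x, S x = T x - T' x by exists (T - T').
have [M M0 hM] := bop_bound S.
rewrite -[T x](subrK (T' x)) (sesquiDl hdot_sesqui) -[RHS]add0r -SE; congr (_ + _).
apply: (@eq_limit _ _ _ (M * (`|y| + 1) + M * `|x|)) => n; rewrite subr0.
have [u xu] := j_dense x n; have [v yv] := j_dense y n.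
have uv : hilb_dot H (S (j u)) (j v) = 0.
  by rewrite SE (sesquiBl hdot_sesqui) TT' subrr.
have -> : hilb_dot H (S x) y =
  hilb_dot H (S (x - j u)) (j v) + hilb_dot H (S x) (y - j v).
  by rewrite bopB (sesquiBl hdot_sesqui) (sesquiBr hdot_sesqui) uv subr0 addrC subrK.
rewrite (le_trans (ler_normD _ _))// mulrDl lerD//.
  rewrite (le_trans (hdot_norm_le _ _))// mulrAC ler_pM//.
    by rewrite (le_trans (hM _))// ler_wpM2l.
  have -> : j v = y - (y - j v) by rewrite opprB addrC subrK.
  rewrite (le_trans (ler_normB _ _))// lerD2l (le_trans yv)//.
  by rewrite invf_le1 ?ltr0Sn// ler1n.
by rewrite (le_trans (hdot_norm_le _ _))// ler_pM.
Qed.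

Lemma bop_psd_dense r (A : 'M[bounded_op H]_r) :
  (forall v : 'I_r -> V,
     0 <= \sum_i \sum_k hilb_dot H (A i k (j (v k))) (j (v i))) ->
  mpos (bop_cones H) A.
Proof.
move=> hA w; have AM i : exists M : 'I_r -> C, forall k, 0 <= M k /\ forall x, `|A i k x| <= M k * `|x|.
  have AM k : exists M : C, 0 <= M /\ forall x, `|A i k x| <= M * `|x|.
    by have [M ? ?] := bop_bound (A i k); exists M.
  by have [M hM] := choice AM; exists M.
have {AM} [M hM] := choice AM.
apply: (@ge0_limit _ _ (\sum_i \sum_k (M i k * (`|w i| + 1) + M i k * `|w k|))) => n.
have [v hv] := choice (fun i => j_dense (w i) n).
exists (\sum_i \sum_k hilb_dot H (A i k (j (v k))) (j (v i))) => //.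
rewrite -sumrB mulr_suml (le_trans (ler_norm_sum _ _ _))//; apply: ler_sum => i _.
rewrite -sumrB mulr_suml (le_trans (ler_norm_sum _ _ _))//; apply: ler_sum => k _.
have [M0 {}hM] := hM i k.
have -> : hilb_dot H (A i k (w k)) (w i) - hilb_dot H (A i k (j (v k))) (j (v i)) =
  hilb_dot H (A i k (w k - j (v k))) (j (v i)) + hilb_dot H (A i k (w k)) (w i - j (v i)).
  by rewrite bopB (sesquiBl hdot_sesqui) (sesquiBr hdot_sesqui) [RHS]addrC addrA subrK.
rewrite (le_trans (ler_normD _ _))// mulrDl lerD//.
  rewrite (le_trans (hdot_norm_le _ _))// mulrAC ler_pM//.
    by rewrite (le_trans (hM _))// ler_wpM2l.
  have -> : j (v i) = w i - (w i - j (v i)) by rewrite opprB addrC subrK.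
  rewrite (le_trans (ler_normB _ _))// lerD2l (le_trans (hv i))//.
  by rewrite invf_le1 ?ltr0Sn// ler1n.
by rewrite (le_trans (hdot_norm_le _ _))// ler_pM.
Qed.

End Dense.
End HilbertFacts.

Section FormOp.
Variables (R : realType) (V : lmodType R[i]) (B : V -> V -> R[i]).
Local Notation C := R[i].
Hypotheses (hB : sesquiform B) (Bpos : psd B).
Local Notation H := (sip_hilbert hB Bpos).
Local Notation j := (sip_ray hB Bpos).

Lemma hdot_ray (f : H) x : hilb_dot H f (j x) = (f : sip_space Bpos) x.
Proof. exact: sip_dotr. Qed.

Definition bounded_form (Q : V -> V -> C) : Prop :=
  sesquiform Q /\ exists2 M : C, 0 <= M &
    forall x y, `|Q x y| <= M * snorm B x * snorm B y.

Section Op.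
Variables (Q : V -> V -> C) (hQ : bounded_form Q).

Let corow_mem y : gmem (sip_gauge Bpos) (fun x => (Q x y)^*).
Proof.
have [Qs [M M0 QM]] := hQ.
apply: (@sip_memP _ _ _ Bpos _ (M * snorm B y)) => [|a x z|x].
- by rewrite mulr_ge0 ?snorm_ge0.
- by rewrite Qs.1 rmorphD rmorphM.
- by rewrite norm_conjC mulrAC QM.
Qed.

(** This is the vector T^* (j y) for the operator T to be constructed. Setting (T f) y to be the
    pairing of [f] with [corow y] defines T on the whole space at once, with no extension from the
    dense set of rays. *)
Let corow y : H := GSpace (corow_mem y).

Let corow_norm : exists2 M : C, 0 <= M & forall y, `|corow y| <= M * snorm B y.
Proof.
have [Qs [M M0 QM]] := hQ; exists M => // y.
apply: sip_norm_le => [|x]; first by rewrite mulr_ge0 ?snorm_ge0.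
by rewrite norm_conjC mulrAC QM.
Qed.

Let form_op_mem (f : H) : gmem (sip_gauge Bpos) (fun y => hilb_dot H f (corow y)).
Proof.
have [Qs _] := hQ; have [M M0 QM] := corow_norm.
apply: (@sip_memP _ _ _ Bpos _ (`|f| * M)) => [|a x z|x].
- by rewrite mulr_ge0.
- have -> : corow (a *: x + z) = a *: corow x + corow z.
    by apply: gspace_eq => y; rewrite gfunD gfunZ /= Qs.2 rmorphD rmorphM /= conjCK.
  by rewrite (hdot_sesqui H).2.
- by rewrite (le_trans (hdot_norm_le _ _))// -mulrA ler_wpM2l.
Qed.

Let form_op_fun (f : H) : H := GSpace (form_op_mem f).

Let form_op_bounded : is_bounded_op form_op_fun.
Proof.
have [M M0 QM] := corow_norm.
apply: (@linear_bounded_op _ H _ M) => // [a x y|x].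
  apply: gspace_eq => z; rewrite gfunD gfunZ.
  exact: (hdot_sesqui H).1.
apply: sip_norm_le => [|y]; first by rewrite mulr_ge0.
by rewrite (le_trans (hdot_norm_le _ _))// mulrC mulrAC ler_wpM2r.
Qed.

Definition form_op : bounded_op H := BoundedOp form_op_bounded.

Let form_opE (f : H) y : (form_op f : sip_space Bpos) y = hilb_dot H f (corow y).
Proof. by []. Qed.

Let form_op_jE x y : (form_op (j x) : sip_space Bpos) y = Q x y.
Proof. by rewrite form_opE hdot_herm hdot_ray [corow y x]/(conjC (Q x y)) conjCK. Qed.

Lemma hdot_form_op x y : hilb_dot H (form_op (j x)) (j y) = Q x y.
Proof. by rewrite hdot_ray form_op_jE. Qed.

(** The hypothesis says that the adjoint sends the ray of [y] to the ray of [z]. The point is that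
    [f] is arbitrary here, and in particular may be an image under another operator. *)
Lemma hdot_form_op_adj (f : H) y z : (forall x, Q x y = B x z) ->
  hilb_dot H (form_op f) (j y) = hilb_dot H f (j z).
Proof.
move=> Qz; rewrite hdot_ray form_opE; congr (hilb_dot H _ _).
by apply: gspace_eq => x; change (conjC (Q x y) = B z x); rewrite Qz -(psd_herm hB Bpos).
Qed.

Lemma form_op_ray x z : (forall y, Q x y = B z y) -> form_op (j x) = j z.
Proof. by move=> Qz; apply: gspace_eq => y; rewrite form_op_jE Qz. Qed.

End Op.
End FormOp.

(** * Spanning by positive elements, and families of forms indexed by an operator system *)

Section OpsysFacts.
Variables (R : realType) (V : lmodType R[i]) (o : opsys_data V).
Hypothesis ho : is_opsys o.
Local Notation C := R[i].
Implicit Types (x y : V) (a : C).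

Definition pos1 x : Prop := mpos o (const_mx x : 'M_1).

Lemma amp_mx1 (e : V) : amp_mx 1 e = const_mx e.
Proof. by apply/matrixP => i j; rewrite !mxE !ord1 eqxx. Qed.

Lemma star_const x : star_mx (ops_star o) (const_mx x : 'M_1) = const_mx (ops_star o x).
Proof. by apply/matrixP => i j; rewrite !mxE. Qed.

Lemma const_mx1_inj x y : (const_mx x : 'M_1) = const_mx y -> x = y.
Proof. by move=> /matrixP/(_ 0 0); rewrite !mxE. Qed.

Lemma pos1_herm x : pos1 x -> ops_star o x = x.
Proof. by move=> /(ops_pos_herm ho); rewrite star_const => /const_mx1_inj. Qed.


Lemma pos1Z a x : 0 <= a -> pos1 x -> pos1 (a *: x).
Proof.
move=> a0 px; have := ops_posZ ho a0 px.
by rewrite /pos1 (_ : scale_vmx _ _ = const_mx (a *: x))//; apply/matrixP => i j; rewrite !mxE.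
Qed.

Lemma pos1_order_unit x : ops_star o x = x ->
  exists2 t : C, 0 < t & pos1 (t *: munit o - x).
Proof.
move=> hx; have [|t t0 ht] := ops_order_unit ho (A := (const_mx x : 'M_1)).
  by rewrite star_const hx.
exists t => //; move: ht; rewrite amp_mx1 /pos1.
by rewrite (_ : _ - _ = const_mx (t *: munit o - x))//; apply/matrixP => i j; rewrite !mxE.
Qed.

Lemma ops_starD x y : ops_star o (x + y) = ops_star o x + ops_star o y.
Proof. by have := ops_star_conjlinear ho 1 x y; rewrite !scale1r conjC1 scale1r. Qed.
Lemma ops_star0 : ops_star o 0 = 0.
Proof. by apply: (addrI (ops_star o 0)); rewrite -ops_starD !addr0. Qed.
Lemma ops_starZ a x : ops_star o (a *: x) = a^* *: ops_star o x.
Proof. by have := ops_star_conjlinear ho a x 0; rewrite ops_star0 !addr0. Qed.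
Lemma ops_starN x : ops_star o (- x) = - ops_star o x.
Proof. by rewrite -scaleN1r ops_starZ rmorphN1 scaleN1r. Qed.
Lemma ops_starB x y : ops_star o (x - y) = ops_star o x - ops_star o y.
Proof. by rewrite ops_starD ops_starN. Qed.

Lemma pos1_unit : pos1 (munit o).
Proof.
have [t t0] := pos1_order_unit ops_star0; rewrite subr0 => ht.
have := pos1Z (_ : 0 <= t^-1) ht; rewrite invr_ge0 ltW// => /(_ isT).
by rewrite scalerK// lt0r_neq0.
Qed.

Lemma herm_decomp x : exists y z, [/\ ops_star o y = y, ops_star o z = z & x = y + 'i *: z].
Proof.
pose y := 2^-1 *: (x + ops_star o x); pose z := (2^-1 / 'i) *: (x - ops_star o x).
have c2 : (2^-1 : C)^* = 2^-1 by rewrite fmorphV /= conjC_nat.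
exists y, z; split.
- by rewrite /y ops_starZ ops_starD (ops_starK ho) c2 addrC.
- rewrite /z ops_starZ ops_starB (ops_starK ho) rmorphM /= c2 fmorphV /= conjCi.
  by rewrite invrN mulrN scaleNr -scalerN opprB.
- rewrite /y /z scalerA mulrCA divff ?neq0Ci// mulr1 -scalerDr addrACA subrr addr0.
  have -> : x + x = 2 *: x by rewrite scaler_nat mulr2n.
  by rewrite scalerA mulVf ?scale1r// pnatr_eq0.
Qed.

(** A self-adjoint element is t 1 minus the positive element t 1 - x, so positive elements span.
    Identities that are linear in the element are checked on positive ones by this principle. *)
Lemma opsys_span_ind (P : V -> Prop) :
  (forall x, pos1 x -> P x) ->
  (forall a x y, P x -> P y -> P (a *: x + y)) -> forall x, P x.
Proof.
move=> Ppos PD x; have Ph y : ops_star o y = y -> P y.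
  move=> /pos1_order_unit[t t0 ht].
  have -> : y = -1 *: (t *: munit o - y) + t *: munit o.
    by rewrite scaleN1r opprB subrK.
  by apply: PD; apply: Ppos => //; apply: pos1Z pos1_unit; exact: ltW.
have [y [z [hy hz ->]]] := herm_decomp x.
by rewrite addrC; apply: PD; exact: Ph.
Qed.

End OpsysFacts.

Section BoundedFamily.
Variables (R : realType) (V : lmodType R[i]) (o : opsys_data V).
Hypothesis ho : is_opsys o.
Local Notation C := R[i].
Variables (V0 : lmodType R[i]) (Q : V -> V0 -> V0 -> C).
Hypothesis Qs : forall s, sesquiform (Q s).
Hypothesis Ql : forall a s t x y, Q (a *: s + t) x y = a * Q s x y + Q t x y.
Hypothesis Qpos : forall s, pos1 o s -> psd (Q s).

Lemma family_herm s x y : Q (ops_star o s) x y = (Q s y x)^*.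
Proof.
move: s x y; apply: (opsys_span_ind ho) => [s ps x y|a s t Hs Ht x y].
  by rewrite (pos1_herm ho ps) (psd_herm (Qs s) (Qpos ps)).
by rewrite (ops_star_conjlinear ho) !Ql rmorphD rmorphM Hs Ht.
Qed.

Let Q0 x y : Q 0 x y = 0.
Proof.
have := Ql 1 0 0 x y; rewrite scale1r addr0 mul1r => Q00.
by apply: (addrI (Q 0 x y)); rewrite -Q00 addr0.
Qed.

(** If 0 <= s <= t 1 then [Q s] is dominated by t times the form at the unit on the diagonal, and
    Cauchy-Schwarz for [Q s] extends the bound to all pairs. Linear combinations keep such
    bounds. *)
Lemma family_bounded s : exists2 M : C, 0 <= M &
  forall x y, `|Q s x y| <= M * snorm (Q (munit o)) x * snorm (Q (munit o)) y.
Proof.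
have Bpos := Qpos (pos1_unit ho).
move: s; apply: (opsys_span_ind ho) => [s ps|a s t [M M0 HM] [N N0 HN]].
  have [t t0 ht] := pos1_order_unit ho (pos1_herm ho ps).
  have le x : Q s x x <= t * Q (munit o) x x.
    have := Qpos ht x; rewrite addrC -scaleN1r Ql -[t *: _]addr0 Ql Q0 addr0.
    by rewrite mulN1r addrC subr_ge0.
  exists t => [|x y]; first exact: ltW.
  rewrite -ler_sqr ?nnegrE ?mulr_ge0 ?snorm_ge0 ?(ltW t0)//.
  apply: le_trans (psd_CS (Qs s) (Qpos ps) x y) _.
  have -> : (t * snorm (Q (munit o)) x * snorm (Q (munit o)) y) ^+ 2 =
    (t * Q (munit o) x x) * (t * Q (munit o) y y).
    by rewrite !exprMn !snormK; ring.
  by apply: ler_pM => //; exact: Qpos.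
exists (`|a| * M + N) => [|x y]; first by rewrite addr_ge0// mulr_ge0.
rewrite Ql (le_trans (ler_normD _ _))// normrM mulrDl mulrDl lerD//.
by rewrite -2!mulrA ler_wpM2l// mulrA.
Qed.

End BoundedFamily.

Lemma bop_sesqui (R : realType) (H : hilbert R) (T : bounded_op H) :
  sesquiform (fun x y => hilb_dot H (T x) y).
Proof.
split=> [a x y z|a x y z]; first by rewrite bop_linear (hdot_sesqui H).1.
by rewrite (hdot_sesqui H).2.
Qed.

Lemma bop_pos1E (R : realType) (H : hilbert R) (T : bounded_op H) :
  mpos (bop_cones H) (const_mx T : 'M_1) <-> psd (fun x y => hilb_dot H (T x) y).
Proof.
split=> [h x|h v]; last by rewrite !big_ord1 mxE.
by have := h (fun=> x); rewrite !big_ord1 mxE.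
Qed.

Lemma bop_compE (R : realType) (H : hilbert R) (S T : bounded_op H) x :
  bop_comp S T x = S (T x).
Proof. by []. Qed.

(** * Commuting ucp maps obtained from families of forms *)

Section AbsorbUnit.
Variables (R : realType) (V W : lmodType R[i]) (oV : opsys_data V) (oW : opsys_data W).
Hypotheses (hV : is_opsys oV) (hW : is_opsys oW).
Local Notation C := R[i].
Variables (K : hilbert R) (phi : V -> bounded_op K) (l : W -> bounded_op K).
Hypotheses (phil : linear phi) (ll : linear l).
Hypothesis phi1 : phi (munit oV) = bop_id K.
Hypothesis phi_pos : forall s, pos1 oV s -> mpos (bop_cones K) (const_mx (phi s) : 'M_1).
Hypothesis comm : forall s t, bop_comp (phi s) (l t) = bop_comp (l t) (phi s).
Hypothesis phi_cp : forall r (G : 'M[V]_r), mpos oV G -> forall x : 'I_r -> K,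
  0 <= \sum_i \sum_j hilb_dot K (l (munit oW) (phi (G i j) (x j))) (x i).
Hypothesis l_cp : forall r (F : 'M[W]_r), mpos oW F -> mpos (bop_cones K) (map_mx l F).

Let commE s t x : phi s (l t x) = l t (phi s x).
Proof. by have := congr1 (fun T : bounded_op K => T x) (comm s t). Qed.

Let Qphi s x y : C := hilb_dot K (l (munit oW) (phi s x)) y.
Let Qpsi t x y : C := hilb_dot K (l t x) y.
Let B := Qpsi (munit oW).

Let Qphi_sesqui s : sesquiform (Qphi s).
Proof. exact: (bop_sesqui (bop_comp (l (munit oW)) (phi s))). Qed.
Let Qpsi_sesqui t : sesquiform (Qpsi t).
Proof. exact: bop_sesqui. Qed.

Let Qphi_linear a s t x y : Qphi (a *: s + t) x y = a * Qphi s x y + Qphi t x y.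
Proof. by rewrite /Qphi phil bop_linear (hdot_sesqui K).1. Qed.
Let Qpsi_linear a s t x y : Qpsi (a *: s + t) x y = a * Qpsi s x y + Qpsi t x y.
Proof. by rewrite /Qpsi ll (hdot_sesqui K).1. Qed.

Let Qphi_psd s : pos1 oV s -> psd (Qphi s).
Proof. by move=> ps x; have := phi_cp ps (fun=> x); rewrite !big_ord1 mxE. Qed.
Let Qpsi_psd t : pos1 oW t -> psd (Qpsi t).
Proof.
move=> pt; apply/bop_pos1E; have := l_cp pt.
by rewrite (_ : map_mx l _ = const_mx (l t))//; apply/matrixP => i j; rewrite !mxE.
Qed.

Let hB : sesquiform B := Qpsi_sesqui (munit oW).
Let Bpos : psd B := Qpsi_psd (pos1_unit hW).

Let Qphi1 : Qphi (munit oV) = B.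
Proof. by apply/funext => x; apply/funext => y; rewrite /Qphi phi1. Qed.

Let Qphi_bounded s : bounded_form B (Qphi s).
Proof.
split=> //; rewrite -Qphi1.
exact: (family_bounded hV Qphi_sesqui Qphi_linear Qphi_psd).
Qed.
Let Qpsi_bounded t : bounded_form B (Qpsi t).
Proof.
by split=> //; exact: (family_bounded hW Qpsi_sesqui Qpsi_linear Qpsi_psd).
Qed.

Let H := sip_hilbert hB Bpos.
Let j := sip_ray hB Bpos.
Let j_dense (f : H) n : exists x, `|f - j x| <= rate R n := sip_ray_dense hB f n.

Let phi' s : bounded_op H := form_op hB Bpos (Qphi_bounded s).
Let psi' t : bounded_op H := form_op hB Bpos (Qpsi_bounded t).

Let phi_adj s x y : hilb_dot K (phi s x) y = hilb_dot K x (phi (ops_star oV s) y).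
Proof.
rewrite [RHS]hdot_herm (family_herm hV (Q := fun s x y => hilb_dot K (phi s x) y)) ?conjCK//.
- by move=> t; exact: bop_sesqui.
- by move=> a t u z w; rewrite phil (hdot_sesqui K).1.
- by move=> t /phi_pos/bop_pos1E.
Qed.

(** The new inner product is the form of [l (munit oW)] on [K]. Formally [psi' t] is [l t]
    multiplied on both sides by the inverse square root of [l (munit oW)]; the passage through forms
    takes neither the inverse nor the root, and allows a kernel. *)
Lemma absorb_unit : exists (H : hilbert R) (j : K -> H)
    (phi' : V -> bounded_op H) (psi' : W -> bounded_op H),
  [/\ ucp oV (bop_cones H) phi', ucp oW (bop_cones H) psi',
      forall s t, bop_comp (phi' s) (psi' t) = bop_comp (psi' t) (phi' s)
    & forall s t x, hilb_dot H (phi' s (psi' t (j x))) (j x)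
                    = hilb_dot K (phi s (l t x)) x].
Proof.
(* Because [phi s] commutes with [l (munit oW)], its adjoint for the new inner product is still
   given by [phi (ops_star oV s)]. *)
have adjQ s x y : Qphi s x y = B x (phi (ops_star oV s) y).
  by rewrite /Qphi -commE phi_adj.
have mixed s t x y : hilb_dot H (phi' s (psi' t (j x))) (j y) = hilb_dot K (phi s (l t x)) y.
  rewrite (hdot_form_op_adj _ _ (fun x => adjQ s x y)) hdot_form_op.
  by rewrite /Qpsi phi_adj.
exists H, j, phi', psi'; split => //.
- split; last first.
    apply: (bop_dense_ext j_dense) => u v; rewrite hdot_form_op Qphi1.
    by rewrite hdot_ray.
  split=> [a s t|r G hG].
    apply: (bop_dense_ext j_dense) => u v; rewrite hdot_form_op Qphi_linear.
    by rewrite (hdot_sesqui H).1 !hdot_form_op.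
  apply: (bop_psd_dense j_dense) => v.
  under eq_bigr do under eq_bigr do rewrite mxE hdot_form_op.
  exact: phi_cp.
- split; last first.
    apply: (bop_dense_ext j_dense) => u v; rewrite hdot_form_op.
    by rewrite hdot_ray.
  split=> [a s t|r G hG].
    apply: (bop_dense_ext j_dense) => u v; rewrite hdot_form_op Qpsi_linear.
    by rewrite (hdot_sesqui H).1 !hdot_form_op.
  apply: (bop_psd_dense j_dense) => v.
  under eq_bigr do under eq_bigr do rewrite mxE hdot_form_op.
  have -> : \sum_i \sum_k Qpsi (G i k) (v k) (v i) =
    \sum_i \sum_k hilb_dot K (map_mx l G i k (v k)) (v i).
    by apply: eq_bigr => i _; apply: eq_bigr => k _; rewrite mxE.
  exact: l_cp.
(* [psi'] need not send rays to rays, but [phi'] and, by [adjQ], its adjoint do. So in both products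
   only [phi'] is moved. *)
move=> s t; apply: (bop_dense_ext j_dense) => u v.
rewrite !bop_compE mixed.
have -> : phi' s (j u) = j (phi s u) by apply: form_op_ray => y.
by rewrite hdot_form_op commE.
Qed.

End AbsorbUnit.

Section CommutingRepresentation.
Variables (R : realType) (V W : lmodType R[i]) (oV : opsys_data V) (oW : opsys_data W).
Hypotheses (hV : is_opsys oV) (hW : is_opsys oW).
Local Notation C := R[i].
Variables (V0 : lmodType R[i]) (Phi : V -> V0 -> V0 -> C) (L : W -> V0 -> V0).
Hypothesis Phis : forall s, sesquiform (Phi s).
Hypothesis Phil : forall a s t x y, Phi (a *: s + t) x y = a * Phi s x y + Phi t x y.
Hypothesis Phi_pos : forall s, pos1 oV s -> psd (Phi s).
Hypothesis Ll : forall a t u x, L (a *: t + u) x = a *: L t x + L u x.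
Hypothesis L_linear : forall t, linear (L t).
Hypothesis L_adj : forall s t x y, Phi s (L t x) y = Phi s x (L (ops_star oW t) y).
Hypothesis L_bound : exists2 M : C, 0 <= M &
  forall x, Phi (munit oV) (L (munit oW) x) x <= M * Phi (munit oV) x x.
Hypothesis Phi_cp : forall r (G : 'M[V]_r), mpos oV G -> forall x : 'I_r -> V0,
  0 <= \sum_i \sum_j Phi (G i j) (L (munit oW) (x j)) (x i).
Hypothesis L_cp : forall r (F : 'M[W]_r), mpos oW F -> forall x : 'I_r -> V0,
  0 <= \sum_i \sum_j Phi (munit oV) (L (F i j) (x j)) (x i).

Let B := Phi (munit oV).
Let hB : sesquiform B := Phis (munit oV).
Let Bpos : psd B := Phi_pos (pos1_unit hV).
Let Q t x y := B (L t x) y.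

Let Q_sesqui t : sesquiform (Q t).
Proof.
by split=> [a x y z|a x y z]; rewrite /Q ?L_linear ?hB.1 ?hB.2.
Qed.

Let Q_linear a s t x y : Q (a *: s + t) x y = a * Q s x y + Q t x y.
Proof. by rewrite /Q Ll hB.1. Qed.

Let Q_psd t : pos1 oW t -> psd (Q t).
Proof. by move=> pt x; have := L_cp pt (fun=> x); rewrite !big_ord1 mxE. Qed.

Let Phi_bounded s : bounded_form B (Phi s).
Proof. by split=> //; exact: (family_bounded hV Phis Phil Phi_pos). Qed.

Let Q_bounded t : bounded_form B (Q t).
Proof.
(* [family_bounded] controls [Q t] only by the form [Q (munit oW)]; [L_bound] compares this form
   with the inner product [B]. *)
split=> //; have [M M0 hM] := L_bound.
have [N N0 hN] := family_bounded hW Q_sesqui Q_linear Q_psd t.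
have le x : snorm (Q (munit oW)) x <= sqrtC M * snorm B x.
  rewrite -ler_sqr ?nnegrE ?mulr_ge0 ?snorm_ge0 ?sqrtC_ge0//; last exact/Q_psd/pos1_unit.
  by rewrite exprMn (sqrtCK M) (snormK B) (snormK (Q _)); exact: hM.
exists (N * M) => [|x y]; first exact: mulr_ge0.
apply: le_trans (hN x y) _.
have -> : N * M * snorm B x * snorm B y = N * (sqrtC M * snorm B x) * (sqrtC M * snorm B y).
  by rewrite -{1}(sqrtCK M); ring.
have q0 z : 0 <= snorm (Q (munit oW)) z by apply/snorm_ge0/Q_psd/pos1_unit.
by apply: ler_pM => //; [exact: mulr_ge0 | exact: ler_wpM2l].
Qed.

Let K := sip_hilbert hB Bpos.
Let j := sip_ray hB Bpos.
Let j_dense (f : K) n : exists x, `|f - j x| <= rate R n := sip_ray_dense hB f n.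
Let phi s : bounded_op K := form_op hB Bpos (Phi_bounded s).
Let l t : bounded_op K := form_op hB Bpos (Q_bounded t).

Let l_ray t x : l t (j x) = j (L t x).
Proof. by apply: form_op_ray => y. Qed.

(** A GNS construction in two completions. Completing [V0] under the form at the unit of [V] yields
    a unital [phi], and the maps [L t] descend to operators that commute with it, since by [L_adj]
    they can be moved across every form [Phi s]. [absorb_unit] then repairs the value at the unit of
    [W]. *)
Lemma commuting_representation (a : V0) : exists (H : hilbert R) (xi : H)
    (phi : V -> bounded_op H) (psi : W -> bounded_op H),
  [/\ ucp oV (bop_cones H) phi, ucp oW (bop_cones H) psi,
      forall s t, bop_comp (phi s) (psi t) = bop_comp (psi t) (phi s)
    & forall s t, hilb_dot H (phi s (psi t xi)) xi = Phi s (L t a) a].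
Proof.
have phil : linear phi.
  move=> c s t; apply: (bop_dense_ext j_dense) => u v; rewrite hdot_form_op Phil.
  by rewrite (hdot_sesqui K).1 !hdot_form_op.
have ll : linear l.
  move=> c s t; apply: (bop_dense_ext j_dense) => u v; rewrite hdot_form_op Q_linear.
  by rewrite (hdot_sesqui K).1 !hdot_form_op.
have phi1 : phi (munit oV) = bop_id K.
  apply: (bop_dense_ext j_dense) => u v; rewrite hdot_form_op.
  by rewrite hdot_ray.
have phi_pos s : pos1 oV s -> mpos (bop_cones K) (const_mx (phi s) : 'M_1).
  move=> ps; apply: (bop_psd_dense j_dense) => v.
  by rewrite !big_ord1 mxE hdot_form_op; exact: Phi_pos.
have comm s t : bop_comp (phi s) (l t) = bop_comp (l t) (phi s).
  apply: (bop_dense_ext j_dense) => u v; rewrite !bop_compE l_ray hdot_form_op.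
  rewrite (@hdot_form_op_adj _ _ _ hB Bpos _ (Q_bounded t) _ _ (L (ops_star oW t) v)).
    by rewrite hdot_form_op L_adj.
  by move=> x; exact: L_adj.
have phi_cp r (G : 'M[V]_r) : mpos oV G -> forall x : 'I_r -> K,
    0 <= \sum_i \sum_k hilb_dot K (l (munit oW) (phi (G i k) (x k))) (x i).
  move=> hG x.
  pose A : 'M[bounded_op K]_r := \matrix_(i, k) bop_comp (l (munit oW)) (phi (G i k)).
  have AE i k y : A i k y = l (munit oW) (phi (G i k) y) by rewrite mxE bop_compE.
  have AjE i k u v : hilb_dot K (A i k (j u)) (j v) = Phi (G i k) (L (munit oW) u) v.
    by rewrite mxE -comm bop_compE l_ray hdot_form_op.
  have PA : mpos (bop_cones K) A.
    apply: (bop_psd_dense j_dense) => v.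
    under eq_bigr do under eq_bigr do rewrite AjE.
    exact: Phi_cp.
  have e : \sum_i \sum_k hilb_dot K (A i k (x k)) (x i) =
      \sum_i \sum_k hilb_dot K (l (munit oW) (phi (G i k) (x k))) (x i).
    by apply: eq_bigr => i _; apply: eq_bigr => k _; rewrite (AE i k (x k)).
  exact (eq_ind _ (fun z => 0 <= z) (PA x) _ e).
have l_cp r (F : 'M[W]_r) : mpos oW F -> mpos (bop_cones K) (map_mx l F).
  move=> hF; apply: (bop_psd_dense j_dense) => v.
  have -> : \sum_i \sum_k hilb_dot K (map_mx l F i k (j (v k))) (j (v i)) =
      \sum_i \sum_k Phi (munit oV) (L (F i k) (v k)) (v i).
    by apply: eq_bigr => i _; apply: eq_bigr => k _; rewrite mxE hdot_form_op.
  exact: L_cp.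
have [H [j' [phi' [psi' [h1 h2 h3 h4]]]]] := absorb_unit hV hW phil ll phi1 phi_pos comm phi_cp l_cp.
exists H, (j' (j a)), phi', psi'; split=> // s t.
by rewrite h4 l_ray hdot_form_op.
Qed.

End CommutingRepresentation.

(** * Positive elements of a C*-algebra *)

(* The square root of 1 - h is 1 - z, with z the limit of the iterates of
   x |-> (h + x^2) / 2.  Coefficientwise domination by the scalar iterates for
   h = 1 gives the rate of convergence. *)
Section AbstractSqrt.
Variables (R : realType) (A : pzRingType) (star : A -> A) (half : A).
Local Notation C := R[i].
Variable bnd : C -> A -> Prop.
Hypothesis halfD : half + half = 1.
Hypothesis half_comm : forall x, half * x = x * half.
Hypothesis star_half : star half = half.
Hypothesis starD : {morph star : x y / x + y}.
Hypothesis starM : forall x y, star (x * y) = star y * star x.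
Hypothesis bndD : forall a b x y, bnd a x -> bnd b y -> bnd (a + b) (x + y).
Hypothesis bndN : forall a x, bnd a x -> bnd a (- x).
Hypothesis bndM : forall a b x y, 0 <= a -> 0 <= b -> bnd a x -> bnd b y -> bnd (a * b) (x * y).
Hypothesis bndW : forall a b x, a <= b -> bnd a x -> bnd b x.
Hypothesis bnd0 : bnd 0 0.
Hypothesis bnd_half : bnd 2^-1 half.
Hypothesis bnd_star : forall a x, bnd a x -> bnd a (star x).
Hypothesis bnd_eq0 : forall k x, (forall n, bnd (k * rate R n) x) -> x = 0.
Hypothesis bnd_complete : forall (u : nat -> A) (d : nat -> C),
  (forall n, 0 <= d n <= 2 * rate R n) ->
  (forall m n, (m <= n)%N -> bnd (d m) (u n - u m)) ->
  exists l, forall n, bnd (d n) (u n - l).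
Variable h : A.
Hypothesis h1 : bnd 1 h.

Let star0 : star 0 = 0.
Proof. by apply: (addrI (star 0)); rewrite -starD !addr0. Qed.
Let starN x : star (- x) = - star x.
Proof. by apply: (addrI (star x)); rewrite -starD !subrr star0. Qed.

Let t_ n : C := iter n (fun t => (1 + t ^+ 2) / 2) 0.
Let z_ n : A := iter n (fun z => half * (h + z * z)) 0.
Let d_ n : C := 1 - t_ n.

Let tS n : t_ n.+1 = (1 + t_ n ^+ 2) / 2. Proof. by []. Qed.
Let zS n : z_ n.+1 = half * (h + z_ n * z_ n). Proof. by []. Qed.

Let t_itv n : 0 <= t_ n <= 1.
Proof.
elim: n => [|n /andP[t0 t1]]; first by rewrite lexx ler01.
rewrite tS divr_ge0 ?addr_ge0 ?exprn_ge0 ?ler0n//= ler_pdivrMr ?ltr0Sn// mul1r.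
by rewrite [leRHS]mulr2n lerD2l exprn_ile1.
Qed.

Let t_inc n : t_ n <= t_ n.+1.
Proof.
have /andP[t0 t1] := t_itv n.
rewrite tS ler_pdivlMr ?ltr0Sn// -subr_ge0.
have -> : 1 + t_ n ^+ 2 - t_ n * 2 = (1 - t_ n) ^+ 2 by ring.
by rewrite exprn_ge0// subr_ge0.
Qed.

Let d_itv n : 0 <= d_ n <= 2 / n.+2%:R.
Proof.
have d0 m : 0 <= d_ m <= 1.
  by rewrite /d_ subr_ge0 gerBl; have /andP[-> ->] := t_itv m.
have /andP[-> _] := d0 n; rewrite /=.
elim: n => [|n IH]; first by rewrite /d_ /t_ /= subr0 divff ?pnatr_eq0.
(* The map d - d^2 / 2 increases on [0, 1], so the bound [2 / n.+2%:R] can be inserted in the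
   recursion. *)
have -> : d_ n.+1 = d_ n - d_ n ^+ 2 / 2 by rewrite /d_ tS; field.
have [/andP[dn0 dn1] n0] := (d0 n, ltr0Sn C n.+1).
pose e : C := 2 / n.+2%:R; have e1 : e <= 1.
  by rewrite ler_pdivrMr// mul1r ler_nat.
apply: (@le_trans _ _ (e - e ^+ 2 / 2)).
  rewrite -subr_ge0.
  have -> : e - e ^+ 2 / 2 - (d_ n - d_ n ^+ 2 / 2) = (e - d_ n) * (1 - (e + d_ n) / 2).
    by field.
  rewrite mulr_ge0 ?subr_ge0// ler_pdivrMr ?ltr0Sn// mul1r.
  by rewrite mulr2n lerD.
rewrite -subr_ge0 /e.
have -> : n.+3%:R = n.+2%:R + 1 :> C by rewrite natr1.
move: n0; move: (n.+2%:R : C) => N n0.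
have N0 : N != 0 by rewrite lt0r_neq0.
have N1 : N + 1 != 0 by rewrite lt0r_neq0// addr_gt0.
have -> : 2 / (N + 1) - (2 / N - (2 / N) ^+ 2 / 2) = 2 / (N ^+ 2 * (N + 1)).
  by field; rewrite ?N0 ?N1.
by rewrite divr_ge0 ?ler0n// mulr_ge0 ?exprn_ge0 ?addr_ge0 ?ler01// ltW.
Qed.

Let d_rate n : 0 <= d_ n <= 2 * rate R n.
Proof.
have /andP[-> dn] := d_itv n; rewrite (le_trans dn)//=.
by rewrite ler_wpM2l ?ler0n// lef_pV2 ?posrE ?ltr0Sn// ler_nat.
Qed.

Let bndz n : bnd (t_ n) (z_ n).
Proof.
elim: n => [//|n IH]; rewrite zS tS mulrC.
have /andP[t0 _] := t_itv n.
apply: bndM => //; first by rewrite invr_ge0 ler0n.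
  by rewrite addr_ge0 ?exprn_ge0.
by apply: bndD => //; rewrite expr2; exact: bndM.
Qed.

Let diff_sq (x y : A) : x * x - y * y = (x - y) * x + y * (x - y).
Proof. by rewrite mulrBl mulrBr addrA subrK. Qed.

Let bnd_step n : bnd (t_ n.+1 - t_ n) (z_ n.+1 - z_ n).
Proof.
elim: n => [|n IH].
  by rewrite !subr0; exact: (bndz 1).
have -> : z_ n.+2 - z_ n.+1 = half * (z_ n.+1 * z_ n.+1 - z_ n * z_ n).
  by rewrite (zS n.+1) [X in _ - X = _]zS -mulrBr opprD addrACA subrr add0r.
have -> : t_ n.+2 - t_ n.+1 = 2^-1 * ((t_ n.+1 - t_ n) * t_ n.+1 + t_ n * (t_ n.+1 - t_ n)).
  by rewrite (tS n.+1) [X in _ - X = _]tS; field.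
have [/andP[t0 _] /andP[t1 _]] := (t_itv n, t_itv n.+1).
have dt : 0 <= t_ n.+1 - t_ n by rewrite subr_ge0.
apply: bndM => //; rewrite ?invr_ge0 ?ler0n//.
  by rewrite addr_ge0// mulr_ge0.
by rewrite diff_sq; apply: bndD; exact: bndM.
Qed.

Let bnd_diff m n : (m <= n)%N -> bnd (t_ n - t_ m) (z_ n - z_ m).
Proof.
move=> /subnK <-; elim: (n - m)%N => [|k IH]; first by rewrite !subrr.
rewrite addSn -[z_ _.+1](subrK (z_ (k + m)%N)) -addrA.
rewrite -[t_ _.+1](subrK (t_ (k + m)%N)) -addrA.
exact: bndD.
Qed.

(** [bnd c x] stands for a norm bound [|x| <= c]. It is a relation because the lemma is used both
    with the norm of a C*-algebra and with matrices over a commutant, where the operator norm is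
    present only through its defining inequality. *)
Lemma sqrt_iteration : exists z : A,
  [/\ h + z * z = z + z, bnd 1 z, star h = h -> star z = z
    & forall k b, 0 <= k -> bnd k b -> h * b = b * h -> z * b = b * z].
Proof.
have [|z hz] := bnd_complete d_rate (u := z_).
  move=> m n mn; apply: bndW (bnd_diff mn); rewrite lerD2r.
  by have /andP[] := t_itv n.
have d0 n : 0 <= d_ n by have /andP[] := d_rate n.
have z1 : bnd 1 z.
  have := bndD (bndz 0) (bndN (hz 0%N)).
  by rewrite /d_ /= add0r subr0 opprB addrC subrK.
have zfix : z = half * (h + z * z).
  apply/eqP; rewrite -subr_eq0; apply/eqP; apply: (@bnd_eq0 4%:R) => n.
  have -> : z - half * (h + z * z) = - (z_ n.+1 - z) + half * ((z_ n - z) * z_ n + z * (z_ n - z)).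
    rewrite -diff_sq zS opprB -addrA; congr (z + _).
    by rewrite !mulrDr mulrN !opprD addrA addrNK.
  have /andP[t0 t1] := t_itv n.
  apply: bndW (_ : d_ n.+1 + 2^-1 * (d_ n * 1 + 1 * d_ n) <= _) _; last first.
    apply: bndD; first exact: bndN.
    apply: bndM => //; first by rewrite invr_ge0 ler0n.
      by rewrite addr_ge0// mulr_ge0.
    apply: bndD; apply: bndM => //.
    exact: bndW (bndz n).
  have -> : d_ n.+1 + 2^-1 * (d_ n * 1 + 1 * d_ n) = d_ n.+1 + d_ n by field.
  have -> : 4%:R * rate R n = 2 * rate R n + 2 * rate R n by ring.
  have [/andP[_ dn] /andP[_ dn1]] := (d_rate n, d_rate n.+1).
  rewrite lerD// (le_trans dn1)// ler_wpM2l ?ler0n//.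
  exact: le_rate_anti.
exists z; split => //.
- by rewrite -[h + z * z]mul1r -halfD mulrDl -zfix.
- move=> sh; have sz n : star (z_ n) = z_ n.
    elim: n => [//|n IH]; rewrite zS starM starD starM IH sh star_half.
    by rewrite half_comm.
  apply/eqP; rewrite -subr_eq0; apply/eqP; apply: (@bnd_eq0 4%:R) => n.
  have -> : star z - z = (z_ n - z) - star (z_ n - z).
    by rewrite starD starN sz opprB [RHS]addrC addrA subrK.
  have /andP[_ dn] := d_rate n.
  apply: bndW (bndD (hz n) (bndN (bnd_star (hz n)))).
  have -> : 4%:R * rate R n = 2 * rate R n + 2 * rate R n by ring.
  exact: lerD.
- move=> k b k0 hk hb; have zb n : z_ n * b = b * z_ n.
    elim: n => [|n IH]; first by rewrite mul0r mulr0.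
    rewrite zS -mulrA mulrDl hb -mulrA IH mulrA IH -mulrA -mulrDr mulrA half_comm.
    by rewrite -!mulrA half_comm.
  apply/eqP; rewrite -subr_eq0; apply/eqP; apply: (@bnd_eq0 (4%:R * k)) => n.
  have -> : z * b - b * z = b * (z_ n - z) - (z_ n - z) * b.
    by rewrite mulrBr mulrBl zb opprB [RHS]addrC addrA subrK.
  have /andP[_ dn] := d_rate n.
  apply: bndW (bndD (bndM k0 (d0 n) hk (hz n)) (bndN (bndM (d0 n) k0 (hz n) hk))).
  have -> : 4%:R * k * rate R n = k * (2 * rate R n) + (2 * rate R n) * k by ring.
  by rewrite lerD// ?ler_wpM2l// ler_wpM2r.
Qed.

End AbstractSqrt.

(** An alias that receives the product as a ring structure next to the normed module structure, so
    that ring lemmas apply to it. *)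
Definition calg (R : realType) (A : cstarAlg R) : Type := cstar_sort A.

Section CAlgRing.
Variables (R : realType) (A : cstarAlg R).

HB.instance Definition _ := CompleteNormedModule.copy (calg A) (cstar_sort A).

Let mulDl : left_distributive (@cstar_mul R A) +%R.
Proof.
move=> x y z; have := (cstar_mul_bilinear A).1 z 1 x y.
by rewrite /= !scale1r.
Qed.

Let mulDr : right_distributive (@cstar_mul R A) +%R.
Proof.
move=> x y z; have := (cstar_mul_bilinear A).2 x 1 y z.
by rewrite /= !scale1r.
Qed.

HB.instance Definition _ := GRing.Zmodule_isPzRing.Build (calg A)
  (@cstar_mulA R A) (@cstar_mul1l R A) (@cstar_mul1r R A) mulDl mulDr.

Lemma calg_scaleAl (a : R[i]) (x y : calg A) : a *: (x * y) = a *: x * y.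
Proof.
have := (cstar_mul_bilinear A).1 y a x 0; rewrite /= !addr0 => e.
apply/esym/(etrans e).
by have -> : cstar_mul 0 y = 0 by [exact: (mul0r (y : calg A))]; rewrite addr0.
Qed.

Lemma calg_scaleAr (a : R[i]) (x y : calg A) : a *: (x * y) = x * (a *: y).
Proof.
have := (cstar_mul_bilinear A).2 x a y 0; rewrite /= !addr0 => e.
apply/esym/(etrans e).
by have -> : cstar_mul x 0 = 0 by [exact: (mulr0 (x : calg A))]; rewrite addr0.
Qed.

Definition cst (x : calg A) : calg A := cstar_star x.

Lemma cstP a x y : cst (a *: x + y) = a^* *: cst x + cst y.
Proof. exact: cstar_star_conjlinear. Qed.
Lemma cstK : involutive cst. Proof. exact: cstar_starK. Qed.
Lemma cstM x y : cst (x * y) = cst y * cst x. Proof. exact: cstar_starM. Qed.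
Lemma cstD : {morph cst : x y / x + y}.
Proof. by move=> x y; have := cstP 1 x y; rewrite conjC1 !scale1r. Qed.
Lemma cst0 : cst 0 = 0.
Proof. by apply: (addrI (cst 0)); rewrite -cstD !addr0. Qed.
Lemma cstZ a x : cst (a *: x) = a^* *: cst x.
Proof. by have := cstP a x 0; rewrite cst0 !addr0. Qed.
Lemma cstN x : cst (- x) = - cst x.
Proof. by rewrite -scaleN1r cstZ rmorphN1 scaleN1r. Qed.
Lemma cstB x y : cst (x - y) = cst x - cst y.
Proof. by rewrite cstD cstN. Qed.
Lemma cst1 : cst 1 = 1.
Proof. by rewrite -[RHS]cstK -[cst 1 in RHS]mul1r cstM cstK mul1r. Qed.
Lemma cst_sum I r (P : pred I) (F : I -> calg A) :
  cst (\sum_(i <- r | P i) F i) = \sum_(i <- r | P i) cst (F i).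
Proof. exact: (big_morph cst cstD cst0). Qed.

Lemma calg_normM (x y : calg A) : `|x * y| <= `|x| * `|y|.
Proof. exact: cstar_normM. Qed.
Lemma calg_normE (x : calg A) : `|cst x * x| = `|x| ^+ 2.
Proof. exact: cstar_normE. Qed.

Lemma calg_norm_cst (x : calg A) : `|cst x| = `|x|.
Proof.
have le (y : calg A) : `|y| <= `|cst y|.
  have [->|y0] := eqVneq `|y| 0; first exact: normr_ge0.
  have yp : 0 < `|y| by rewrite lt_def y0 normr_ge0.
  by rewrite -(ler_pM2r yp) -expr2 -calg_normE calg_normM.
by apply/eqP; rewrite eq_le le andbT; have := le (cst x); rewrite cstK.
Qed.

Lemma calg_norm1 : `|1 : calg A| <= 1.
Proof.
have := calg_normE 1; rewrite cst1 mul1r => e.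
have [->|n0] := eqVneq `|1 : calg A| 0; first exact: ler01.
rewrite -{1}[`|_|]mulr1 in e.
by rewrite (mulfI n0 (etrans (esym (expr2 _)) (esym e))).
Qed.

Lemma calg_norm_herm (x : calg A) : cst x = x -> `|x * x| = `|x| ^+ 2.
Proof. by move=> hx; rewrite -calg_normE hx. Qed.

Lemma calg_sqrt1 (h : calg A) : cst h = h -> `|h| <= 1 -> exists y : calg A,
  [/\ cst y = y, y * y = 1 - h, `|1 - y| <= 1
    & forall b, h * b = b * h -> y * b = b * y].
Proof.
move=> hh h1.
pose hf := 2^-1 *: (1 : calg A).
have [||||||||||||||z [zE z1 zh zc]] := @sqrt_iteration R (calg A) cst hf (fun a x => `|x| <= a) _ _ _ _ _ _ _ _ _ _ _ _ _ _ h h1.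
- have e : 2^-1 + 2^-1 = 1 :> R[i] by field.
  by rewrite -scalerDl e scale1r.
- by move=> x; rewrite -calg_scaleAl -calg_scaleAr mul1r mulr1.
- by rewrite cstZ cst1 fmorphV /= conjC_nat.
- exact: cstD.
- exact: cstM.
- by move=> a b x y xa yb; rewrite (le_trans (ler_normD _ _))// lerD.
- by move=> a x; rewrite normrN.
- by move=> a b x y a0 b0 xa yb; rewrite (le_trans (calg_normM _ _))// ler_pM.
- by move=> a b x ab xa; exact: le_trans ab.
- by rewrite normr0.
- by rewrite normrZ gtr0_norm ?invr_gt0 ?ltr0Sn// ler_piMr ?invr_ge0 ?ler0n// calg_norm1.
- by move=> a x; rewrite calg_norm_cst.
- move=> k x hx; apply/eqP; rewrite -normr_le0.
  by apply: (@ler_rate _ _ _ k) => n; rewrite add0r.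
- move=> u d hd hu.
  have du n : 0 <= d n by have /andP[] := hd n.
  have [||l hl] := @seq_complete_scaled R (calg A) (@cauchy_seq_complete R A) 2 u.
  + exact: ler0n.
  + move=> m n; rewrite mulrDr.
    have [mn|nm] := leqP m n.
      rewrite distrC (le_trans (hu _ _ mn))//; have /andP[_ dm] := hd m.
      by rewrite (le_trans dm)// lerDl mulr_ge0 ?ler0n ?rate_ge0.
    rewrite (le_trans (hu _ _ (ltnW nm)))//; have /andP[_ dn] := hd n.
    by rewrite (le_trans dn)// lerDr mulr_ge0 ?ler0n ?rate_ge0.
  exists l => n; apply: (@ler_rate _ _ _ 2) => m.
  have -> : u n - l = - (u (maxn m n) - u n) + (u (maxn m n) - l).
    by rewrite opprB addrA subrK.
  rewrite (le_trans (ler_normD _ _))// lerD ?normrN ?hu ?leq_maxr//.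
  by rewrite (le_trans (hl _))// ler_wpM2l ?ler0n// le_rate_anti// leq_maxl.
exists (1 - z); split.
- by rewrite cstB cst1 zh.
- have -> : (1 - z) * (1 - z) = 1 - (z + z - z * z).
    by rewrite mulrBl mul1r mulrBr mulr1 !opprD !opprK !addrA.
  by rewrite -zE addrK.
- by rewrite opprB addrC subrK.
- move=> b hb; rewrite mulrBl mulrBr mul1r mulr1; congr (_ - _).
  exact: (zc `|b|).
Qed.

End CAlgRing.

Section CPositive.
Variables (R : realType) (A : cstarAlg R).
Local Notation C := R[i].
Implicit Types (x y z h k : calg A) (t : C).

(* Self-adjoint elements with spectrum in [0, 2t]. *)
Definition cpos h : Prop :=
  cst h = h /\ exists2 t : C, 0 <= t & `|t *: (1 : calg A) - h| <= t.

Lemma cst_scalar t : 0 <= t -> cst (t *: (1 : calg A)) = t *: (1 : calg A).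
Proof. by move=> t0; rewrite cstZ cst1 (conj_Creal (ger0_real t0)). Qed.

Lemma norm_scalar t : `|t *: (1 : calg A)| <= `|t|.
Proof. by rewrite normrZ ler_piMr// calg_norm1. Qed.

Lemma cposD h k : cpos h -> cpos k -> cpos (h + k).
Proof.
move=> [hh [t t0 ht]] [hk [s s0 ks]]; split; first by rewrite cstD hh hk.
exists (t + s); first exact: addr_ge0.
by rewrite scalerDl opprD addrACA (le_trans (ler_normD _ _))// lerD.
Qed.

Lemma cposZ t h : 0 <= t -> cpos h -> cpos (t *: h).
Proof.
move=> t0 [hh [s s0 hs]]; split; first by rewrite cstZ hh (conj_Creal (ger0_real t0)).
exists (t * s); first exact: mulr_ge0.
by rewrite -scalerA -scalerBr normrZ ger0_norm// ler_wpM2l.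
Qed.

Lemma cpos_scalar t : 0 <= t -> cpos (t *: (1 : calg A)).
Proof.
by move=> t0; split; [exact: cst_scalar | exists t; rewrite // subrr normr0].
Qed.

Lemma cpos_norm h : cst h = h -> cpos (`|h| *: (1 : calg A) - h).
Proof.
move=> hh; split; first by rewrite cstB hh cst_scalar.
by exists `|h|; rewrite // opprB addrC subrK.
Qed.

Lemma cpos_sqrt h : cpos h -> exists k, [/\ cpos k, k * k = h
  & forall b, h * b = b * h -> k * b = b * k].
Proof.
move=> [hh [t t0 ht]]; have [t00|tn0] := eqVneq t 0.
  move: ht; rewrite t00 scale0r sub0r normrN normr_le0 => /eqP ->.
  exists 0; split => [||b _]; rewrite ?mulr0 ?mul0r//.
  by rewrite -(scale0r (1 : calg A)); exact: cpos_scalar.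
have tp : 0 < t by rewrite lt_def tn0.
pose u := 1 - t^-1 *: h.
have uh : cst u = u by rewrite cstB cst1 cstZ hh fmorphV /= (conj_Creal (ger0_real t0)).
have u1 : `|u| <= 1.
  rewrite -(ler_pM2l tp) mulr1 -{1}(ger0_norm t0) -normrZ scalerBr scalerA mulfV//.
  by rewrite scale1r.
have [y [hy yy y1 yc]] := calg_sqrt1 uh u1.
have s0 : 0 <= sqrtC t by rewrite sqrtC_ge0.
exists (sqrtC t *: y); split.
(* The bound [|1 - y| <= 1] from the iteration is itself a certificate that [y] is positive. *)
- apply: cposZ => //; split=> //; exists 1; first exact: ler01.
  by rewrite scale1r.
- rewrite -calg_scaleAl -calg_scaleAr scalerA -expr2 sqrtCK yy /u opprB addrC subrK.
  by rewrite scalerA mulfV// scale1r.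
- move=> b hb; rewrite -calg_scaleAl -calg_scaleAr yc// /u mulrBl mulrBr mul1r mulr1.
  by rewrite -calg_scaleAl -calg_scaleAr hb.
Qed.

(* If a and b commute then u = a + ib satisfies u^* u = c, so that the C*-identity
   bounds a, the real part of u. *)
Lemma herm_norm_bound a b t : cst a = a -> cst b = b -> a * b = b * a -> 0 <= t ->
  a * a + b * b = t *: (1 : calg A) -> `|a| ^+ 2 <= t.
Proof.
move=> ha hb ab t0 e; pose u := a + 'i *: b.
have ii : 'i * 'i = -1 :> C by rewrite -expr2 sqrCi.
have su : cst u = a - 'i *: b by rewrite cstD cstZ ha hb conjCi scaleNr.
have uu : cst u * u = t *: (1 : calg A).
  rewrite su /u mulrDr !mulrBl -!calg_scaleAl -!calg_scaleAr scalerA ab ii.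
  by rewrite scaleN1r opprK -e addrA subrK.
have un : `|u| ^+ 2 <= t.
  by rewrite -calg_normE uu (le_trans (norm_scalar t))// ger0_norm.
have aE : a = 2^-1 *: (u + cst u).
  have e2 : a + a = 2 *: a by rewrite scaler_nat mulr2n.
  by rewrite su /u addrACA subrr addr0 e2 scalerA mulVf ?pnatr_eq0// scale1r.
apply: le_trans un; rewrite ler_sqr ?nnegrE// aE normrZ gtr0_norm ?invr_gt0 ?ltr0Sn//.
rewrite ler_pdivrMl ?ltr0Sn// (le_trans (ler_normD _ _))// calg_norm_cst.
by rewrite mulr2n mulrDl mul1r.
Qed.

(** With c = |h|^2, the element c - h^2 is positive because |h^2| <= c, so it has a root k commuting
    with h. From k^2 + h^2 = c follows |k^2| <= c, which is the certificate for h^2. *)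
Lemma cpos_sq h : cst h = h -> cpos (h * h).
Proof.
move=> hh; split; first by rewrite cstM hh.
set c := `|h| ^+ 2; have c0 : 0 <= c by rewrite exprn_ge0.
exists c => //.
have [k [[kh _] kk kc]] : exists k, [/\ cpos k, k * k = c *: (1 : calg A) - h * h
    & forall b, (c *: (1 : calg A) - h * h) * b = b * (c *: (1 : calg A) - h * h) -> k * b = b * k].
  apply: cpos_sqrt; split; first by rewrite cstB cst_scalar// cstM hh.
  by exists c; rewrite // opprB addrC subrK (le_trans (calg_normM _ _))// expr2.
rewrite -kk calg_norm_herm//; apply: (@herm_norm_bound k h) => //.
  by apply: kc; rewrite mulrBl mulrBr -calg_scaleAl -calg_scaleAr mul1r mulr1 mulrA.
by rewrite kk subrK.
Qed.

(** The roots y and z of t + h and t - h commute and y^2 + z^2 = 2 t, whence |y^2| <= 2 t, while h =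
    y^2 - t. The constant 3 instead of 1 is harmless, the lemma being used only as t tends to 0. *)
Lemma cpos_bound h t : 0 <= t -> cst h = h ->
  cpos (t *: (1 : calg A) + h) -> cpos (t *: (1 : calg A) - h) -> `|h| <= 3%:R * t.
Proof.
move=> t0 hh /cpos_sqrt[y [[yh _] yy yc]] /cpos_sqrt[z [[zh _] zz zc]].
have hz : h * z = z * h.
  apply/esym/zc; rewrite mulrBl mulrBr -calg_scaleAl -calg_scaleAr mul1r mulr1.
  by [].
have yz : y * z = z * y.
  by apply: yc; rewrite mulrDl mulrDr -calg_scaleAl -calg_scaleAr mul1r mulr1 hz.
have := @herm_norm_bound y z (2 * t) yh zh yz.
rewrite mulr_ge0 ?ler0n// yy zz => /(_ isT) yn.
have hE : h = y * y - t *: (1 : calg A) by rewrite yy addrC addKr.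
rewrite hE (le_trans (ler_normB _ _))// calg_norm_herm//.
have -> : 3%:R * t = 2 * t + t by ring.
rewrite lerD//; last by rewrite (le_trans (norm_scalar t))// ger0_norm.
by apply: yn; rewrite addrACA subrr addr0 -scalerDl; congr (_ *: _); ring.
Qed.

Lemma cpos_anti h : cpos h -> cpos (- h) -> h = 0.
Proof.
move=> ph nh; apply/eqP; rewrite -normr_le0; apply: (@ler_rate _ _ _ 3%:R) => n.
rewrite add0r; apply: cpos_bound; [exact: rate_ge0 | exact: ph.1 | |].
  by apply: cposD => //; apply: cpos_scalar; exact: rate_ge0.
by apply: cposD => //; apply: cpos_scalar; exact: rate_ge0.
Qed.

Lemma herm_sq_eq0 h : cst h = h -> h * h = 0 -> h = 0.
Proof.
move=> hh e; apply/eqP; rewrite -normr_eq0 -sqrf_eq0.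
by rewrite -calg_norm_herm// e normr0.
Qed.

Lemma re_im_decomp x : exists a b, [/\ cst a = a, cst b = b & x = a + 'i *: b].
Proof.
pose a := 2^-1 *: (x + cst x); pose b := (2^-1 / 'i) *: (x - cst x).
have c2 : (2^-1 : C)^* = 2^-1 by rewrite fmorphV /= conjC_nat.
exists a, b; split.
- by rewrite /a cstZ cstD cstK c2 addrC.
- rewrite /b cstZ cstB cstK rmorphM /= c2 fmorphV /= conjCi.
  by rewrite invrN mulrN scaleNr -scalerN opprB.
- rewrite /a /b scalerA mulrCA divff ?neq0Ci// mulr1 -scalerDr addrACA subrr addr0.
  have -> : x + x = 2 *: x by rewrite scaler_nat mulr2n.
  by rewrite scalerA mulVf ?scale1r// pnatr_eq0.
Qed.

(** This avoids comparing the spectra of xy and yx. With d the root of c = - z^* z and x = z d, both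
    x^* x and x x^* are negatives of squares, whereas their sum is twice the sum of the squares of
    the real and imaginary parts of x. A vanishing sum of positive squares forces c = 0. *)
Lemma cpos_neg_starsq z : cpos (- (cst z * z)) -> z = 0.
Proof.
set c := - _ => pc; have [d [[dh _] dd dc]] := cpos_sqrt pc.
have cE : cst z * z = - c by rewrite opprK.
have dcE : d * c = c * d by rewrite -dd mulrA.
have ii : 'i * 'i = -1 :> C by rewrite -expr2 sqrCi.
have [a [b [ha hb zE]]] := re_im_decomp (z * d).
have cc : c * c + (a * a + a * a + (b * b + b * b)) + (z * cst z) * (z * cst z) = 0.
  have e1 : cst (z * d) * (z * d) = - (c * c).
    by rewrite cstM dh mulrA -(mulrA d) cE mulrN mulNr dcE -mulrA dd.
  have e2 : (z * d) * cst (z * d) = - ((z * cst z) * (z * cst z)).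
    by rewrite cstM dh mulrA -(mulrA z) dd /c mulrN mulNr !mulrA.
  have e3 : cst (z * d) * (z * d) + (z * d) * cst (z * d) =
      a * a + a * a + (b * b + b * b).
    rewrite zE; have -> : cst (a + 'i *: b) = a - 'i *: b.
      by rewrite cstD cstZ ha hb conjCi scaleNr.
    rewrite mulrDr mulrBl mulrBl mulrDl !mulrBr.
    rewrite -!calg_scaleAl -!calg_scaleAr !scalerA ii !scaleN1r !opprK.
    rewrite addrACA [_ - _ + _]addrACA [X in _ + X]addrACA -opprD.
    by rewrite ['i *: (a * b) + _]addrC addrA addrNK.
  by rewrite -e3 e1 e2 addrA addrN add0r addNr.
have c0 : c = 0.
  apply: herm_sq_eq0; first exact: pc.1.
  apply: cpos_anti; first by apply: cpos_sq; exact: pc.1.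
  have -> : - (c * c) = (a * a + a * a + (b * b + b * b)) + (z * cst z) * (z * cst z).
    by rewrite -[LHS]addr0 -cc !addrA addNr add0r.
  have pa := cpos_sq ha; have pb := cpos_sq hb.
  apply: cposD; first by apply: cposD; exact: cposD.
  by apply: cpos_sq; rewrite cstM cstK.
apply/eqP; rewrite -normr_eq0 -sqrf_eq0 -calg_normE.
by rewrite cE c0 oppr0 normr0.
Qed.

(* With |x| = sqrt (x^2) and q = |x| - x one has q x q = - (k q)^2 where k^2 = |x|,
   so that z = y q satisfies - z^* z >= 0 and vanishes. *)
Lemma cpos_starsq y : cpos (cst y * y).
Proof.
set x := cst y * y; have xh : cst x = x by rewrite cstM cstK.
have [a [pa aa ac]] := cpos_sqrt (cpos_sq xh).
have [k [[kh _] kk kc]] := cpos_sqrt pa.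
have ax : a * x = x * a by apply: ac; rewrite mulrA.
pose q := a - x.
have qh : cst q = q by rewrite cstB pa.1 xh.
have xq : x * q = - (a * q) by rewrite mulrBr mulrBr opprB ax aa.
have kq : k * q = q * k.
  by apply: kc; rewrite mulrBr mulrBl ax.
have kqh : cst (k * q) = k * q by rewrite cstM kh qh kq.
have e : cst (y * q) * (y * q) = - ((k * q) * (k * q)).
  rewrite cstM qh mulrA -(mulrA q) -/x -mulrA xq mulrN; congr (- _).
  by rewrite -kk !mulrA -kq.
have yq : y * q = 0.
  by apply: cpos_neg_starsq; rewrite e opprK; exact: cpos_sq.
have kq0 : k * q = 0.
  apply: herm_sq_eq0 => //; apply/eqP; rewrite -oppr_eq0 -e yq mulr0.
  exact: eqxx.
have aq : a * q = 0 by rewrite -kk -mulrA kq0 mulr0.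
have q0 : q = 0.
  apply: herm_sq_eq0 => //; rewrite {1}/q mulrBl aq xq aq oppr0 subr0.
  by [].
by have -> : x = a; [apply/eqP; rewrite eq_sym -subr_eq0 -/q q0 | exact: pa].
Qed.

Lemma cposP h : cpos h <-> exists y, h = cst y * y.
Proof.
split=> [/cpos_sqrt[k [[kh _] kk _]]|[y ->]]; last exact: cpos_starsq.
by exists k; rewrite kh.
Qed.

End CPositive.

(** * Separation of convex cones *)

Section ConeSeparation.
Variables (R : realType) (E : lmodType R[i]) (star : E -> E).
Local Notation C := R[i].
Local Notation rc := (real_complex R).
Hypothesis starP : forall (a : C) x y, star (a *: x + y) = a^* *: star x + star y.
Hypothesis starK : involutive star.

Let starD x y : star (x + y) = star x + star y.
Proof. by have := starP 1 x y; rewrite conjC1 !scale1r. Qed.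
Let star0 : star 0 = 0.
Proof. by apply: (addrI (star 0)); rewrite -starD !addr0. Qed.
Let starZ a x : star (a *: x) = a^* *: star x.
Proof. by have := starP a x 0; rewrite star0 !addr0. Qed.
Let starN x : star (- x) = - star x.
Proof. by rewrite -scaleN1r starZ rmorphN1 scaleN1r. Qed.

Definition convex_cone (D : set E) : Prop :=
  [/\ forall x, D x -> star x = x, D 0,
      forall x y, D x -> D y -> D (x + y)
    & forall (t : C) x, 0 <= t -> D x -> D (t *: x)].

Section MaximalCone.
Variables (P : set E) (e : E).
Hypotheses (P_cone : convex_cone P) (P_proper : ~ P (- e)).
Hypothesis P_total : forall h, star h = h -> P h \/ P (- h).
Hypothesis P_unit : forall h, star h = h -> exists2 t : C, 0 < t & P (t *: e - h).

Let Pe : P e.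
Proof.
have [_ _ _ PZ] := P_cone.
have [t t0] := P_unit star0; rewrite subr0 => Pt.
have := PZ t^-1 _ _ Pt; rewrite scalerK ?lt0r_neq0//; apply.
by rewrite invr_ge0 ltW.
Qed.

Let P_scalar (r : R) : P (rc r *: e) -> 0 <= r.
Proof.
have [_ _ _ PZ] := P_cone; move=> Pr; rewrite leNgt; apply/negP => r0.
apply: P_proper; have -> : - e = rc (- r)^-1 *: (rc r *: e).
  have rn0 : r != 0 by rewrite lt_eqF.
  by rewrite scalerA -rmorphM /= invrN mulNr mulVf// rmorphN1 scaleN1r.
by apply: PZ => //; rewrite ler0c invr_ge0 oppr_ge0 ltW.
Qed.

Let he : star e = e. Proof. by have [Ph _ _ _] := P_cone; exact: Ph. Qed.

Let phi_ex h : exists phi : R, star h = h ->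
  (forall r, r < phi -> P (h - rc r *: e)) /\ (forall r, P (h - rc r *: e) -> r <= phi).
Proof.
have [hh|nh] := pselect (star h = h); last by exists 0.
have [Ph P0 PD PZ] := P_cone.
have [t t0 Pt] := P_unit hh.
have [s s0 Ps] := P_unit (etrans (starN h) (congr1 _ hh)).
pose S : set R := [set r | P (h - rc r *: e)]%classic.
have Sub r : S r -> r <= complex.Re t.
  move=> Sr; rewrite -subr_ge0; apply: P_scalar.
  rewrite rmorphB /= -gt0_ReE// scalerBl.
  by have := PD _ _ Pt Sr; rewrite addrA subrK.
have S_sup : has_sup S.
  split; last by exists (complex.Re t) => r; exact: Sub.
  exists (- complex.Re s); rewrite /S /= rmorphN /= -gt0_ReE// scaleNr opprK addrC.
  by move: Ps; rewrite opprK.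
exists (sup S) => _; split=> r.
  move=> rS; have d0 : 0 < sup S - r by rewrite subr_gt0.
  have [q Sq] := sup_adherent d0 S_sup; rewrite subKr => rq.
  have -> : h - rc r *: e = (h - rc q *: e) + rc (q - r) *: e.
    by rewrite rmorphB /= scalerBl addrA subrK.
  by apply: PD => //; apply: PZ => //; rewrite ler0c subr_ge0 ltW.
by move=> Sr; apply: ub_le_sup => //; have [] := S_sup.
Qed.

(** A total proper cone with an order unit is a half-space up to its boundary: the largest r with h
    - r e in P is a real linear function of the self-adjoint h, and f combines its values at real
    and imaginary parts. *)
Lemma maximal_cone_functional : exists f : E -> C,
  [/\ forall a x y, f (a *: x + y) = a * f x + f y,
      forall x, f (star x) = (f x)^*, f e = 1 & forall x, P x -> 0 <= f x].
Proof.
have [Ph P0 PD PZ] := P_cone.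
have [phi hphi] := choice phi_ex.
have phi_ge h r : star h = h -> P (h - rc r *: e) -> r <= phi h.
  by move=> /hphi[_]; exact.
have phi_lt h r : star h = h -> r < phi h -> P (h - rc r *: e).
  by move=> /hphi[+ _]; exact.
have rci (r : R) : (rc r)^* = rc r by rewrite conj_Creal//; apply/complex_realP; exists r.
have hZ (r : R) h : star h = h -> star (rc r *: h) = rc r *: h.
  by move=> hh; rewrite starZ hh rci.
have hD h k : star h = h -> star k = k -> star (h + k) = h + k.
  by move=> hh hk; rewrite starD hh hk.
have hN h : star h = h -> star (- h) = - h by move=> hh; rewrite starN hh.
have phi0 : phi 0 = 0.
  apply/eqP; rewrite eq_le; apply/andP; split; last first.
    by apply: (phi_ge) => //; rewrite rmorph0 scale0r subr0.
  apply/ler_addgt0Pr => d d0; rewrite add0r leNgt; apply/negP => dp.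
  have := phi_lt _ _ star0 dp; rewrite sub0r -scaleNr -rmorphN /=.
  by move/P_scalar; rewrite oppr_ge0 leNgt d0.
have phiD h k : star h = h -> star k = k -> phi h + phi k <= phi (h + k).
  move=> hh hk; apply/ler_addgt0Pr => d d0.
  have d2 : 0 < d / 2 by rewrite divr_gt0.
  have p1 := phi_lt h (phi h - d / 2) hh; have p2 := phi_lt k (phi k - d / 2) hk.
  have := PD _ _ (p1 _) (p2 _); rewrite !gtrBl => /(_ d2 d2).
  rewrite addrACA -opprD -scalerDl -rmorphD /= => /(phi_ge _ _ (hD _ _ hh hk)).
  have -> : phi h - d / 2 + (phi k - d / 2) = phi h + phi k - d by field.
  by rewrite lerBlDr.
have phiN h : star h = h -> phi (- h) = - phi h.
  move=> hh; apply/eqP; rewrite eq_le; apply/andP; split.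
    by have := phiD h (- h) hh (hN _ hh); rewrite subrr phi0 -lerBrDl sub0r.
  apply/ler_addgt0Pr => d d0; rewrite -lerBlDr -opprD.
  apply: (phi_ge); first exact: hN.
  rewrite rmorphN /= scaleNr opprK.
  have hk : star (h - rc (phi h + d) *: e) = h - rc (phi h + d) *: e.
    by apply: hD => //; apply: hN; exact: hZ.
  (* Superadditivity gives one inequality. Totality gives the other: h - r e with r above [phi h] is
     outside [P], so its opposite is inside. *)
  have [Pk|] := P_total hk; last by rewrite opprB addrC.
  by have := phi_ge _ _ hh Pk; rewrite gerDl leNgt d0.
have {}phiD h k : star h = h -> star k = k -> phi (h + k) = phi h + phi k.
  move=> hh hk; apply/eqP; rewrite eq_le phiD// andbT -lerBlDr -phiN//.
  by have := phiD (h + k) (- k) (hD _ _ hh hk) (hN _ hk); rewrite addrK.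
have phiZpos (r : R) h : star h = h -> 0 < r -> r * phi h <= phi (rc r *: h).
  move=> hh r0; apply/ler_addgt0Pr => d d0.
  have dr : 0 < d / r by rewrite divr_gt0.
  have := phi_lt h (phi h - d / r) hh; rewrite gtrBl => /(_ dr).
  move/(PZ (rc r)); rewrite ler0c ltW// => /(_ isT).
  rewrite scalerBr scalerA -rmorphM /= => /(phi_ge _ _ (hZ _ _ hh)).
  by rewrite mulrBr mulrCA divff ?lt0r_neq0// mulr1 lerBlDr.
have {}phiZpos (r : R) h : star h = h -> 0 < r -> phi (rc r *: h) = r * phi h.
  move=> hh r0; apply/eqP; rewrite eq_le phiZpos// andbT.
  have ri : 0 < r^-1 by rewrite invr_gt0.
  have := phiZpos r^-1 (rc r *: h) (hZ _ _ hh) ri.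
  rewrite scalerA -rmorphM /= mulVf ?lt0r_neq0// rmorph1 scale1r.
  by rewrite ler_pdivrMl.
have phiZ (r : R) h : star h = h -> phi (rc r *: h) = r * phi h.
  move=> hh; case: (ltgtP r 0) => [r0|r0|->].
  - rewrite -[r]opprK rmorphN /= scaleNr phiN; last exact: hZ.
    by rewrite phiZpos ?oppr_gt0// !mulNr.
  - exact: phiZpos.
  - by rewrite rmorph0 scale0r phi0 mul0r.
pose re x := 2^-1 *: (x + star x); pose im x := (2^-1 / 'i) *: (x - star x).
have c2 : (2^-1 : C)^* = 2^-1 by rewrite fmorphV /= conjC_nat.
have hre x : star (re x) = re x by rewrite /re starZ starD starK c2 addrC.
have him x : star (im x) = im x.
  rewrite /im starZ starD starN starK rmorphM /= c2 fmorphV /= conjCi.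
  by rewrite invrN mulrN scaleNr -scalerN opprB.
have xE x : x = re x + 'i *: im x.
  rewrite /re /im scalerA mulrCA divff ?neq0Ci// mulr1 -scalerDr addrACA subrr addr0.
  have -> : x + x = 2 *: x by rewrite scaler_nat mulr2n.
  by rewrite scalerA mulVf ?scale1r// pnatr_eq0.
have reD x y : re (x + y) = re x + re y.
  by rewrite /re starD addrACA scalerDr.
have imD x y : im (x + y) = im x + im y.
  by rewrite /im starD opprD addrACA scalerDr.
have reR (r : R) x : re (rc r *: x) = rc r *: re x.
  by rewrite /re starZ rci -scalerDr !scalerA mulrC.
have imR (r : R) x : im (rc r *: x) = rc r *: im x.
  by rewrite /im starZ rci -scalerBr !scalerA mulrC.
have rei x : re ('i *: x) = - im x.
  rewrite /re /im starZ conjCi scaleNr -scalerBr scalerA -scaleNr; congr (_ *: _).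
  by rewrite invCi mulrN opprK.
have imi x : im ('i *: x) = re x.
  rewrite /re /im starZ conjCi scaleNr opprK -scalerDr scalerA; congr (_ *: _).
  by rewrite divfK// neq0Ci.
exists (fun x => rc (phi (re x)) + 'i * rc (phi (im x))); split.
- have fD x y : rc (phi (re (x + y))) + 'i * rc (phi (im (x + y))) =
    rc (phi (re x)) + 'i * rc (phi (im x)) + (rc (phi (re y)) + 'i * rc (phi (im y))).
    by rewrite reD imD !phiD// !rmorphD /=; ring.
  move=> a x y; rewrite fD; congr (_ + _).
  have -> : a = rc (complex.Re a) + 'i * rc (complex.Im a) by exact: complexE.
  move: (complex.Re a) (complex.Im a) => p q.
  rewrite scalerDl -scalerA fD reR imR rei imi reR imR !phiN ?phiZ//; last exact: hZ.
  rewrite !(rmorphM, rmorphN) /=.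
  have i2 : 'i * 'i = -1 :> C by rewrite -expr2 sqrCi.
  transitivity (rc p * (rc (phi (re x)) + 'i * rc (phi (im x))) +
    ((-1) * rc q * rc (phi (im x)) + 'i * (rc q * rc (phi (re x))))); first by ring.
  by rewrite -i2; ring.
- move=> x; have -> : re (star x) = re x by rewrite /re starK addrC.
  have -> : im (star x) = - im x by rewrite /im starK -scalerN opprB.
  by rewrite phiN// rmorphN /= rmorphD rmorphM /= conjCi !rci; ring.
- have -> : re e = e.
    have ee : e + e = 2 *: e by rewrite scaler_nat mulr2n.
    by rewrite /re he ee scalerA mulVf ?scale1r// pnatr_eq0.
  have -> : im e = 0 by rewrite /im he subrr scaler0.
  rewrite phi0 rmorph0 mulr0 addr0; suff -> : phi e = 1 by rewrite rmorph1.
  apply/eqP; rewrite eq_le; apply/andP; split; last first.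
    by apply: (phi_ge) => //; rewrite rmorph1 scale1r subrr.
  apply/ler_addgt0Pr => d d0; rewrite leNgt; apply/negP => /(phi_lt _ _ he).
  rewrite -{1}[e]scale1r -scalerBl -(rmorph1 (real_complex R)) -rmorphB /= => /P_scalar.
  by rewrite opprD addrA subrr sub0r oppr_ge0 leNgt d0.
- move=> x Px; have hx := Ph _ Px.
  have -> : re x = x.
    have ee : x + x = 2 *: x by rewrite scaler_nat mulr2n.
    by rewrite /re hx ee scalerA mulVf ?scale1r// pnatr_eq0.
  have -> : im x = 0 by rewrite /im hx subrr scaler0.
  rewrite phi0 rmorph0 mulr0 addr0 ler0c; apply: (phi_ge) => //.
  by rewrite rmorph0 scale0r subr0.
Qed.

End MaximalCone.
End ConeSeparation.

Section Separation.
Variables (R : realType) (E : lmodType R[i]) (star : E -> E).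
Local Notation C := R[i].
Hypothesis starP : forall (a : C) x y, star (a *: x + y) = a^* *: star x + star y.
Hypothesis starK : involutive star.

Let starD x y : star (x + y) = star x + star y.
Proof. by have := starP 1 x y; rewrite conjC1 !scale1r. Qed.
Let star0 : star 0 = 0.
Proof. by apply: (addrI (star 0)); rewrite -starD !addr0. Qed.
Let starZ a x : star (a *: x) = a^* *: star x.
Proof. by have := starP a x 0; rewrite star0 !addr0. Qed.
Let starN x : star (- x) = - star x.
Proof. by rewrite -scaleN1r starZ rmorphN1 scaleN1r. Qed.

Lemma convex_cone_adjoin (P : set E) (h : E) : convex_cone star P -> star h = h ->
  convex_cone star [set x | exists p (t : C), [/\ P p, 0 <= t & x = p + t *: h]]%classic.
Proof.
move=> [Ph P0 PD PZ] hh; split.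
- move=> _ [p [t [Pp t0 ->]]]; rewrite starD starZ hh (Ph _ Pp).
  by rewrite (conj_Creal (ger0_real t0)).
- by exists 0, 0; rewrite scale0r addr0.
- move=> _ _ [p [t [Pp t0 ->]]] [q [s [Pq s0 ->]]].
  exists (p + q), (t + s); split; [exact: PD | exact: addr_ge0 |].
  by rewrite scalerDl addrACA.
- move=> a _ a0 [p [t [Pp t0 ->]]].
  exists (a *: p), (a * t); split; [exact: PZ | exact: mulr_ge0 |].
  by rewrite scalerDr scalerA.
Qed.

Section Extension.
Variables (D : set E) (e : E).
Hypotheses (D_cone : convex_cone star D) (D_proper : ~ D (- e)).
Hypothesis D_unit : forall h, star h = h -> exists2 t : C, 0 < t & D (t *: e - h).

Lemma maximal_cone_exists : exists P : set E, [/\ convex_cone star P, ~ P (- e),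
  (forall x, D x -> P x) & forall h, star h = h -> P h \/ P (- h)].
Proof.
(* The conditions are imposed on the union with [D], so that they also hold for the empty set, the
   union of the empty chain. *)
pose Q (A : set E) := convex_cone star (A `|` D)%classic /\ ~ (A `|` D)%classic (- e).
have [F FQ Ftot|A [[Ac Ae] Amax]] := @Zorn_bigcup E Q.
  have [Dh D0 DD DZ] := D_cone.
  split; last by case=> [[A FA Ae]|//]; have [_] := FQ _ FA; apply; left.
  split.
  - move=> x [[A FA Ax]|]; last exact: Dh.
    by have [[Ah _ _ _] _] := FQ _ FA; apply: Ah; left.
  - by right.
  - move=> x y [[A FA Ax]|Dx] [[B FB By]|Dy].
    + have key X : F X -> X x -> X y -> (\bigcup_(X in F) X `|` D)%classic (x + y).
        move=> FX Xx Xy; have [[_ _ XD _] _] := FQ _ FX.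
        by have [Xxy|] := XD x y (or_introl Xx) (or_introl Xy); [left; exists X | right].
      by have [AB|BA] := Ftot _ _ FA FB; [apply: (key B) => //; exact: AB|apply: (key A) => //; exact: BA].
    + have [[_ _ XD _] _] := FQ _ FA.
      by have [Xxy|] := XD x y (or_introl Ax) (or_intror Dy); [left; exists A | right].
    + have [[_ _ XD _] _] := FQ _ FB.
      by have [Xxy|] := XD x y (or_intror Dx) (or_introl By); [left; exists B | right].
    + by right; exact: DD.
  - move=> t x t0 [[A FA Ax]|Dx]; last by right; exact: DZ.
    have [[_ _ _ XZ] _] := FQ _ FA.
    by have [Xxy|] := XZ t x t0 (or_introl Ax); [left; exists A | right].
exists (A `|` D)%classic; split => //; first by move=> x; right.
set P := (A `|` D)%classic in Ac Ae *.
have [Ph P0 PD PZ] := Ac.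
(* By maximality, adjoining [h] to [P] must bring in [- e]; the coefficient of [h] is nonzero as
   [- e] is not in [P]. *)
have key h : star h = h -> ~ P h -> exists p (t : C), [/\ P p, 0 < t & - e = p + t *: h].
  move=> hh Ph'; pose B : set E := [set x | exists p (t : C), [/\ P p, 0 <= t & x = p + t *: h]]%classic.
  have PB x : P x -> B x by move=> Px; exists x, 0; rewrite scale0r addr0.
  have BD : (B `|` D)%classic = B.
    by apply/seteqP; split => x; [case=> // Dx; apply: PB; right | left].
  have : ~ Q B.
    apply: Amax; split; first by move=> x Ax; apply: PB; left.
    move=> BA; apply: Ph'; left; apply: BA; exists 0, 1.
    by rewrite scale1r add0r; split => //; exact: ler01.
  rewrite /Q BD => nQ.
  have [p [t [Pp t0 et]]] : B (- e).
    by apply: contrapT => nB; apply: nQ; split=> //; exact: convex_cone_adjoin.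
  exists p, t; split=> //; rewrite lt_def t0 andbT; apply/eqP => tz.
  by apply: Ae; rewrite et tz scale0r addr0.
move=> h hh; apply: contrapT => /not_orP[nP nPN].
have [p [t [Pp t0 et]]] := key h hh nP.
have [q [s [Pq s0 es]]] := key (- h) (etrans (starN h) (congr1 _ hh)) nPN.
have ts : 0 < s + t by rewrite addr_gt0.
(* The weights [s] and [t] cancel the multiples of [h] and [- h] in the two expressions of [- e]. *)
apply: Ae; have -> : - e = (s + t)^-1 *: (s *: p + t *: q).
  have -> : s *: p + t *: q = (s + t) *: (- e).
    rewrite scalerDl {1}et es !scalerDr !scalerA scalerN addrACA.
    by rewrite [t * s]mulrC subrr addr0.
  by rewrite scalerK// lt0r_neq0.
apply: (PZ); first by rewrite invr_ge0 ltW.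
by apply: (PD); apply: (PZ) => //; exact: ltW.
Qed.

Lemma cone_functional : exists f : E -> C,
  [/\ forall a x y, f (a *: x + y) = a * f x + f y,
      forall x, f (star x) = (f x)^*, f e = 1 & forall x, D x -> 0 <= f x].
Proof.
have [P [Pc Pe DP Ptot]] := maximal_cone_exists.
have P_unit h : star h = h -> exists2 t : C, 0 < t & P (t *: e - h).
  by move=> /D_unit[t t0 Dt]; exists t => //; exact: DP.
have [f [fl fs fe fP]] := maximal_cone_functional starP starK Pc Pe Ptot P_unit.
by exists f; split=> // x /DP/fP.
Qed.

End Extension.

(** The functional is taken positive on the cone generated by [D] and [- x0], which stays proper
    because [x0] is outside [D]. As [D] need not be closed, [f x0] may be 0; strict inequalities are
    obtained by separating [x0] shifted by a multiple of [e] and using [f e = 1]. *)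
Lemma cone_separation (D : set E) (e x0 : E) : convex_cone star D ->
  (forall h, star h = h -> exists2 t : C, 0 < t & D (t *: e - h)) ->
  star x0 = x0 -> ~ D x0 -> exists f : E -> C,
  [/\ forall a x y, f (a *: x + y) = a * f x + f y,
      forall x, f (star x) = (f x)^*, f e = 1, (forall x, D x -> 0 <= f x) & f x0 <= 0].
Proof.
move=> Dc D_unit hx nDx; have [Dh D0 DD DZ] := Dc.
have De : D e.
  have [t t0] := D_unit _ star0; rewrite subr0 => Dt.
  by rewrite -[e](scalerK (lt0r_neq0 t0)); apply: (DZ) => //; rewrite invr_ge0 ltW.
have hNx : star (- x0) = - x0 by rewrite starN hx.
have D'c := convex_cone_adjoin Dc hNx.
set D' := [set x | _]%classic in D'c.
have DD' x : D x -> D' x by move=> Dx; exists x, 0; rewrite scale0r addr0.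
have D'e : ~ D' (- e).
  move=> [d [t [Dd t0 et]]]; apply: nDx.
  have xt : t *: x0 = d + e.
    by rewrite -[e]opprK et opprD scalerN opprK addrA subrr add0r.
  (* For [t = 0] the cone contains [- e], hence every self-adjoint element since [e] is an order
     unit, and [x0] among them. *)
  have [tz|tn] := eqVneq t 0.
    have De' : D (- e) by rewrite et tz scale0r addr0.
    have [s s0 Ds] := D_unit _ hNx.
    have -> : x0 = (s *: e - - x0) + s *: - e.
      by rewrite opprK scalerN addrAC subrr add0r.
    by apply: (DD) => //; apply: (DZ) => //; exact: ltW.
  rewrite -[x0](scalerK tn) xt; apply: (DZ); first by rewrite invr_ge0.
  exact: DD.
have D'_unit h : star h = h -> exists2 t : C, 0 < t & D' (t *: e - h).
  by move=> /D_unit[t t0 Dt]; exists t => //; exact: DD'.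
have [f [fl fs fe fD]] := cone_functional D'c D'e D'_unit.
exists f; split=> // [x /DD'/fD//|].
have : 0 <= f (- x0).
  by apply: (fD); exists 0, 1; rewrite scale1r add0r; split => //; exact: ler01.
have f0 : f 0 = 0.
  by have := fl 1 0 0; rewrite scale1r addr0 mul1r => h; apply: (addrI (f 0)); rewrite -h addr0.
by have := fl (-1) x0 0; rewrite scaleN1r !addr0 f0 addr0 mulN1r => ->; rewrite oppr_ge0.
Qed.

End Separation.

(** * Minimal and maximal tensor products *)

Section TensorLemmas.
Variables (K : fieldType) (S T : lmodType K).
Implicit Types (s : S) (t : T) (a : K).

Lemma tensDl s s' t : (s + s') ⊗ t = s ⊗ t + s' ⊗ t.
Proof. by have := (tens_bilinear S T).1 t 1 s s'; rewrite /= !scale1r. Qed.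
Lemma tensDr s t t' : s ⊗ (t + t') = s ⊗ t + s ⊗ t'.
Proof. by have := (tens_bilinear S T).2 s 1 t t'; rewrite /= !scale1r. Qed.
Lemma tens0l t : 0 ⊗ t = 0 :> tensor S T.
Proof. by apply: (addrI (0 ⊗ t)); rewrite -tensDl !addr0. Qed.
Lemma tens0r s : s ⊗ 0 = 0 :> tensor S T.
Proof. by apply: (addrI (s ⊗ 0)); rewrite -tensDr !addr0. Qed.
Lemma tensZl a s t : (a *: s) ⊗ t = a *: (s ⊗ t).
Proof. by have := (tens_bilinear S T).1 t a s 0; rewrite /= !addr0 tens0l addr0. Qed.
Lemma tensZr a s t : s ⊗ (a *: t) = a *: (s ⊗ t).
Proof. by have := (tens_bilinear S T).2 s a t 0; rewrite /= !addr0 tens0r addr0. Qed.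
Lemma tensNl s t : (- s) ⊗ t = - (s ⊗ t).
Proof. by rewrite -scaleN1r tensZl scaleN1r. Qed.
Lemma tensNr s t : s ⊗ (- t) = - (s ⊗ t).
Proof. by rewrite -scaleN1r tensZr scaleN1r. Qed.
Lemma tensBl s s' t : (s - s') ⊗ t = s ⊗ t - s' ⊗ t.
Proof. by rewrite tensDl tensNl. Qed.
Lemma tensBr s t t' : s ⊗ (t - t') = s ⊗ t - s ⊗ t'.
Proof. by rewrite tensDr tensNr. Qed.
Lemma tens_suml I r (P : pred I) (F : I -> S) t :
  (\sum_(i <- r | P i) F i) ⊗ t = \sum_(i <- r | P i) F i ⊗ t.
Proof. exact: (big_morph (fun s => s ⊗ t) (fun x y => tensDl x y t) (tens0l t)). Qed.
Lemma tens_sumr I r (P : pred I) (F : I -> T) s :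
  s ⊗ (\sum_(i <- r | P i) F i) = \sum_(i <- r | P i) s ⊗ F i.
Proof. exact: (big_morph (fun t => s ⊗ t) (fun x y => tensDr s x y) (tens0r s)). Qed.

Section Lift.
Variables (U : lmodType K) (b : S -> T -> U).
Hypothesis hb : bilinear_for *:%R *:%R b.
Let B : {bilinear S -> T -> U} := HB.pack b
  (bilinear_isBilinear.Build K S T U *:%R *:%R b hb).

Lemma lift_tens s t : tensor_lift b (s ⊗ t) = b s t.
Proof. exact: (tensor_lift_tens B). Qed.

Lemma lift_linear a (x y : tensor S T) :
  tensor_lift b (a *: x + y) = a *: tensor_lift b x + tensor_lift b y.
Proof. exact: (tensor_lift_linear B). Qed.

Lemma liftD (x y : tensor S T) : tensor_lift b (x + y) = tensor_lift b x + tensor_lift b y.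
Proof. by have := lift_linear 1 x y; rewrite !scale1r. Qed.
Lemma lift0 : tensor_lift b 0 = 0.
Proof. by apply: (addrI (tensor_lift b 0)); rewrite -liftD !addr0. Qed.
Lemma liftZ a (x : tensor S T) : tensor_lift b (a *: x) = a *: tensor_lift b x.
Proof. by have := lift_linear a x 0; rewrite lift0 !addr0. Qed.
Lemma liftN (x : tensor S T) : tensor_lift b (- x) = - tensor_lift b x.
Proof. by rewrite -scaleN1r liftZ scaleN1r. Qed.
Lemma lift_sum I r (P : pred I) (F : I -> tensor S T) :
  tensor_lift b (\sum_(i <- r | P i) F i) = \sum_(i <- r | P i) tensor_lift b (F i).
Proof. exact: (big_morph _ liftD lift0). Qed.

End Lift.

Lemma tensor_ind (P : tensor S T -> Prop) : P 0 -> (forall x y, P x -> P y -> P (x + y)) ->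
  (forall s t, P (s ⊗ t)) -> forall x, P x.
Proof.
move=> P0 PD Pt x; rewrite [x]tensor_span.
by apply: (big_ind P) => // -[s t] _; exact: Pt.
Qed.

End TensorLemmas.

Lemma sum_mxtens (V : nmodType) p q (F : 'I_p * 'I_q -> V) :
  \sum_(k < p * q) F (mxtens_unindex k) = \sum_a \sum_b F (a, b).
Proof.
rewrite pair_bigA /= (reindex (@mxtens_index p q)) /=.
  by apply: eq_bigr => -[a b] _; rewrite mxtens_indexK.
by exists (@mxtens_unindex p q) => ? _; [exact: mxtens_indexK | exact: mxtens_unindexK].
Qed.

Section MaxTensor.
Variables (R : realType) (V : lmodType R[i]) (oV : opsys_data V) (A : cstarAlg R).
Hypothesis hV : is_opsys oV.
Local Notation C := R[i].
Local Notation "x ^§" := (cstar_star x) (at level 2, format "x ^§").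
Local Infix "**" := (@cstar_mul R A) (at level 40).

Let mulZl a (x y : A) : (a *: x) ** y = a *: (x ** y).
Proof. by rewrite (calg_scaleAl a (x : calg A) y). Qed.
Let mulZr a (x y : A) : x ** (a *: y) = a *: (x ** y).
Proof. by rewrite (calg_scaleAr a (x : calg A) y). Qed.
Let mul_suml I r (P : pred I) (F : I -> A) y :
  (\sum_(i <- r | P i) F i) ** y = \sum_(i <- r | P i) F i ** y.
Proof. exact: (@mulr_suml (calg A)). Qed.
Let mul_sumr I r (P : pred I) (F : I -> A) y :
  y ** (\sum_(i <- r | P i) F i) = \sum_(i <- r | P i) y ** F i.
Proof. exact: (@mulr_sumr (calg A)). Qed.

Let star_sum I r (P : pred I) (F : I -> A) :
  (\sum_(i <- r | P i) F i)^§ = \sum_(i <- r | P i) (F i)^§.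
Proof. exact: (@cst_sum _ A). Qed.
Let starZ a (x : A) : (a *: x)^§ = a^* *: x^§.
Proof. exact: (@cstZ _ A). Qed.

(* Writing the positive factor from A as a sum of rank one terms brings the
   elements of [Dmax] to this form. *)
Definition simple_Dmax r (Y : 'I_r -> 'I_r -> tensor V A) : Prop :=
  exists p (S : 'M[V]_p) (x : 'I_p -> 'I_r -> A), mpos oV S /\
    forall i j, Y i j = \sum_k \sum_l S k l ⊗ ((x k i)^§ ** x l j).

Lemma simple_Dmax0 r : simple_Dmax (0 : 'I_r -> 'I_r -> tensor V A).
Proof.
by exists 0, 0, (fun _ _ => 0); split=> [|i j]; [exact: ops_pos0 hV _ | rewrite big_ord0].
Qed.

Let compress_row_mx p q (S : 'M[V]_p) k l :
  compress (row_mx 1%:M 0 : 'M[C]_(p, p + q)) S k l =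
    match fintype.split k, fintype.split l with inl a, inl b => S a b | _, _ => 0 end.
Proof.
rewrite mxE; case: (fintype.splitP k) => a ka; last first.
  rewrite big1// => c _; rewrite big1// => d _.
  by rewrite (_ : k = rshift p a) ?row_mxEr ?mxE ?conjC0 ?mul0r ?scale0r//; exact: val_inj.
rewrite (_ : k = lshift q a); last exact: val_inj.
case: (fintype.splitP l) => b lb; last first.
  rewrite big1// => c _; rewrite big1// => d _.
  by rewrite (_ : l = rshift p b) ?row_mxEr ?mxE ?mulr0 ?scale0r//; exact: val_inj.
rewrite (_ : l = lshift q b); last exact: val_inj.
rewrite (bigD1 a)//= (bigD1 b)//= !row_mxEl !mxE !eqxx conjC1 mulr1 scale1r.
rewrite big1 => [|d db]; last by rewrite row_mxEl !mxE (negPf db) mulr0 scale0r.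
rewrite big1 ?addr0// => c ca; rewrite big1// => d _.
by rewrite row_mxEl !mxE (negPf ca) conjC0 mul0r scale0r.
Qed.

Let compress_row_mx' p q (S : 'M[V]_q) k l :
  compress (row_mx 0 1%:M : 'M[C]_(q, p + q)) S k l =
    match fintype.split k, fintype.split l with inr a, inr b => S a b | _, _ => 0 end.
Proof.
rewrite mxE; case: (fintype.splitP k) => a ka.
  rewrite big1// => c _; rewrite big1// => d _.
  by rewrite (_ : k = lshift q a) ?row_mxEl ?mxE ?conjC0 ?mul0r ?scale0r//; exact: val_inj.
rewrite (_ : k = rshift p a); last exact: val_inj.
case: (fintype.splitP l) => b lb.
  rewrite big1// => c _; rewrite big1// => d _.
  by rewrite (_ : l = lshift q b) ?row_mxEl ?mxE ?mulr0 ?scale0r//; exact: val_inj.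
rewrite (_ : l = rshift p b); last exact: val_inj.
rewrite (bigD1 a)//= (bigD1 b)//= !row_mxEr !mxE !eqxx conjC1 mulr1 scale1r.
rewrite big1 => [|d db]; last by rewrite row_mxEr !mxE (negPf db) mulr0 scale0r.
rewrite big1 ?addr0// => c ca; rewrite big1// => d _.
by rewrite row_mxEr !mxE (negPf ca) conjC0 mul0r scale0r.
Qed.

(** The block diagonal matrix of S and T is positive because it is the sum of their compressions by
    the two coordinate projections. *)
Lemma simple_DmaxD r (Y Z : 'I_r -> 'I_r -> tensor V A) :
  simple_Dmax Y -> simple_Dmax Z -> simple_Dmax (Y + Z).
Proof.
move=> [p [S [x [hS Yx]]]] [q [T [y [hT Zy]]]].
exists (p + q)%N, (compress (row_mx 1%:M 0 : 'M[C]_(p, p + q)) S +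
  compress (row_mx 0 1%:M : 'M[C]_(q, p + q)) T).
exists (fun k i => match fintype.split k with inl a => x a i | inr b => y b i end); split.
  by apply: (ops_posD hV); exact: (ops_compress hV).
move=> i j; rewrite fctE fctE Yx Zy big_split_ord /=.
have Sl (k : 'I_p) : fintype.split (lshift q k) = inl k by exact: (fintype.unsplitK (inl k)).
have Sr (k : 'I_q) : fintype.split (rshift p k) = inr k by exact: (fintype.unsplitK (inr k)).
congr (_ + _).
  apply: eq_bigr => k _; rewrite big_split_ord /= [X in _ + X]big1 ?addr0.
    by apply: eq_bigr => l _; rewrite mxE compress_row_mx compress_row_mx' !Sl addr0.
  by move=> l _; rewrite mxE compress_row_mx compress_row_mx' Sl Sr addr0 tens0l.
apply: eq_bigr => k _; rewrite big_split_ord /= [X in X + _]big1 ?add0r.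
  by apply: eq_bigr => l _; rewrite mxE compress_row_mx compress_row_mx' !Sr add0r.
by move=> l _; rewrite mxE compress_row_mx compress_row_mx' Sl Sr addr0 tens0l.
Qed.

Lemma simple_DmaxZ r (t : C) (Y : 'I_r -> 'I_r -> tensor V A) :
  0 <= t -> simple_Dmax Y -> simple_Dmax (t *: Y).
Proof.
move=> t0 [p [S [x [hS Yx]]]]; exists p, (scale_vmx t S), x; split.
  exact: (ops_posZ hV).
move=> i j; rewrite !fctE Yx scaler_sumr; apply: eq_bigr => k _.
by rewrite scaler_sumr; apply: eq_bigr => l _; rewrite mxE tensZl.
Qed.

Lemma simple_Dmax_sum r (I : finType) (F : I -> 'I_r -> 'I_r -> tensor V A) :
  (forall o, simple_Dmax (F o)) -> simple_Dmax (\sum_o F o).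
Proof.
move=> hF; apply: (big_ind (@simple_Dmax r)) => //; first exact: simple_Dmax0.
exact: simple_DmaxD.
Qed.

Lemma Dmax_simple r (Y : 'M[tensor V A]_r) :
  Dmax oV (cstar_cones A) Y -> simple_Dmax (fun i j => Y i j).
Proof.
move=> [p [q [S [T [X [hS [Z hZ] ->]]]]]].
(* [T] is the sum over [o] of the rank one matrices given by the rows of [Z]; each row absorbs the
   scalar matrix [X]. *)
pose x (o : 'I_q) (k : 'I_p) (i : 'I_r) : A := \sum_m X (mxtens_index (k, m)) i *: Z o m.
pose F o i j : tensor V A := \sum_k \sum_l S k l ⊗ ((x o k i)^§ ** x o l j).
have -> : (fun i j => compress X (tens_mx S T) i j) = \sum_o F o.
  apply/funext => i; apply/funext => j.
  rewrite !fct_sumE /F mxE.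
  pose G1 (km ln : 'I_p * 'I_q) := ((X (mxtens_index km) i)^* * X (mxtens_index ln) j) *:
      (S km.1 ln.1 ⊗ T km.2 ln.2).
  transitivity (\sum_(K < p * q) \sum_(L < p * q) G1 (mxtens_unindex K) (mxtens_unindex L)).
    by apply: eq_bigr => K _; apply: eq_bigr => L _; rewrite /G1 !mxtens_unindexK mxE.
  rewrite (sum_mxtens (fun km => \sum_(L < p * q) G1 km (mxtens_unindex L))).
  under eq_bigr do under eq_bigr do rewrite sum_mxtens.
  rewrite [RHS]exchange_big /=; apply: eq_bigr => k _.
  rewrite [RHS]exchange_big /= exchange_big /=; apply: eq_bigr => l _.
  under [RHS]eq_bigr => o _.
    rewrite /x star_sum mul_suml tens_sumr.
    under eq_bigr => m _.
      rewrite mul_sumr tens_sumr.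
      under eq_bigr => n _ do rewrite starZ mulZl mulZr !tensZr scalerA.
    over.
  over.
  rewrite [RHS]exchange_big /=; apply: eq_bigr => m _.
  rewrite [RHS]exchange_big /=; apply: eq_bigr => n _.
  rewrite -scaler_sumr -tens_sumr /G1 /=; congr (_ *: (_ ⊗ _)).
  by rewrite hZ mxE.
by apply: simple_Dmax_sum => o; exists p, S, (x o).
Qed.

Lemma simple_DmaxP r (Y : 'M[tensor V A]_r) :
  simple_Dmax (fun i j => Y i j) -> Dmax oV (cstar_cones A) Y.
Proof.
move=> [p [S [x [hS Yx]]]].
pose B : 'M[A]_(p * r) := \matrix_(K, L)
  ((x (mxtens_unindex K).1 (mxtens_unindex K).2)^§ **
    x (mxtens_unindex L).1 (mxtens_unindex L).2).
(* Column [i] selects the indices (k, (k, i)), which identifies the index of [S] with the first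
   index of [B]. [B] is Y^* Y for a matrix Y whose only nonzero row, the row 0, lists the elements
   [x k i]. *)
pose X : 'M[C]_(p * (p * r), r) := \matrix_(K, i)
  (mxtens_index ((mxtens_unindex K).1, i) == (mxtens_unindex K).2)%:R.
exists p, (p * r)%N, S, B, X; split => //.
  exists (\matrix_(o, K) if (o : nat) == 0%N then
    x (mxtens_unindex K).1 (mxtens_unindex K).2 else 0).
  apply/matrixP => K L; rewrite !mxE.
  have pr : (0 < p * r)%N by exact: leq_ltn_trans (ltn_ord K).
  rewrite (bigD1 (Ordinal pr))//= !mxE /= big1 ?addr0// => o.
  rewrite -val_eqE /= => /negPf o0; rewrite !mxE o0.
  exact: (mulr0 (_ : calg A)).
apply/matrixP => i j; rewrite Yx mxE.
pose G (K : 'I_p * 'I_(p * r)) (L : 'I_p * 'I_(p * r)) : tensor V A :=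
  (((mxtens_index (K.1, i) == K.2)%:R : C)^* * (mxtens_index (L.1, j) == L.2)%:R) *:
   (S K.1 L.1 ⊗ B K.2 L.2).
transitivity (\sum_K \sum_L G (mxtens_unindex K) (mxtens_unindex L)); last first.
  by apply: eq_bigr => K _; apply: eq_bigr => L _; rewrite /G !mxE.
rewrite (sum_mxtens (fun km => \sum_L G km (mxtens_unindex L))).
apply: eq_bigr => k _.
rewrite (bigD1 (mxtens_index (k, i)))//= [X in _ + X]big1 ?addr0; last first.
  move=> m mk; rewrite big1// => L _.
  by rewrite /G /= eq_sym (negPf mk) conjC0 mul0r scale0r.
rewrite sum_mxtens; apply: eq_bigr => l _.
rewrite (bigD1 (mxtens_index (l, j)))//= [X in _ + X]big1 ?addr0; last first.
  by move=> m ml; rewrite /G /= [_ == m]eq_sym (negPf ml) mulr0 scale0r.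
by rewrite /G /= !eqxx conjC1 mulr1 scale1r mxE !mxtens_indexK.
Qed.

End MaxTensor.

(** The conjugate space: a map that is conjugate linear in both arguments is bilinear into it, so
    that [tensor_lift] also yields the involution of the tensor product. *)
Definition conjmod (R : realType) (U : lmodType R[i]) : Type := U.

Section ConjMod.
Variables (R : realType) (U : lmodType R[i]).
HB.instance Definition _ := GRing.Zmodule.copy (conjmod U) U.
Let cscale (a : R[i]) (u : conjmod U) : conjmod U := (a^* *: (u : U) : U).
Let cscaleA a b u : cscale a (cscale b u) = cscale (a * b) u.
Proof. by rewrite /cscale scalerA rmorphM. Qed.
Let cscale1 : left_id 1 cscale.
Proof. by move=> u; rewrite /cscale conjC1 scale1r. Qed.
Let cscaleDr : right_distributive cscale +%R.
Proof. by move=> a u v; exact: (scalerDr a^* (u : U) (v : U)). Qed.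
Let cscaleDl u : {morph cscale^~ u : a b / a + b}.
Proof. by move=> a b; rewrite /cscale rmorphD; exact: (scalerDl (u : U) a^* b^*). Qed.
HB.instance Definition _ :=
  GRing.Zmodule_isLmodule.Build R[i] (conjmod U) cscaleA cscale1 cscaleDr cscaleDl.

End ConjMod.

Section MaxOrder.
Variables (R : realType) (V : lmodType R[i]) (oV : opsys_data V) (A : cstarAlg R).
Hypothesis hV : is_opsys oV.
Local Notation C := R[i].
Local Notation "x ^§" := (cstar_star x) (at level 2, format "x ^§").
Local Infix "**" := (@cstar_mul R A) (at level 40).
Local Notation one := (cstar_one A).
Local Notation VA := (tensor V A).

Let tstar_bilinear : bilinear_for *:%R *:%R
  (fun s (a : A) => (ops_star oV s ⊗ a^§ : conjmod VA)).
Proof.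
split=> [a c s t|s c a b] /=.
  by rewrite (ops_star_conjlinear hV) tensDl tensZl.
by rewrite cstar_star_conjlinear tensDr tensZr.
Qed.

Definition tstar (x : VA) : VA :=
  tensor_lift (fun s (a : A) => (ops_star oV s ⊗ a^§ : conjmod VA)) x.

Lemma tstarP a x y : tstar (a *: x + y) = a^* *: tstar x + tstar y.
Proof. exact: (lift_linear tstar_bilinear). Qed.
Lemma tstar_tens s a : tstar (s ⊗ a) = ops_star oV s ⊗ a^§.
Proof. exact: (lift_tens tstar_bilinear). Qed.
Lemma tstarD x y : tstar (x + y) = tstar x + tstar y.
Proof. exact: (liftD tstar_bilinear). Qed.
Lemma tstar0 : tstar 0 = 0. Proof. exact: (lift0 tstar_bilinear). Qed.
Lemma tstar_sum I r (P : pred I) (F : I -> VA) :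
  tstar (\sum_(i <- r | P i) F i) = \sum_(i <- r | P i) tstar (F i).
Proof. exact: (big_morph _ tstarD tstar0). Qed.
Lemma tstarK : involutive tstar.
Proof.
apply: tensor_ind => [|x y hx hy|s t]; first by rewrite !tstar0.
  by rewrite !tstarD hx hy.
by rewrite !tstar_tens (ops_starK hV) cstar_starK.
Qed.

Section Fixed.
Variable r : nat.
Local Notation E := ('I_r -> 'I_r -> VA).
Implicit Types (Y Z : E) (i j m n : 'I_r).

Definition estar Y : E := fun i j => tstar (Y j i).

Lemma estarP (a : C) Y Z : estar (a *: Y + Z) = a^* *: estar Y + estar Z.
Proof. by apply/funext => i; apply/funext => j; rewrite /estar /= tstarP. Qed.

Lemma estarK : involutive estar.
Proof. by move=> Y; apply/funext => i; apply/funext => j; rewrite /estar tstarK. Qed.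

Lemma simple_Dmax_herm Y : simple_Dmax oV Y -> estar Y = Y.
Proof.
move=> [p [S [x [hS Yx]]]]; apply/funext => i; apply/funext => j.
rewrite /estar !Yx tstar_sum exchange_big; apply: eq_bigr => l _ /=.
rewrite tstar_sum; apply: eq_bigr => k _; rewrite tstar_tens cstar_starM cstar_starK.
by have /matrixP/(_ k l) := ops_pos_herm hV hS; rewrite !mxE => ->.
Qed.

Definition eunit : E := fun i j => (munit oV ⊗ one) *+ (i == j).

Let el i j (v : VA) : E := fun m n => if (m == i) && (n == j) then v else 0.

Let elD i j u v : el i j (u + v) = el i j u + el i j v.
Proof.
apply/funext => m; apply/funext => n; rewrite !fctE /el.
by case: ifP => _; rewrite ?addr0.
Qed.
Let el0 i j : el i j 0 = 0.
Proof. by apply/funext => m; apply/funext => n; rewrite /el; case: ifP. Qed.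
Let elZ i j a v : el i j (a *: v) = a *: el i j v.
Proof.
apply/funext => m; apply/funext => n; rewrite !fctE /el.
by case: ifP => _; rewrite ?scaler0.
Qed.
Let elB i j u v : el i j (u - v) = el i j u - el i j v.
Proof. by rewrite elD -scaleN1r elZ scaleN1r. Qed.
Let el_sum Y : Y = \sum_i \sum_j el i j (Y i j).
Proof.
apply/funext => m; apply/funext => n; rewrite !fct_sumE (bigD1 m)//= [X in _ + X]big1.
  rewrite addr0 !fct_sumE (bigD1 n)//= [X in _ + X]big1 ?addr0.
    by rewrite /el !eqxx.
  by move=> j jn; rewrite /el eqxx eq_sym (negPf jn).
move=> i im; rewrite !fct_sumE big1// => j _.
by rewrite /el eq_sym (negPf im).
Qed.
Let estar_el i j v : estar (el i j v) = el j i (tstar v).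
Proof.
apply/funext => m; apply/funext => n; rewrite /estar /el andbC.
by case: ifP; rewrite ?tstar0.
Qed.

Let pos_el i s (b : A) : pos1 oV s -> simple_Dmax oV (el i i (s ⊗ (b^§ ** b))).
Proof.
move=> ps; exists 1%N, (const_mx s), (fun _ m => if m == i then b else 0).
split=> // m n; rewrite !big_ord1 mxE /el.
case: (m == i) => /=; last first.
  have -> : (0 : A)^§ = 0 by exact: (@cst0 _ A).
  by rewrite [_ ** _](mul0r (_ : calg A)) tens0r.
case: (n == i) => //=.
by rewrite [_ ** _](mulr0 (_ : calg A)) tens0r.
Qed.

Let unit11 : one = one^§ ** one.
Proof. by rewrite cstar_mul1r [one^§](@cst1 _ A). Qed.

Let eunitE : eunit = \sum_i el i i (munit oV ⊗ one).
Proof.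
apply/funext => m; apply/funext => n; rewrite !fct_sumE (bigD1 m)//= [X in _ + X]big1.
  by rewrite addr0 /el eqxx /= /eunit [n == m]eq_sym; case: (m == n).
by move=> i im; rewrite /el eq_sym (negPf im).
Qed.


Let dominated Y := exists2 t : C, 0 <= t & simple_Dmax oV (t *: eunit - Y).

Let dominatedD Y Z : dominated Y -> dominated Z -> dominated (Y + Z).
Proof.
move=> [t t0 tY] [s s0 sZ]; exists (t + s); first exact: addr_ge0.
by rewrite scalerDl opprD addrACA; exact: simple_DmaxD.
Qed.

Let dominatedZ a Y : 0 <= a -> dominated Y -> dominated (a *: Y).
Proof.
move=> a0 [t t0 tY]; exists (a * t); first exact: mulr_ge0.
by rewrite -scalerA -scalerBr; exact: simple_DmaxZ.
Qed.

Let dominated_le Y Z : simple_Dmax oV (Z - Y) -> dominated Z -> dominated Y.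
Proof.
move=> ZY [t t0 tZ]; exists t => //.
by rewrite -[t *: eunit](subrK Z) -addrA; exact: simple_DmaxD.
Qed.

Let pos_unit_el i : simple_Dmax oV (el i i (munit oV ⊗ one)).
Proof. by rewrite unit11; apply: pos_el; exact: pos1_unit. Qed.

Let dominated_unit_el i : dominated (el i i (munit oV ⊗ one)).
Proof.
exists 1; first exact: ler01.
rewrite scale1r eunitE (bigD1 i)//= addrAC subrr add0r.
apply: (big_ind (@simple_Dmax _ _ oV A r)) => //; first exact: simple_Dmax0.
exact: simple_DmaxD.
Qed.

Let dominated_el i s (b : A) : pos1 oV s -> dominated (el i i (s ⊗ (b^§ ** b))).
Proof.
move=> ps; have [c c0 hc] := pos1_order_unit hV (pos1_herm hV ps).
pose be := `|(cst (b : calg A) * b : calg A)|.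
have [y hy] : exists y : calg A, be *: (1 : calg A) - cst (b : calg A) * b = cst y * y.
  by apply/cposP/cpos_norm; rewrite cstM cstK.
have {}hy : be *: one - b^§ ** b = y^§ ** y by exact: hy.
apply: (@dominated_le _ ((c * be) *: el i i (munit oV ⊗ one))); last first.
  by apply: dominatedZ; [apply: mulr_ge0; [exact: ltW | exact: normr_ge0] | exact: dominated_unit_el].
(* Both factors are dominated separately: c 1 - s is positive in V, and be 1 - b^* b = y^* y in
   A. *)
have -> : (c * be) *: el i i (munit oV ⊗ one) - el i i (s ⊗ (b^§ ** b)) =
   el i i ((c *: munit oV - s) ⊗ (b^§ ** b)) + el i i ((c *: munit oV) ⊗ (y^§ ** y)).
  rewrite -hy -elZ -elB -elD; congr (el i i _).
  by rewrite tensBl tensBr [RHS]addrC addrA subrK tensZl tensZr scalerA.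
apply: simple_DmaxD => //; first exact: pos_el.
apply: pos_el; apply: (pos1Z hV); [exact: ltW | exact: pos1_unit].
Qed.

Let dominated_herm_el i j s (a : A) : pos1 oV s ->
  dominated (el i j (s ⊗ a) + estar (el i j (s ⊗ a))).
Proof.
move=> ps; apply: (@dominated_le _ (el i i (s ⊗ (one^§ ** one)) + el j j (s ⊗ (a^§ ** a)))).
  (* The rank one element of the row with 1 at [i] and - a at [j] has the wanted off-diagonal
     entries, up to sign. Writing the row as a difference also covers [i = j]. *)
  exists 1%N, (const_mx s), (fun _ m => (if m == i then one else 0) - (if m == j then a else 0)).
  split=> // m n; rewrite !big_ord1 mxE estar_el tstar_tens (pos1_herm hV ps) !fctE /el.
  have starB (x y : A) : (x - y)^§ = x^§ - y^§ by exact: (@cstB _ A).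
  have star0 : (0 : A)^§ = 0 by exact: (@cst0 _ A).
  have star1 : one^§ = one by exact: (@cst1 _ A).
  have mulBl (x y z : A) : (x - y) ** z = x ** z - y ** z by exact: (@mulrBl (calg A)).
  have mulBr (x y z : A) : z ** (x - y) = z ** x - z ** y by exact: (@mulrBr (calg A)).
  have mul0l (x : A) : 0 ** x = 0 by exact: (@mul0r (calg A)).
  have mul0r' (x : A) : x ** 0 = 0 by exact: (@mulr0 (calg A)).
  have ifmul (b c : bool) (x y : A) : s ⊗ ((if b then x else 0)^§ ** (if c then y else 0)) =
      if b && c then s ⊗ (x^§ ** y) else 0.
    by case: b; case: c; rewrite /= ?star0 ?mul0l ?mul0r' ?tens0r.
  rewrite starB mulBl !mulBr !tensBr !ifmul star1 !cstar_mul1l cstar_mul1r.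
  by rewrite opprB addrACA -opprD.
by apply: dominatedD; exact: dominated_el.
Qed.

(** This supplies the order unit that separation requires. Domination of Z + Z^* is additive in Z,
    which reduces it to a single entry s ⊗ a with s positive; a self-adjoint Y is half of Y +
    Y^*. *)
Lemma dominated_herm Y : estar Y = Y ->
  exists2 t : C, 0 < t & simple_Dmax oV (t *: eunit - Y).
Proof.
have P0 : dominated 0.
  by exists 0 => //; rewrite scale0r subrr; exact: simple_Dmax0.
have estarD Z Z' : estar (Z + Z') = estar Z + estar Z'.
  by have := estarP 1 Z Z'; rewrite conjC1 !scale1r.
have estar0 : estar 0 = 0 by apply: (addrI (estar 0)); rewrite -estarD !addr0.
pose P Z := dominated (Z + estar Z).
have PD Z Z' : P Z -> P Z' -> P (Z + Z').
  by rewrite /P estarD addrACA; exact: dominatedD.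
have PsumI (I : finType) (F : I -> E) : (forall o, P (F o)) -> P (\sum_o F o).
  move=> hF; apply: (big_ind P) => [|Z Z'|o _]; [|exact: PD|exact: hF].
  by rewrite /P estar0 addr0.
have Pel i j v : P (el i j v).
  elim/tensor_ind: v => [|u v Pu Pv|s a]; first by rewrite el0 /P estar0 addr0.
    rewrite elD; apply: PD; [exact: Pu | exact: Pv].
  move: s a; apply: (opsys_span_ind hV) => [s ps a|c s u Ps Pu a].
    exact: dominated_herm_el.
  by rewrite tensDl tensZl -tensZr elD; apply: PD.
move=> hY; have : P Y.
  by rewrite [Y]el_sum; apply: (PsumI) => i; apply: (PsumI) => j; exact: Pel.
rewrite /P hY => -[t t0 tY].
exists (2^-1 * t + 1); first by rewrite ltr_wpDl ?ltr01// mulr_ge0// invr_ge0 ler0n.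
have -> : (2^-1 * t + 1) *: eunit - Y = 2^-1 *: (t *: eunit - (Y + Y)) + eunit.
  have YY : Y + Y = 2 *: Y by rewrite scaler_nat mulr2n.
  by rewrite YY scalerBr !scalerA mulVf ?pnatr_eq0// scale1r scalerDl scale1r addrAC.
apply: simple_DmaxD => //; first by apply: simple_DmaxZ; rewrite // invr_ge0 ler0n.
rewrite eunitE; apply: (big_ind (@simple_Dmax _ _ oV A r)) => //; first exact: simple_Dmax0.
exact: simple_DmaxD.
Qed.

(** Failure of max positivity means that some X + eps 1 lies outside D^max. Since the functional is
    1 at the unit, separating this element makes it at most - eps at X. *)
Lemma max_separation (X : 'M[VA]_r) : (forall i j, tstar (X j i) = X i j) ->
  ~ mpos (max_tensor oV (cstar_cones A)) X -> exists f : E -> C,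
  [/\ forall a x y, f (a *: x + y) = a * f x + f y,
      forall x, f (estar x) = (f x)^*, (forall x, simple_Dmax oV x -> 0 <= f x)
    & exists2 e : C, 0 < e & f (fun i j => X i j) <= - e].
Proof.
move=> hX nX.
have [eps [eps0 neps]] : exists eps : C, 0 < eps /\
    ~ simple_Dmax oV ((fun i j => X i j) + eps *: eunit).
  apply: contrapT => h; apply: nX => /= eps eps0; apply: (simple_DmaxP (oV := oV)).
  apply: contrapT => neps; apply: h; exists eps; split => // hs; apply: neps.
  move: hs; congr (simple_Dmax oV _); apply/funext => i; apply/funext => j.
  by rewrite !fctE !mxE /=.
pose D : set E := @simple_Dmax _ _ oV A r.
have Dc : convex_cone estar D.
  split; [exact: simple_Dmax_herm | exact: simple_Dmax0 | |].
    by move=> x y; exact: simple_DmaxD.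
  by move=> t x; exact: simple_DmaxZ.
have ue : estar eunit = eunit.
  apply: simple_Dmax_herm; rewrite eunitE.
  apply: (big_ind (@simple_Dmax _ _ oV A r)) => //; first exact: simple_Dmax0.
  exact: simple_DmaxD.
have hXe : estar ((fun i j => X i j) + eps *: eunit) = (fun i j => X i j) + eps *: eunit.
  rewrite addrC estarP ue (conj_Creal (gtr0_real eps0)); congr (_ + _).
  by apply/funext => i; apply/funext => j; rewrite /estar hX.
have [f [fl fs fe fD fX]] := cone_separation estarP estarK Dc dominated_herm hXe neps.
exists f; split=> //; exists eps => //.
by move: fX; rewrite addrC fl fe mulr1 -lerBrDl sub0r.
Qed.

End Fixed.
End MaxOrder.

(** * Scalar matrices and normalisation of completely positive maps *)

Section ScalarMatrices.
Variable R : realType.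
Local Notation C := R[i].
Local Notation adj X := (map_mx conjC X^T).

Lemma adjmxM m n p (A : 'M[C]_(m, n)) (B : 'M[C]_(n, p)) : adj (A *m B) = adj B *m adj A.
Proof. by rewrite trmx_mul map_mxM. Qed.
Lemma adjmxK m n (A : 'M[C]_(m, n)) : adj (adj A) = A.
Proof. by apply/matrixP => i j; rewrite !mxE conjCK. Qed.

Definition qform n (T : 'M[C]_n) (x y : 'cV[C]_n) : C := (adj y *m T *m x) 0 0.

Lemma qform_sesqui n (T : 'M[C]_n) : sesquiform (qform T).
Proof.
split=> a x y z; rewrite /qform.
  by rewrite linearP /= mxE [X in X + _ = _]mxE.
by rewrite linearP map_mxD map_mxZ mulmxDl mulmxDl -!scalemxAl mxE [X in X + _ = _]mxE.
Qed.

Lemma qform_tens n (T : 'M[C]_n) m (X : 'M[C]_(n, m)) x y :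
  qform T (X *m x) (X *m y) = qform (adj X *m T *m X) x y.
Proof. by rewrite /qform adjmxM !mulmxA. Qed.

(** Keeping only the nonzero eigenvalues gives [Z] full row rank, hence a right inverse [W], with
    which [cp_normalise] divides by [Z]. *)
Lemma psd_factor n (T : 'M[C]_n) : psd (qform T) ->
  exists r (Z : 'M[C]_(r, n)) (W : 'M[C]_(n, r)), T = adj Z *m Z /\ Z *m W = 1%:M.
Proof.
move=> Tpos.
have Th : T = adj T.
  apply/matrixP => i j; have := psd_herm (qform_sesqui T) Tpos (delta_mx i 0) (delta_mx j 0).
  have e a b : qform T (delta_mx a 0) (delta_mx b 0) = T b a.
    by rewrite /qform trmx_delta map_delta_mx -colE -rowE !mxE.
  by rewrite !e !mxE.
have Tn : T \is normalmx.
  apply: hermitian_normalmx; apply/is_hermitianmxP.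
  by rewrite expr0 scale1r -Th.
have := orthomx_spectralP Tn; set U := spectralmx T; set d := spectral_diag T.
have Uu : U \is unitarymx := spectral_unitarymx T.
rewrite (invmx_unitary Uu) => TE.
have UU : U *m adj U = 1%:M by apply/unitarymxP.
have dpos i : 0 <= d 0 i.
  have := Tpos (adj U *m delta_mx i 0); rewrite qform_tens adjmxK {1}TE.
  rewrite !mulmxA UU mul1mx -mulmxA UU mulmx1 /qform trmx_delta map_delta_mx.
  by rewrite -colE -rowE !mxE eqxx.
pose s i := sqrtC (d 0 i).
have sC i : (s i)^* = s i by rewrite conj_Creal// ger0_real// sqrtC_ge0.
pose e (a : 'I_#|[pred i | d 0 i != 0]|) := enum_val a.
have s0 a : s (e a) != 0 by rewrite sqrtC_eq0; have := enum_valP a; rewrite inE.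
exists _, (\matrix_(a, j) (s (e a) * U (e a) j)), (\matrix_(j, a) ((U (e a) j)^* / s (e a))).
split.
  apply/matrixP => i j; rewrite {1}TE !mxE.
  transitivity (\sum_(k | d 0 k != 0) (d 0 k * (U k i)^* * U k j)).
    rewrite [RHS]big_mkcond /=; apply: eq_bigr => k _.
    rewrite mxE (bigD1 k)//= !mxE eqxx mulr1n big1 ?addr0.
      by case: eqVneq => [->|_] /=; rewrite ?mulr0 ?mul0r// [d 0 k * _]mulrC.
    by move=> l lk; rewrite !mxE (negPf lk) mulr0n mulr0.
  rewrite (@big_enum_val _ _ _ _ [pred i | d 0 i != 0] (fun k => d 0 k * (U k i)^* * U k j)).
  apply: eq_bigr => a _; rewrite !mxE rmorphM /= sC.
  by rewrite -[d 0 _]sqrtCK -/(s _) -/(e a); ring.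
apply/matrixP => a b; rewrite !mxE.
have := congr1 (fun M : 'M_n => M (e a) (e b)) UU; rewrite !mxE => Uab.
transitivity (s (e a) / s (e b) * \sum_j U (e a) j * (adj U) j (e b)).
  by rewrite mulr_sumr; apply: eq_bigr => j _; rewrite !mxE; ring.
rewrite Uab (inj_eq enum_val_inj); case: eqVneq => [->|_]; last by rewrite mulr0.
by rewrite mulr1 divff.
Qed.

End ScalarMatrices.

Section UnitSpanned.
Variable R : realType.
Local Notation C := R[i].
Local Notation adj X := (map_mx conjC X^T).

(** The common feature of operator systems and C*-algebras: elements between 0 and a multiple of the
    unit span. The induction form lets [cp_normalise] treat both factors of a tensor product
    alike. *)
Definition unit_spanned (V : lmodType C) (o : mcones V) : Prop :=
  mpos o (const_mx (munit o) : 'M_1) /\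
  forall P : V -> Prop,
    (forall x (t : C), mpos o (const_mx x : 'M_1) -> 0 <= t ->
       mpos o (const_mx (t *: munit o - x) : 'M_1) -> P x) ->
    (forall (a : C) x y, P x -> P y -> P (a *: x + y)) -> forall x, P x.

Lemma opsys_unit_spanned (V : lmodType C) (o : opsys_data V) :
  is_opsys o -> unit_spanned o.
Proof.
move=> ho; split=> [|P Pp PD]; first exact: pos1_unit.
apply: (opsys_span_ind ho) => // x px.
have [t t0 pt] := pos1_order_unit ho (pos1_herm ho px).
by apply: (Pp x t) => //; exact: ltW.
Qed.

Lemma cstar_pos1 (A : cstarAlg R) (x : calg A) :
  mpos (cstar_cones A) (const_mx x : 'M[A]_1) <-> cpos x.
Proof.
rewrite cposP; split=> [[Y /matrixP/(_ 0 0)]|[y xy]].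
  by rewrite !mxE big_ord1 => ->; exists (Y 0 0).
exists (const_mx y); apply/matrixP => i j; rewrite !mxE big_ord1 !mxE.
exact: xy.
Qed.

Lemma cstar_unit_spanned (A : cstarAlg R) : unit_spanned (cstar_cones A).
Proof.
have p1 (t : C) : 0 <= t -> cpos (t *: (1 : calg A)) by exact: cpos_scalar.
split=> [|P Pp PD].
  by apply/(@cstar_pos1 A 1); have := p1 1 ler01; rewrite scale1r.
have {}Pp (x : calg A) (t : C) : cpos x -> 0 <= t -> cpos (t *: (1 : calg A) - x) -> P x.
  move=> /cstar_pos1 px t0 /cstar_pos1 pt; exact: (Pp x t).
have Ph (h : calg A) : cst h = h -> P h.
  move=> hh; have b0 : 0 <= `|h| by [].
  have -> : h = (-1 : C) *: (`|h| *: (1 : calg A) - h) + `|h| *: (1 : calg A).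
    by rewrite scaleN1r opprB subrK.
  apply: PD.
    apply: (Pp _ (2 * `|h|)); first exact: cpos_norm.
      by rewrite mulr_ge0// ler0n.
    have -> : (2 * `|h|) *: (1 : calg A) - (`|h| *: (1 : calg A) - h) = `|h| *: (1 : calg A) - - h.
      by rewrite mulr_natl mulr2n scalerDl opprB addrACA subrr addr0 opprK.
    by rewrite -(normrN h); apply: cpos_norm; rewrite cstN hh.
  apply: (Pp _ `|h|) => //; first exact: p1.
  by rewrite subrr -(scale0r (1 : calg A)); exact: p1.
move=> x; have [a [b [ha hb ->]]] := re_im_decomp (x : calg A).
by rewrite addrC; apply: PD; exact: Ph.
Qed.

Lemma mx_pos1 p (T : 'M[C]_p) :
  mpos (mx_cones R p) (const_mx T : 'M_1) <-> psd (qform T).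
Proof.
split=> [h x|h v]; last by rewrite !big_ord1 [const_mx T _ _]mxE; exact: h.
by have := h (fun=> x); rewrite !big_ord1 [const_mx T _ _]mxE.
Qed.

(** With Z^* Z the value of [phi] at the unit and Z W = 1, the unital map is W^* phi W. Nothing is
    lost: if 0 <= x <= t 1 then Cauchy-Schwarz makes [phi x] vanish on the kernel of Z^* Z, which is
    the range of [N], so [phi] lives on the range of W Z. *)
Lemma cp_normalise (V : lmodType C) (o : mcones V) : unit_spanned o ->
  forall p (phi : V -> 'M[C]_p), cp o (mx_cones R p) phi ->
  exists q (psi : V -> 'M[C]_q) (Z : 'M[C]_(q, p)),
    ucp o (mx_cones R q) psi /\ forall v, phi v = adj Z *m psi v *m Z.
Proof.
move=> [pu sp] p phi [phil phip].
have phi1 x : mpos o (const_mx x : 'M_1) -> psd (qform (phi x)).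
  move=> px; apply/mx_pos1; have := phip _ _ px.
  by rewrite (_ : map_mx phi _ = const_mx (phi x))//; apply/matrixP => i j; rewrite !mxE.
have phiD x y : phi (x + y) = phi x + phi y by have := phil 1 x y; rewrite !scale1r.
have phi0 : phi 0 = 0 by apply: (addrI (phi 0)); rewrite -phiD !addr0.
have phiZ a x : phi (a *: x) = a *: phi x by have := phil a x 0; rewrite phi0 !addr0.
have phiB x y : phi (x - y) = phi x - phi y by rewrite phiD -scaleN1r phiZ scaleN1r.
have [q [Z [W [TE ZW]]]] := psd_factor (phi1 _ pu).
have [N NE] : exists N, N = 1%:M - W *m Z by eexists.
have TN : phi (munit o) *m N = 0.
  by rewrite TE -mulmxA NE mulmxBr mulmx1 mulmxA ZW mul1mx subrr mulmx0.
have killN v : phi v *m N = 0 /\ adj N *m phi v = 0.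
  move: v; apply: sp => [x t px t0 pt|a x y [h1 h2] [h3 h4]]; last first.
    by rewrite phil mulmxDl (mulmxDr (adj N)) -scalemxAl -scalemxAr h1 h2 h3 h4 scaler0 addr0.
  have hx := phi1 _ px; have ht := phi1 _ pt.
  have s := qform_sesqui (phi x).
  have xN0 (y : 'cV_p) : qform (phi x) (N *m y) (N *m y) = 0.
    apply/eqP; rewrite eq_le hx andbT.
    have := ht (N *m y); rewrite phiB phiZ.
    have -> : qform (t *: phi (munit o) - phi x) (N *m y) (N *m y) =
        - qform (phi x) (N *m y) (N *m y).
      rewrite qform_tens mulmxBr mulmxBl -scalemxAr -scalemxAl -[_ *m phi (munit o) *m _]mulmxA TN.
      rewrite mulmx0 scaler0 sub0r qform_tens /qform mulmxN mulNmx !mxE.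
      by [].
    by rewrite oppr_ge0.
  have xN1 (y z : 'cV_p) : qform (phi x) (N *m y) z = 0.
    apply/eqP; rewrite -normr_eq0 -sqrf_eq0 eq_le exprn_ge0// andbT.
    by have := psd_CS s hx (N *m y) z; rewrite xN0 mul0r.
  have e T a b : qform T (delta_mx a 0) (delta_mx b 0) = T b a.
    by rewrite /qform trmx_delta map_delta_mx -colE -rowE !mxE.
  have e1 : phi x *m N = 0.
    apply/matrixP => i j; have := xN1 (delta_mx j 0) (delta_mx i 0).
    rewrite /qform mulmxA -[adj _ *m _ *m N]mulmxA.
    by rewrite trmx_delta map_delta_mx -colE -rowE !mxE => ->.
  split=> //; rewrite -[LHS]adjmxK adjmxM adjmxK.
  suff -> : adj (phi x) = phi x by rewrite e1; apply/matrixP => i j; rewrite !mxE conjC0.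
  apply/matrixP => i j; rewrite !mxE -[phi x j i]e -[phi x i j]e.
  exact/esym/(psd_herm s hx).
exists q, (fun v => adj W *m phi v *m W), Z; split; first split; first split.
- by move=> a x y; rewrite phil mulmxDr mulmxDl -scalemxAr -scalemxAl.
- move=> r A /phip hA v; have := hA (fun i => W *m v i).
  rewrite [X in 0 <= X -> _](_ : _ = \sum_i \sum_j
    (adj (v i) *m map_mx (fun u => adj W *m phi u *m W) A i j *m v j) 0 0)//.
  by apply: eq_bigr => i _; apply: eq_bigr => j _; rewrite ![map_mx _ A i j]mxE adjmxM !mulmxA.
- by rewrite TE mulmxA -adjmxM ZW -mulmxA ZW mulmx1 trmx1 map_mx1.
move=> v; have [v1 v2] := killN v.
have e1 : phi v = phi v *m (W *m Z).
  by rewrite -[LHS]mulmx1 -[1%:M](subrK (W *m Z)) -NE mulmxDr v1 add0r.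
have e2 : phi v = adj (W *m Z) *m phi v.
  have -> : adj (W *m Z) = 1%:M - adj N.
    rewrite NE linearB map_mxB /= trmx1 map_mx1 opprB addrC subrK.
    by [].
  by rewrite mulmxBl mul1mx v2 subr0.
by rewrite {1}e2 {1}e1 adjmxM !mulmxA.
Qed.

Lemma tens_mx_bilinear (V W : lmodType C) p q (phi : V -> 'M[C]_p) (psi : W -> 'M[C]_q) :
  linear phi -> linear psi -> bilinear_for *:%R *:%R (fun s t => phi s *t psi t).
Proof.
move=> phil psil; split=> [t a x y|s a x y] /=; apply/matrixP => i j; rewrite !mxE.
  by rewrite phil !mxE mulrDl mulrA.
by rewrite psil !mxE mulrDr mulrCA.
Qed.

(** The minimal cone tests against unital maps only, whereas the maps that arise from duality and
    from functionals are not unital. They are compressions of unital ones, and so is their tensor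
    product. *)
Lemma min_pos_cp (V W : lmodType C) (oV : mcones V) (oW : mcones W) :
  unit_spanned oV -> unit_spanned oW ->
  forall r (X : 'M[tensor V W]_r), mpos (min_tensor oV oW) X ->
  forall p q (phi : V -> 'M[C]_p) (psi : W -> 'M[C]_q),
    cp oV (mx_cones R p) phi -> cp oW (mx_cones R q) psi ->
    mpos (mx_cones R (p * q)) (map_mx (tensor_lift (fun s t => phi s *t psi t)) X).
Proof.
move=> sV sW r X hX p q phi psi cphi cpsi.
have [p' [phi' [Z [uphi phiE]]]] := cp_normalise sV cphi.
have [q' [psi' [Z' [upsi psiE]]]] := cp_normalise sW cpsi.
have b1 := tens_mx_bilinear cphi.1 cpsi.1.
have b2 := tens_mx_bilinear uphi.1.1 upsi.1.1.
have liftE x : tensor_lift (fun s t => phi s *t psi t) x =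
    adj (Z *t Z') *m tensor_lift (fun s t => phi' s *t psi' t) x *m (Z *t Z').
  elim/tensor_ind: x => [|x y hx hy|s t]; first by rewrite !lift0// mulmx0 mul0mx.
    by rewrite (liftD b1) (liftD b2) hx hy mulmxDr mulmxDl.
  by rewrite (lift_tens b1) (lift_tens b2) trmx_tens map_mxT !tensmx_mul phiE psiE.
move=> v; have := hX _ _ _ _ uphi upsi (fun i => (Z *t Z') *m v i).
rewrite [X in 0 <= X -> _](_ : _ = \sum_i \sum_j
    (adj (v i) *m map_mx (tensor_lift (fun s t => phi s *t psi t)) X i j *m v j) 0 0)//.
by apply: eq_bigr => i _; apply: eq_bigr => j _; rewrite ![map_mx _ X i j]mxE liftE adjmxM !mulmxA.
Qed.

End UnitSpanned.

Lemma exchange_big4 (M : nmodType) (I J K L : finType) (F : I -> J -> K -> L -> M) :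
  \sum_i \sum_j \sum_k \sum_l F i j k l = \sum_k \sum_l \sum_i \sum_j F i j k l.
Proof.
rewrite pair_bigA [RHS]pair_bigA /=.
under eq_bigr do rewrite pair_bigA /=.
under [RHS]eq_bigr do rewrite pair_bigA /=.
by rewrite exchange_big.
Qed.

(** * Completely positive maps and positive functionals on a C*-algebra *)

Section CStates.
Variables (R : realType) (A : cstarAlg R).
Local Notation C := R[i].
Local Notation adj X := (map_mx conjC X^T).

Lemma qformE n (T : 'M[C]_n) x y :
  qform T x y = \sum_a \sum_b (y a 0)^* * T a b * x b 0.
Proof.
rewrite /qform mxE exchange_big /=; apply: eq_bigr => b _.
by rewrite mxE mulr_suml; apply: eq_bigr => a _; rewrite !mxE.
Qed.

(** A positive matrix over A is a sum of rank one matrices given by rows, and the test vectors can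
    be absorbed in each row. One tuple of length [q] thus tests all matrix sizes. *)
Lemma cstar_cp q (eta : calg A -> 'M[C]_q) : linear eta ->
  (forall y : 'I_q -> calg A, 0 <= \sum_a \sum_b eta (cst (y a) * y b) a b) ->
  cp (cstar_cones A) (mx_cones R q) eta.
Proof.
move=> etal hpos; split=> // r X [Y ->] v.
have etaD x y : eta (x + y) = eta x + eta y by have := etal 1 x y; rewrite !scale1r.
have eta0 : eta 0 = 0 by apply: (addrI (eta 0)); rewrite -etaD !addr0.
have etaZ a x : eta (a *: x) = a *: eta x by have := etal a x 0; rewrite eta0 !addr0.
have eta_sum I s (P : pred I) (F : I -> calg A) a b :
    eta (\sum_(i <- s | P i) F i) a b = \sum_(i <- s | P i) eta (F i) a b.
  by rewrite (big_morph eta etaD eta0) summxE.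
pose Xk k i j : calg A := cst (Y k i : calg A) * (Y k j : calg A).
have -> : \sum_i \sum_j (adj (v i) *m map_mx eta (\matrix_(i, j) \sum_k
    cstar_mul (cstar_star (Y k i)) (Y k j)) i j *m v j) 0 0 =
  \sum_k \sum_i \sum_j qform (eta (Xk k i j)) (v j) (v i).
  rewrite [RHS]exchange_big /=; apply: eq_bigr => i _.
  rewrite [RHS]exchange_big /=; apply: eq_bigr => j _.
  rewrite [map_mx _ _ _ _]mxE [X in eta X]mxE -/(qform _ _ _) qformE.
  under [RHS]eq_bigr do rewrite qformE.
  rewrite [RHS]exchange_big /=; apply: eq_bigr => a _.
  rewrite [RHS]exchange_big /=; apply: eq_bigr => b _.
  have -> : eta (\sum_k cstar_mul (cstar_star (Y k i)) (Y k j)) a b = \sum_k eta (Xk k i j) a b.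
    exact: eta_sum.
  by rewrite mulr_sumr mulr_suml.
apply: sumr_ge0 => k _.
have -> : \sum_i \sum_j qform (eta (Xk k i j)) (v j) (v i) =
  \sum_a \sum_b eta (cst (\sum_i v i a 0 *: (Y k i : calg A)) * \sum_i v i b 0 *: (Y k i : calg A)) a b.
  under eq_bigr do under eq_bigr do rewrite qformE.
  rewrite exchange_big4; apply: eq_bigr => a _; apply: eq_bigr => b _.
  rewrite cst_sum mulr_suml eta_sum; apply: eq_bigr => i _.
  rewrite mulr_sumr eta_sum; apply: eq_bigr => j _.
  by rewrite cstZ -calg_scaleAl -calg_scaleAr scalerA etaZ mxE mulrAC.
exact: hpos.
Qed.

Definition positive_functional (g : calg A -> C) : Prop :=
  (forall a x y, g (a *: x + y) = a * g x + g y) /\ forall y, 0 <= g (cst y * y).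

Lemma positive_functional_cp g : positive_functional g ->
  cp (cstar_cones A) (mx_cones R 1) (fun a => (g a)%:M).
Proof.
move=> [gl gp]; apply: cstar_cp => [a x y|y].
  by rewrite gl raddfD /= scalar_mxM -mul_scalar_mx.
by rewrite !big_ord1 mxE eqxx mulr1n.
Qed.

(** For h self-adjoint and killed by these functionals, h + [rate R n] and - h + [rate R n] are
    positive, since a separating functional would have the value [rate R n] > 0 there instead of a
    value at most 0. [cpos_bound] then gives h = 0. *)
Lemma positive_functional_separate (a : calg A) :
  (forall g, positive_functional g -> (forall x, g (cst x) = (g x)^*) -> g a = 0) -> a = 0.
Proof.
move=> ha.
have Dc : convex_cone (@cst _ A) [set x | cpos x]%classic.
  split=> [x []//||x y|t x t0]; last exact: cposZ.
    by rewrite /= -(scale0r (1 : calg A)); exact: cpos_scalar.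
  exact: cposD.
have Du (h : calg A) : cst h = h ->
    exists2 t : C, 0 < t & [set x | cpos x]%classic (t *: (1 : calg A) - h).
  move=> hh; exists (`|h| + 1); first by rewrite ltr_wpDl.
  rewrite /= scalerDl scale1r addrAC; apply: cposD; first exact: cpos_norm.
  by rewrite -[1](scale1r (1 : calg A)); exact: cpos_scalar.
have key (h : calg A) n : cst h = h -> (forall g, positive_functional g ->
    (forall x, g (cst x) = (g x)^*) -> g h = 0) -> cpos (rate R n *: (1 : calg A) + h).
  move=> hh hg; apply: contrapT => nc.
  have hx : cst (rate R n *: (1 : calg A) + h) = rate R n *: (1 : calg A) + h.
    by rewrite cstD hh cst_scalar ?rate_ge0.
  have [f [fl fs fe fD fx]] := cone_separation (@cstP _ A) (@cstK _ A) Dc Du hx nc.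
  have fp : positive_functional f by split=> // y; apply: fD; exact: cpos_starsq.
  move: fx; rewrite fl fe (hg _ fp fs) mulr1 addr0 => /(lt_le_trans (rate_gt0 R n)).
  by rewrite ltxx.
have herm0 (h : calg A) : cst h = h -> (forall g, positive_functional g ->
    (forall x, g (cst x) = (g x)^*) -> g h = 0) -> h = 0.
  move=> hh hg; apply/eqP; rewrite -normr_le0; apply: (@ler_rate _ _ _ 3%:R) => n.
  rewrite add0r; apply: cpos_bound => //; [exact: rate_ge0|exact: key|].
  apply: key => [|g gp gs]; first by rewrite cstN hh.
  have g0 : g 0 = 0.
    by have := gp.1 (-1) h h; rewrite scaleN1r addNr (hg g gp gs) mulr0 addr0.
  by have := gp.1 (-1) h 0; rewrite scaleN1r addr0 (hg g gp gs) g0 mulr0 addr0.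
have [b [c [hb hc ac]]] := re_im_decomp a.
have bc g : positive_functional g -> (forall x, g (cst x) = (g x)^*) -> g b = 0 /\ g c = 0.
  move=> gp gs; have := ha g gp gs; rewrite ac addrC gp.1 => e.
  have rb : (g b)^* = g b by rewrite -gs hb.
  have rc : (g c)^* = g c by rewrite -gs hc.
  have e' : - 'i * g c + g b = 0.
    by have := congr1 conjC e; rewrite conjC0 rmorphD rmorphM /= conjCi rb rc.
  have b0 : g b = 0.
    apply: (mulfI (_ : 2 != 0 :> C)); first by rewrite pnatr_eq0.
    transitivity (('i * g c + g b) + (- 'i * g c + g b)); first by ring.
    by rewrite e e' addr0 mulr0.
  split=> //; move: e; rewrite b0 addr0 => /eqP; rewrite mulf_eq0 (negPf (neq0Ci C)) /=.
  by move/eqP.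
have b0 : b = 0 by apply: herm0 => // g gp gs; have [] := bc g gp gs.
have c0 : c = 0 by apply: herm0 => // g gp gs; have [] := bc g gp gs.
by rewrite ac b0 c0 scaler0 addr0.
Qed.

End CStates.

(** * The maximal cone is contained in the minimal one *)

Section MaxMin.
Variables (R : realType) (V : lmodType R[i]) (oV : opsys_data V) (A : cstarAlg R).
Hypothesis hV : is_opsys oV.
Local Notation C := R[i].
Local Notation adj X := (map_mx conjC X^T).

(** The Schur product theorem in summed form: [T] is a sum of rank one matrices, each of which gives
    a value covered by the hypothesis on [H]. *)
Lemma psd_pairing n (T : 'M[C]_n) (H : 'I_n -> 'I_n -> C) : psd (qform T) ->
  (forall c : 'I_n -> C, 0 <= \sum_a \sum_b (c a)^* * c b * H a b) ->
  0 <= \sum_a \sum_b T a b * H a b.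
Proof.
move=> /psd_factor[r [Z [W [-> _]]]] hH.
have -> : \sum_a \sum_b (adj Z *m Z) a b * H a b =
    \sum_g \sum_a \sum_b (Z g a)^* * Z g b * H a b.
  rewrite [RHS]exchange_big /=; apply: eq_bigr => a _.
  rewrite [RHS]exchange_big /=; apply: eq_bigr => b _.
  by rewrite mxE mulr_suml; apply: eq_bigr => g _; rewrite !mxE.
by apply: sumr_ge0 => g _; exact: hH.
Qed.

Lemma cstar_cp_rows q (eta : calg A -> 'M[C]_q) : cp (cstar_cones A) (mx_cones R q) eta ->
  forall y : 'I_q -> calg A, 0 <= \sum_a \sum_b eta (cst (y a) * y b) a b.
Proof.
move=> [etal etap] y.
pose X : 'M[A]_q := \matrix_(a, b) (cst (y a) * y b : calg A).
have hX : mpos (cstar_cones A) X.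
  exists (\matrix_(o, a) if (o : nat) == 0%N then y a else 0).
  apply/matrixP => K L; rewrite !mxE.
  have q0 : (0 < q)%N by exact: leq_ltn_trans (ltn_ord K).
  rewrite (bigD1 (Ordinal q0))//= !mxE /= big1 ?addr0// => o.
  rewrite -val_eqE /= => /negPf o0; rewrite !mxE o0.
  exact: (mulr0 (_ : calg A)).
have := etap _ _ hX (fun a => delta_mx a 0).
rewrite [X in 0 <= X -> _](_ : _ = \sum_a \sum_b eta (cst (y a) * y b) a b)//.
apply: eq_bigr => a _; apply: eq_bigr => b _.
by rewrite trmx_delta map_delta_mx -colE -rowE !mxE.
Qed.

(** The value of the form splits as a Schur pairing of the matrix [phi] (S), positive because [phi]
    is cp, with a matrix built from [eta] on products x^* x', positive by [cstar_cp_rows]. *)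
Lemma simple_Dmax_min r (Y : 'M[tensor V A]_r) : simple_Dmax oV (fun i j => Y i j) ->
  forall p q (phi : V -> 'M[C]_p) (eta : calg A -> 'M[C]_q),
  cp oV (mx_cones R p) phi -> cp (cstar_cones A) (mx_cones R q) eta ->
  mpos (mx_cones R (p * q)) (map_mx (tensor_lift (fun s (a : A) => phi s *t eta a)) Y).
Proof.
move=> [P [S [x [hS Yx]]]] p q phi eta cphi ceta v.
have hb := tens_mx_bilinear cphi.1 ceta.1.
pose T : 'M[C]_(P * p) := \matrix_(K, L)
  phi (S (mxtens_unindex K).1 (mxtens_unindex L).1) (mxtens_unindex K).2 (mxtens_unindex L).2.
have Tpos : psd (qform T).
  move=> c; have := cphi.2 _ _ hS (fun k => \col_a c (mxtens_index (k, a)) 0).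
  rewrite [X in 0 <= X -> _](_ : _ = qform T c c)// qformE.
  pose G (k l : 'I_P * 'I_p) := (c (mxtens_index k) 0)^* * phi (S k.1 l.1) k.2 l.2 *
    c (mxtens_index l) 0.
  transitivity (\sum_K \sum_L G (mxtens_unindex K) (mxtens_unindex L)); last first.
    by apply: eq_bigr => K _; apply: eq_bigr => L _; rewrite /G !mxtens_unindexK mxE.
  rewrite (sum_mxtens (fun k => \sum_L G k (mxtens_unindex L))); apply: eq_bigr => k _.
  under [RHS]eq_bigr do rewrite sum_mxtens.
  rewrite [RHS]exchange_big /=; apply: eq_bigr => l _.
  rewrite -/(qform _ _ _) qformE; apply: eq_bigr => a _; apply: eq_bigr => b _.
  by rewrite !mxE.
pose xx k i : calg A := x k i.
pose Gm k l i j (a b : 'I_p) (g d : 'I_q) := (v i (mxtens_index (a, g)) 0)^* *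
  v j (mxtens_index (b, d)) 0 * eta (cst (xx k i) * xx l j) g d.
pose H K L := \sum_i \sum_j \sum_g \sum_d Gm (mxtens_unindex K).1 (mxtens_unindex L).1 i j
   (mxtens_unindex K).2 (mxtens_unindex L).2 g d.
suff -> : \sum_i \sum_j (adj (v i) *m map_mx (tensor_lift (fun s (a : A) => phi s *t eta a)) Y i j
    *m v j) 0 0 = \sum_K \sum_L T K L * H K L.
  apply: psd_pairing => // c.
  pose y g : calg A := \sum_K \sum_i (c K * v i (mxtens_index ((mxtens_unindex K).2, g)) 0) *:
     xx (mxtens_unindex K).1 i.
  have := cstar_cp_rows ceta y.
  have etal := ceta.1.
  have etaD u w : eta (u + w) = eta u + eta w by have := etal 1 u w; rewrite !scale1r.
  have eta0 : eta 0 = 0 by apply: (addrI (eta 0)); rewrite -etaD !addr0.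
  have etaZ a u : eta (a *: u) = a *: eta u by have := etal a u 0; rewrite eta0 !addr0.
  have eta_sum I s (Q : pred I) (F : I -> calg A) a b :
      eta (\sum_(i <- s | Q i) F i) a b = \sum_(i <- s | Q i) eta (F i) a b.
    by rewrite (big_morph eta etaD eta0) summxE.
  rewrite [X in 0 <= X -> _](_ : _ = \sum_K \sum_L (c K)^* * c L * H K L)//.
  transitivity (\sum_K \sum_L \sum_g \sum_d \sum_i \sum_j (c K)^* * c L *
    Gm (mxtens_unindex K).1 (mxtens_unindex L).1 i j (mxtens_unindex K).2 (mxtens_unindex L).2 g d).
    rewrite exchange_big4; apply: eq_bigr => g _; apply: eq_bigr => d _.
    rewrite /y cst_sum mulr_suml eta_sum; apply: eq_bigr => K _.
    rewrite cst_sum mulr_suml eta_sum [RHS]exchange_big /=; apply: eq_bigr => i _.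
    rewrite mulr_sumr eta_sum; apply: eq_bigr => L _.
    rewrite mulr_sumr eta_sum; apply: eq_bigr => j _.
    by rewrite cstZ -calg_scaleAl -calg_scaleAr scalerA etaZ mxE /Gm rmorphM /=; ring.
  apply: eq_bigr => K _; apply: eq_bigr => L _.
  rewrite exchange_big4 /H mulr_sumr; apply: eq_bigr => i _.
  rewrite mulr_sumr; apply: eq_bigr => j _.
  rewrite mulr_sumr; apply: eq_bigr => g _.
  by rewrite mulr_sumr.
pose G2 i j (a b : 'I_p * 'I_q) := \sum_k \sum_l phi (S k l) a.1 b.1 * Gm k l i j a.1 b.1 a.2 b.2.
transitivity (\sum_i \sum_j \sum_a \sum_g \sum_b \sum_d G2 i j (a, g) (b, d)).
  apply: eq_bigr => i _; apply: eq_bigr => j _.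
  rewrite -/(qform _ _ _) qformE.
  transitivity (\sum_a \sum_b G2 i j (mxtens_unindex a) (mxtens_unindex b)); last first.
    rewrite (sum_mxtens (fun a => \sum_b G2 i j a (mxtens_unindex b))).
    by apply: eq_bigr => a _; apply: eq_bigr => g _; rewrite sum_mxtens.
  apply: eq_bigr => a _; apply: eq_bigr => b _.
  rewrite [map_mx _ _ i j]mxE Yx (lift_sum hb) summxE mulr_sumr mulr_suml.
  apply: eq_bigr => k _; rewrite (lift_sum hb) summxE mulr_sumr mulr_suml.
  apply: eq_bigr => l _; rewrite (lift_tens hb) mxE /Gm /xx.
  have ue (c : 'I_(p * q)) : mxtens_index ((mxtens_unindex c).1, (mxtens_unindex c).2) = c.
    by rewrite -surjective_pairing mxtens_unindexK.
  by rewrite !ue -[cstar_mul _ _]/(cst (x k i : calg A) * (x l j : calg A)); ring.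
pose G3 (k l : 'I_P * 'I_p) := phi (S k.1 l.1) k.2 l.2 * \sum_i \sum_j \sum_g \sum_d
   Gm k.1 l.1 i j k.2 l.2 g d.
transitivity (\sum_K \sum_L G3 (mxtens_unindex K) (mxtens_unindex L)); last first.
  by apply: eq_bigr => K _; apply: eq_bigr => L _; rewrite /G3 /H mxE.
rewrite (sum_mxtens (fun k => \sum_L G3 k (mxtens_unindex L))).
under [RHS]eq_bigr do under eq_bigr do rewrite sum_mxtens.
transitivity (\sum_a \sum_b \sum_k \sum_l G3 (k, a) (l, b)); last first.
  rewrite exchange_big4; apply: eq_bigr => k _.
  rewrite exchange_big /=; apply: eq_bigr => a _.
  by rewrite exchange_big.
transitivity (\sum_a \sum_b \sum_i \sum_j \sum_g \sum_d G2 i j (a, g) (b, d)).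
  rewrite [RHS]exchange_big4; apply: eq_bigr => i _; apply: eq_bigr => j _.
  by apply: eq_bigr => a _; rewrite exchange_big.
apply: eq_bigr => a _; apply: eq_bigr => b _.
rewrite /G2 /G3 /=.
transitivity (\sum_i \sum_j \sum_k \sum_l \sum_g \sum_d phi (S k l) a b * Gm k l i j a b g d).
  by apply: eq_bigr => i _; apply: eq_bigr => j _; rewrite exchange_big4.
rewrite exchange_big4; apply: eq_bigr => k _; apply: eq_bigr => l _.
rewrite mulr_sumr; apply: eq_bigr => i _.
rewrite mulr_sumr; apply: eq_bigr => j _.
rewrite mulr_sumr; apply: eq_bigr => g _.
by rewrite mulr_sumr.
Qed.

Lemma max_min r (Y : 'M[tensor V A]_r) :
  mpos (max_tensor oV (cstar_cones A)) Y -> mpos (min_tensor oV (cstar_cones A)) Y.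
Proof.
move=> hY /= p q phi eta uphi ueta v.
have hb := tens_mx_bilinear uphi.1.1 ueta.1.1.
pose lft := tensor_lift (fun s (a : A) => phi s *t eta a).
have lft1 : lft (munit oV ⊗ munit (cstar_cones A)) = 1%:M.
  rewrite /lft (lift_tens hb) uphi.2 ueta.2; apply/matrixP => i j; rewrite !mxE.
  rewrite -natrM mulnb -xpair_eqE -!surjective_pairing.
  by rewrite (inj_eq (can_inj (@mxtens_unindexK _ _))).
pose N : C := \sum_i (adj (v i) *m v i) 0 0.
apply: (@ge0_limit _ _ `|N|) => n.
have := hY (rate R n) (rate_gt0 R n) => /(Dmax_simple hV)/simple_Dmax_min.
move=> /(_ _ _ _ _ uphi.1 ueta.1 v) h.
eexists; first exact: h.
have YE a b : map_mx lft (Y + scale_vmx (rate R n) (amp_mx r (munit oV ⊗ munit (cstar_cones A)))) a b =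
    map_mx lft Y a b + (rate R n * (a == b)%:R) *: 1%:M.
  rewrite !mxE /lft (liftD hb) (liftZ hb); congr (_ + _).
  case: (a == b); first by rewrite mulr1n -/(lft _) lft1 mulr1.
  by rewrite mulr0n (lift0 hb) scaler0 mulr0 scale0r.
rewrite -sumrB [X in `|X|](_ : _ = - (rate R n * N)); last first.
  rewrite /N mulr_sumr -sumrN; apply: eq_bigr => i _.
  rewrite -sumrB (bigD1 i)//= big1 ?addr0 => [|j ji].
    rewrite -/lft YE eqxx mulr1 mulmxDr mulmxDl -scalemxAr -scalemxAl mulmx1.
    by rewrite [X in _ - X]mxE [X in _ - (_ + X)]mxE opprD addrA subrr add0r.
  by rewrite -/lft YE [i == j]eq_sym (negPf ji) mulr0 scale0r addr0 subrr.
by rewrite normrN normrM (ger0_norm (rate_ge0 R n)) mulrC.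
Qed.

End MaxMin.

(** * Operator systems in duality *)

(** All conditions come in mirrored pairs, so exchanging [V] and [W] gives a dual pair again. The
    dual bases enter through the two expansions, the only form in which they are used. *)
Record dual_pair (R : realType) (V W : lmodType R[i]) (oV : opsys_data V)
    (oW : opsys_data W) := DualPair {
  dp_form :> V -> W -> R[i];
  dp_size : nat;
  dp_v : 'I_dp_size -> V;
  dp_w : 'I_dp_size -> W;
  dp_linl : forall a x y w, dp_form (a *: x + y) w = a * dp_form x w + dp_form y w;
  dp_linr : forall a x y v, dp_form v (a *: x + y) = a * dp_form v x + dp_form v y;
  dp_basisl : forall x, x = \sum_k dp_form x (dp_w k) *: dp_v k;
  dp_basisr : forall y, y = \sum_k dp_form (dp_v k) y *: dp_w k;
  dp_posl : forall r (G : 'M[V]_r), mpos oV G <->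
    cp oW (mx_cones R r) (fun y => \matrix_(i, j) dp_form (G i j) y);
  dp_posr : forall r (F : 'M[W]_r), mpos oW F <->
    cp oV (mx_cones R r) (fun x => \matrix_(i, j) dp_form x (F i j)) }.

Arguments dp_v {R V W oV oW} d _.
Arguments dp_w {R V W oV oW} d _.
Arguments dp_linl {R V W oV oW} d.
Arguments dp_linr {R V W oV oW} d.
Arguments dp_basisl {R V W oV oW} d.
Arguments dp_basisr {R V W oV oW} d.
Arguments dp_posl {R V W oV oW} d {r} G.
Arguments dp_posr {R V W oV oW} d {r} F.

Definition dual_pair_sym (R : realType) (V W : lmodType R[i]) (oV : opsys_data V)
    (oW : opsys_data W) (D : dual_pair oV oW) : dual_pair oW oV :=
  @DualPair R W V oW oV (fun y x => D x y) (dp_size D) (dp_w D) (dp_v D)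
    (fun a x y v => dp_linr D a x y v) (fun a x y w => dp_linl D a x y w)
    (dp_basisr D) (dp_basisl D) (@dp_posr _ _ _ _ _ D) (@dp_posl _ _ _ _ _ D).

(* Positivity of the maximally entangled element in the commuting tensor product. *)
Definition com_positive (R : realType) (V W : lmodType R[i]) (oV : opsys_data V)
    (oW : opsys_data W) (D : dual_pair oV oW) : Prop :=
  forall (H : hilbert R) (phi : V -> bounded_op H) (psi : W -> bounded_op H),
    ucp oV (bop_cones H) phi -> ucp oW (bop_cones H) psi ->
    (forall s t, bop_comp (phi s) (psi t) = bop_comp (psi t) (phi s)) ->
    forall xi : H, 0 <= \sum_k hilb_dot H (phi (dp_v D k) (psi (dp_w D k) xi)) xi.

Lemma com_positive_sym (R : realType) (V W : lmodType R[i]) (oV : opsys_data V)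
    (oW : opsys_data W) (D : dual_pair oV oW) :
  com_positive D -> com_positive (dual_pair_sym D).
Proof.
move=> h H phi psi uphi upsi c xi.
have := h H psi phi upsi uphi (fun s t => esym (c t s)) xi.
rewrite [X in 0 <= X -> _](_ : _ = \sum_k hilb_dot H (phi (dp_w D k) (psi (dp_v D k) xi)) xi)//.
by apply: eq_bigr => k _; rewrite -!bop_compE c.
Qed.

Section Slices.
Variables (R : realType) (V W : lmodType R[i]) (oV : opsys_data V) (oW : opsys_data W).
Hypotheses (hV : is_opsys oV) (hW : is_opsys oW).
Variables (D : dual_pair oV oW) (A : cstarAlg R).
Local Notation C := R[i].

Lemma dp_ge0 x y : pos1 oV x -> pos1 oW y -> 0 <= D x y.
Proof.
move=> px py; have [_ h] := (dp_posr D _).1 py; have := h _ _ px (fun=> delta_mx 0 0).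
by rewrite !big_ord1 trmx_delta map_delta_mx -colE -rowE !mxE.
Qed.

Lemma dp_star x y : D (ops_star oV x) y = (D x (ops_star oW y))^*.
Proof.
move: y x; apply: (opsys_span_ind hW) => [y py|a y z hy hz] x.
  rewrite (pos1_herm hW py); move: x; apply: (opsys_span_ind hV) => [x px|b x z hx hz].
    by rewrite (pos1_herm hV px) conj_Creal// ger0_real// dp_ge0.
  by rewrite (ops_star_conjlinear hV) !dp_linl hx hz rmorphD rmorphM.
by rewrite (ops_star_conjlinear hW) !dp_linr hy hz rmorphD rmorphM /= conjCK.
Qed.

Let slice_bilinear (y : W) : bilinear_for *:%R *:%R (fun s (a : A) => D s y *: a : A).
Proof.
split=> [a c s t|s c a b] /=; first by rewrite dp_linl scalerDl scalerA.
by rewrite scalerDr !scalerA mulrC.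
Qed.

Definition slice (y : W) (x : tensor V A) : A :=
  tensor_lift (fun s (a : A) => D s y *: a : A) x.

Lemma slice_tens y s a : slice y (s ⊗ a) = D s y *: a.
Proof. exact: (lift_tens (slice_bilinear y)). Qed.
Lemma sliceD y x x' : slice y (x + x') = slice y x + slice y x'.
Proof. exact: (liftD (slice_bilinear y)). Qed.
Lemma slice0 y : slice y 0 = 0. Proof. exact: (lift0 (slice_bilinear y)). Qed.
Lemma sliceN y x : slice y (- x) = - slice y x.
Proof. exact: (liftN (slice_bilinear y)). Qed.

Lemma slice_linl a y z x : slice (a *: y + z) x = a *: slice y x + slice z x.
Proof.
elim/tensor_ind: x => [|x x' hx hx'|s b].
- by rewrite !slice0 scaler0 addr0.
- by rewrite !sliceD hx hx' scalerDr addrACA.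
- by rewrite !slice_tens dp_linr scalerDl scalerA.
Qed.

Lemma slice_span x : x = \sum_k dp_v D k ⊗ slice (dp_w D k) x.
Proof.
elim/tensor_ind: x => [|x x' hx hx'|s b].
- by rewrite big1// => k _; rewrite slice0 tens0r.
- under eq_bigr do rewrite sliceD tensDr.
  by rewrite big_split /= -hx -hx'.
- under eq_bigr do rewrite slice_tens tensZr -tensZl.
  by rewrite -tens_suml -(dp_basisl D).
Qed.

Lemma slice_tstar y x : slice y (tstar oV x) = cstar_star (slice (ops_star oW y) x).
Proof.
elim/tensor_ind: x => [|x x' hx hx'|s b].
- rewrite (tstar0 A hV) !slice0; exact/esym/(@cst0 _ A).
- rewrite (tstarD hV) !sliceD hx hx'; exact/esym/(@cstD _ A).
- by rewrite (tstar_tens hV) !slice_tens dp_star; exact/esym/(@cstZ _ A).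
Qed.

Lemma slice_eq0 x : (forall y g, pos1 oW y -> positive_functional g ->
  (forall a, g (cst a) = (g a)^*) -> g (slice y x : calg A) = 0) -> x = 0.
Proof.
move=> h; have s0 y : slice y x = 0.
  move: y; apply: (opsys_span_ind hW) => [y py|a y z hy hz].
    by apply: (@positive_functional_separate _ A) => g gp gs; exact: h.
  by rewrite slice_linl hy hz scaler0 addr0.
by rewrite [x]slice_span big1// => k _; rewrite s0 tens0r.
Qed.

(** The minimal cone only speaks of positivity under product maps. A positive y in W and a positive
    functional g turn [X] into a positive, hence hermitian, scalar matrix, and by [slice_eq0] such
    pairs separate the points of the tensor product. *)
Lemma min_herm r (X : 'M[tensor V A]_r) : mpos (min_tensor oV (cstar_cones A)) X ->
  forall i j, tstar oV (X j i) = X i j.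
Proof.
move=> hX i j; apply/eqP; rewrite -subr_eq0; apply/eqP; apply: slice_eq0 => y g py gp gs.
have gl := gp.1.
have g0 : g 0 = 0 by have := gl (-1) 0 0; rewrite scaleN1r oppr0 addr0 mulN1r addNr.
have gD a b : g (a + b) = g a + g b by have := gl 1 a b; rewrite scale1r mul1r.
have gN a : g (- a) = - g a by have := gl (-1) a 0; rewrite scaleN1r !addr0 g0 addr0 mulN1r.
have gZ c a : g (c *: a) = c * g a by have := gl c a 0; rewrite !addr0 g0 addr0.
rewrite sliceD sliceN slice_tstar (pos1_herm hW py).
rewrite [LHS](gD (cst (slice y (X j i) : calg A)) (- slice y (X i j))) gs gN.
pose phi s : 'M[C]_1 := \matrix_(a, b) D s ((const_mx y : 'M_1) a b).
have cphi : cp oV (mx_cones R 1) phi by exact: (dp_posr D _).1 py.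
have ceta := positive_functional_cp gp.
have hb := tens_mx_bilinear cphi.1 ceta.1.
have lE x : tensor_lift (fun s (a : A) => phi s *t (g a)%:M : 'M_(1 * 1)) x = (g (slice y x))%:M.
  elim/tensor_ind: x => [|x x' hx hx'|s b].
  - rewrite (lift0 hb) slice0 g0; apply/matrixP => a b; rewrite !mxE mul0rn; exact: erefl.
  - rewrite (liftD hb) hx hx' sliceD (gD (slice y x) (slice y x')) raddfD; exact: erefl.
  - rewrite (lift_tens hb) slice_tens (gZ (D s y) b); apply/matrixP => a c; rewrite !mxE !ord1.
    by rewrite !mulr1n.
have := min_pos_cp (opsys_unit_spanned hV) (@cstar_unit_spanned _ A) hX cphi ceta.
pose T : 'M[C]_r := \matrix_(a, b) g (slice y (X a b)).
move=> hT; have Tp : psd (qform T).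
  move=> c; have := hT (fun a => (c a 0)%:M).
  rewrite [X in 0 <= X -> _](_ : _ = qform T c c)// qformE.
  apply: eq_bigr => a _; apply: eq_bigr => b _.
  rewrite [map_mx _ X a b]mxE lE tr_scalar_mx map_scalar_mx /= -!scalar_mxM.
  by rewrite !mxE mulr1n.
have := psd_herm (qform_sesqui T) Tp (delta_mx j 0) (delta_mx i 0).
have e a b : qform T (delta_mx a 0) (delta_mx b 0) = T b a.
  by rewrite /qform trmx_delta map_delta_mx -colE -rowE !mxE.
by rewrite !e !mxE => ->; rewrite conjCK subrr.
Qed.

End Slices.

(** * From the maximally entangled element to nuclearity *)

Section ComPositiveNuclear.
Variables (R : realType) (V W : lmodType R[i]) (oV : opsys_data V) (oW : opsys_data W).
Hypotheses (hV : is_opsys oV) (hW : is_opsys oW).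
Variable D : dual_pair oV oW.
Local Notation C := R[i].

Section Functional.
Variables (A : cstarAlg R) (r : nat) (X : 'M[tensor V A]_r).
Hypothesis X_min : mpos (min_tensor oV (cstar_cones A)) X.
Local Notation E := ('I_r -> 'I_r -> tensor V A).
Local Notation V0 := ('I_r -> 'I_r -> calg A).
Variable f : E -> C.
Hypothesis f_linear : forall a x y, f (a *: x + y) = a * f x + f y.
Hypothesis f_pos : forall x, simple_Dmax oV x -> 0 <= f x.

Let fD x y : f (x + y) = f x + f y.
Proof. by have := f_linear 1 x y; rewrite scale1r mul1r. Qed.
Let f0 : f 0 = 0.
Proof. by apply: (addrI (f 0)); rewrite -fD !addr0. Qed.
Let f_sum I s (P : pred I) (F : I -> E) :
  f (\sum_(i <- s | P i) F i) = \sum_(i <- s | P i) f (F i).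
Proof. exact: (big_morph f fD f0). Qed.

Let Psi (s : V) (M : V0) : C := f (fun i j => s ⊗ (M i j : A)).

Let Psil a s t M : Psi (a *: s + t) M = a * Psi s M + Psi t M.
Proof.
rewrite /Psi -f_linear; congr (f _); apply/funext => i; apply/funext => j.
by rewrite !fctE tensDl tensZl.
Qed.
Let Psir a s M N : Psi s (a *: M + N) = a * Psi s M + Psi s N.
Proof.
rewrite /Psi -f_linear; congr (f _); apply/funext => i; apply/funext => j.
rewrite !fctE; exact: (etrans (tensDr _ _ _) (congr1 (fun z => z + _) (tensZr _ _ _))).
Qed.
Let PsiD s M N : Psi s (M + N) = Psi s M + Psi s N.
Proof. by have := Psir 1 s M N; rewrite scale1r mul1r. Qed.
Let Psi0 s : Psi s 0 = 0.
Proof. by apply: (addrI (Psi s 0)); rewrite -PsiD !addr0. Qed.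
Let Psi_sum s I q (P : pred I) (F : I -> V0) :
  Psi s (\sum_(i <- q | P i) F i) = \sum_(i <- q | P i) Psi s (F i).
Proof. exact: (big_morph (Psi s) (PsiD s) (Psi0 s)). Qed.

Let Psi_pos p (G : 'M[V]_p) (x : 'I_p -> 'I_r -> calg A) : mpos oV G ->
  0 <= \sum_m \sum_n Psi (G m n) (fun i j => cst (x m i) * x n j).
Proof.
move=> hG; rewrite /Psi.
under eq_bigr do rewrite -f_sum.
rewrite -f_sum; apply: f_pos.
by exists p, G, x; split=> // i j; rewrite !fct_sumE; apply: eq_bigr => m _; rewrite !fct_sumE.
Qed.

Let adjmul (y x : V0) : V0 := fun i j => \sum_c cst (y c i) * x c j.
Let Phi s x y := Psi s (adjmul y x).
Let u t : V0 := fun i j => slice D t (X i j).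
Let L t (x : V0) : V0 := fun c j => \sum_d u t c d * x d j.

Let Phil a s t x y : Phi (a *: s + t) x y = a * Phi s x y + Phi t x y.
Proof. exact: Psil. Qed.

Let Phis s : sesquiform (Phi s).
Proof.
split=> a x y z; rewrite /Phi -?Psir.
  congr (Psi s _); apply/funext => i; apply/funext => j.
  rewrite !fctE /adjmul scaler_sumr -big_split; apply: eq_bigr => c _ /=.
  by rewrite mulrDr calg_scaleAr.
congr (Psi s _); apply/funext => i; apply/funext => j.
rewrite !fctE /adjmul scaler_sumr -big_split; apply: eq_bigr => c _ /=.
by rewrite !fctE cstP mulrDl calg_scaleAl.
Qed.

Let PhiE s x y : Phi s x y = \sum_c Psi s (fun i j => cst (y c i) * x c j).
Proof.
rewrite /Phi -Psi_sum; congr (Psi s _); apply/funext => i; apply/funext => j.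
by rewrite !fct_sumE.
Qed.

Let Phi_pos s : pos1 oV s -> psd (Phi s).
Proof.
move=> ps x; rewrite PhiE; apply: sumr_ge0 => c _.
by have := Psi_pos (fun _ => x c) ps; rewrite !big_ord1 mxE.
Qed.

Let Ll a t t' x : L (a *: t + t') x = a *: L t x + L t' x.
Proof.
apply/funext => c; apply/funext => j; rewrite !fctE /L scaler_sumr -big_split.
apply: eq_bigr => d _ /=; rewrite /u slice_linl.
rewrite calg_scaleAl -mulrDl; exact: erefl.
Qed.

Let L_linear t : linear (L t).
Proof.
move=> a x y; apply/funext => c; apply/funext => j; rewrite !fctE /L scaler_sumr -big_split.
by apply: eq_bigr => d _ /=; rewrite calg_scaleAr -mulrDr.
Qed.

Let u_star t i j : cst (u (ops_star oW t) j i) = u t i j.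
Proof.
rewrite /u -(min_herm hV hW D X_min i j) (slice_tstar hV hW).
exact: erefl.
Qed.

Let L_adj s t x y : Phi s (L t x) y = Phi s x (L (ops_star oW t) y).
Proof.
rewrite /Phi; congr (Psi s _); apply/funext => i; apply/funext => j.
rewrite /adjmul /L; under eq_bigr do rewrite mulr_sumr.
under [RHS]eq_bigr do rewrite cst_sum mulr_suml.
rewrite exchange_big; apply: eq_bigr => d _; apply: eq_bigr => c _ /=.
by rewrite cstM u_star mulrA.
Qed.

(** By duality [F] is a cp map [chi] from V to p by p matrices, while [G], [x] and positivity of [f]
    define a cp map [eta] on A. Min positivity of [X] at [chi] and [eta] is the required inequality,
    and [F] or [G] of size 1 at the unit gives the two positivity hypotheses of the
    representation. *)
Let mixed_pos p q (F : 'M[W]_p) (G : 'M[V]_q) (x : 'I_p -> 'I_q -> V0) :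
  mpos oW F -> mpos oV G ->
  0 <= \sum_k \sum_l \sum_m \sum_n Phi (G m n) (L (F k l) (x l n)) (x k m).
Proof.
move=> hF hG.
pose al (K : 'I_(p * r)) m i : calg A := x (mxtens_unindex K).1 m (mxtens_unindex K).2 i.
pose eta (a : calg A) : 'M[C]_(p * r) := \matrix_(K, K')
  \sum_m \sum_n Psi (G m n) (fun i j => cst (al K m i) * a * al K' n j).
have etal : linear eta.
  move=> c a b; apply/matrixP => K K'; rewrite !mxE mulr_sumr -big_split.
  apply: eq_bigr => m _ /=; rewrite mulr_sumr -big_split; apply: eq_bigr => n _ /=.
  rewrite -Psir; congr (Psi _ _); apply/funext => i; apply/funext => j.
  by rewrite !fctE mulrDr mulrDl -calg_scaleAr -calg_scaleAl.
have ceta : cp (cstar_cones A) (mx_cones R (p * r)) eta.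
  apply: cstar_cp => // y.
  have := Psi_pos (fun m i => \sum_K y K * al K m i) hG.
  rewrite [X in 0 <= X -> _](_ : _ = \sum_K \sum_K' eta (cst (y K) * y K') K K')//.
  under [RHS]eq_bigr do under eq_bigr do rewrite mxE.
  rewrite [RHS]exchange_big4; apply: eq_bigr => m _; apply: eq_bigr => n _.
  under [RHS]eq_bigr do rewrite -Psi_sum.
  rewrite -Psi_sum; congr (Psi _ _); apply/funext => i; apply/funext => j.
  rewrite !fct_sumE cst_sum mulr_suml; apply: eq_bigr => K _.
  rewrite !fct_sumE mulr_sumr; apply: eq_bigr => K' _.
  by rewrite cstM !mulrA.
pose chi v : 'M[C]_p := \matrix_(k, l) D v (F k l).
have cchi : cp oV (mx_cones R p) chi by exact: (dp_posr D F).1 hF.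
have hb := tens_mx_bilinear cchi.1 ceta.1.
have := min_pos_cp (opsys_unit_spanned hV) (@cstar_unit_spanned _ A) X_min cchi ceta.
(* The index k occurs both in [chi] and in [eta]; this vector, the sum over k of the basis vectors
   (k, (k, c)), identifies the two occurrences. *)
pose e c : 'cV[C]_(p * (p * r)) :=
  \col_K ((mxtens_unindex K).2 == mxtens_index ((mxtens_unindex K).1, c))%:R.
move/(_ e).
have qe M c d : (map_mx conjC (e c)^T *m M *m e d) 0 0 = \sum_k \sum_l
    M (mxtens_index (k, mxtens_index (k, c))) (mxtens_index (l, mxtens_index (l, d))).
  rewrite -/(qform _ _ _) qformE.
  pose H (a b : 'I_p * 'I_(p * r)) := ((a.2 == mxtens_index (a.1, c))%:R : C)^* *
     M (mxtens_index a) (mxtens_index b) * (b.2 == mxtens_index (b.1, d))%:R.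
  transitivity (\sum_a \sum_b H (mxtens_unindex a) (mxtens_unindex b)).
    by apply: eq_bigr => a _; apply: eq_bigr => b _; rewrite /H !mxE !mxtens_unindexK.
  rewrite (sum_mxtens (fun a => \sum_b H a (mxtens_unindex b))); apply: eq_bigr => k _.
  rewrite (bigD1 (mxtens_index (k, c)))//= [X in _ + X]big1 ?addr0; last first.
    by move=> K Kk; rewrite big1// => b _; rewrite /H /= (negPf Kk) conjC0 !mul0r.
  rewrite sum_mxtens; apply: eq_bigr => l _.
  rewrite (bigD1 (mxtens_index (l, d)))//= [X in _ + X]big1 ?addr0; last first.
    by move=> K Kk; rewrite /H /= (negPf Kk) mulr0.
  by rewrite /H /= !eqxx conjC1 mul1r mulr1.
have liftE z k l c d : tensor_lift (fun s (a : A) => chi s *t eta a) z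
    (mxtens_index (k, mxtens_index (k, c))) (mxtens_index (l, mxtens_index (l, d))) =
  \sum_m \sum_n Psi (G m n) (fun i j => cst (x k m c i) * (slice D (F k l) z : calg A) * x l n d j).
  elim/tensor_ind: z => [|z z' hz hz'|s a].
  - rewrite (lift0 hb) slice0 mxE big1// => m _; rewrite big1// => n _.
    rewrite -[RHS](Psi0 (G m n)); congr (Psi _ _); apply/funext => i; apply/funext => j.
    exact: (etrans (congr1 (fun z => z * x l n d j) (mulr0 (cst (x k m c i)))) (mul0r _)).
  - rewrite (liftD hb) mxE hz hz' -big_split; apply: eq_bigr => m _ /=.
    rewrite -big_split; apply: eq_bigr => n _ /=; rewrite -PsiD.
    congr (Psi _ _); apply/funext => i; apply/funext => j; rewrite !fctE sliceD.
    by rewrite -mulrDl -mulrDr.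
  - rewrite (lift_tens hb) slice_tens !mxE !mxtens_indexK /= mulr_sumr.
    apply: eq_bigr => m _; rewrite mulr_sumr; apply: eq_bigr => n _.
    have PsiZ c' s' M : Psi s' (c' *: M) = c' * Psi s' M.
      by have := Psir c' s' M 0; rewrite Psi0 !addr0.
    rewrite -PsiZ; congr (Psi _ _); apply/funext => i; apply/funext => j.
    by rewrite !fctE /al !mxtens_indexK /= calg_scaleAl calg_scaleAr.
rewrite [X in 0 <= X -> _](_ : _ =
  \sum_k \sum_l \sum_m \sum_n Phi (G m n) (L (F k l) (x l n)) (x k m))//.
transitivity (\sum_c \sum_d \sum_k \sum_l \sum_m \sum_n
   Psi (G m n) (fun i j => cst (x k m c i) * u (F k l) c d * x l n d j)).
  apply: eq_bigr => c _; apply: eq_bigr => d _; rewrite qe.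
  by apply: eq_bigr => k _; apply: eq_bigr => l _; rewrite [map_mx _ _ _ _]mxE liftE.
rewrite exchange_big4; apply: eq_bigr => k _; apply: eq_bigr => l _.
rewrite exchange_big4; apply: eq_bigr => m _; apply: eq_bigr => n _.
rewrite PhiE; apply: eq_bigr => c _; rewrite -Psi_sum.
congr (Psi _ _); apply/funext => i; apply/funext => j; rewrite !fct_sumE /L mulr_sumr.
by apply: eq_bigr => d _; rewrite mulrA.
Qed.

Let Phi_cp q (G : 'M[V]_q) : mpos oV G -> forall x : 'I_q -> V0,
  0 <= \sum_i \sum_j Phi (G i j) (L (munit oW) (x j)) (x i).
Proof.
move=> hG x; have := mixed_pos (fun _ => x) (pos1_unit hW) hG.
rewrite !big_ord1 => h.
by apply: le_trans h _; rewrite le_eqVlt; apply/orP; left; apply/eqP;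
  apply: eq_bigr => m _; apply: eq_bigr => n _; rewrite mxE.
Qed.

Let L_cp p (F : 'M[W]_p) : mpos oW F -> forall x : 'I_p -> V0,
  0 <= \sum_i \sum_j Phi (munit oV) (L (F i j) (x j)) (x i).
Proof.
move=> hF x; have := mixed_pos (fun k _ => x k) hF (pos1_unit hV) => h.
apply: le_trans h _; rewrite le_eqVlt; apply/orP; left; apply/eqP.
by apply: eq_bigr => k _; apply: eq_bigr => l _; rewrite !big_ord1 mxE.
Qed.

(** Left multiplication by a is bounded by |a| for the form [be] because |a|^2 - a^* a = b^* b.
    Summing over the entries of the slice at the unit gives a crude but sufficient [M]. *)
Let L_bound : exists2 M : C, 0 <= M & forall x,
  Phi (munit oV) (L (munit oW) x) x <= M * Phi (munit oV) x x.
Proof.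
pose e := munit oV; pose be (p q : 'I_r -> calg A) := Psi e (fun i j => cst (q i) * p j).
have bes : sesquiform be.
  split=> a x y z; rewrite /be -Psir; congr (Psi e _); apply/funext => i; apply/funext => j.
    by rewrite !fctE mulrDr calg_scaleAr.
  by rewrite !fctE cstP mulrDl calg_scaleAl.
have bep : psd be.
  by move=> p; have := Psi_pos (fun _ => p) (pos1_unit hV); rewrite !big_ord1 mxE.
have be_mul (a : calg A) p : snorm be (fun j => a * p j) <= `|a| * snorm be p.
  rewrite -ler_sqr ?nnegrE ?mulr_ge0 ?snorm_ge0// exprMn !snormK.
  have [b hb] : exists b, `|a| ^+ 2 *: (1 : calg A) - cst a * a = cst b * b.
    by rewrite -calg_normE; apply/cposP/cpos_norm; rewrite cstM cstK.
  have := bep (fun j => b * p j); rewrite /be -subr_ge0.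
  rewrite [X in 0 <= X -> _](_ : _ = `|a| ^+ 2 * Psi e (fun i j => cst (p i) * p j)
    - Psi e (fun i j => cst (a * p i) * (a * p j)))//.
  have -> : (fun i j => cst (b * p i) * (b * p j)) = (-1 : C) *: (fun i j => cst (a * p i) * (a * p j))
      + ((`|a| ^+ 2) *: (fun i j => cst (p i) * p j) + 0 : V0).
    apply/funext => i; apply/funext => j; rewrite !fctE addr0 !cstM !mulrA.
    rewrite -(mulrA (cst (p i)) (cst b)) -hb mulrBr mulrBl -calg_scaleAr mulr1 calg_scaleAl.
    by rewrite -!calg_scaleAl scaleN1r addrC !mulrA.
  by rewrite Psir Psir Psi0 addr0 mulN1r addrC.
pose M := \sum_c \sum_d `|u (munit oW) c d|.
have M0 : 0 <= M by apply: sumr_ge0 => c _; apply: sumr_ge0.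
exists M => // x; set B := Phi (munit oV).
have BE y : B y y = \sum_c be (y c) (y c) by rewrite /B PhiE.
have Bpos : 0 <= B x x := Phi_pos (pos1_unit hV) x.
have xB c : snorm be (x c) <= sqrtC (B x x).
  rewrite -ler_sqr ?nnegrE ?sqrtC_ge0 ?snorm_ge0//.
  rewrite snormK sqrtCK BE (bigD1 c)//= lerDl; apply: sumr_ge0 => d _; exact: bep.
have LE : B (L (munit oW) x) x = \sum_c \sum_d be (fun j => u (munit oW) c d * x d j) (x c).
  rewrite /B PhiE; apply: eq_bigr => c _; rewrite /be -Psi_sum; congr (Psi _ _).
  apply/funext => i; apply/funext => j; rewrite !fct_sumE /L mulr_sumr.
  by [].
have Lr : B (L (munit oW) x) x \is Num.real.
  have := Phi_cp (pos1_unit hV) (fun=> x); rewrite !big_ord1 mxE; exact: ger0_real.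
apply: le_trans (real_ler_norm Lr) _; rewrite LE /M mulr_suml.
apply: le_trans (ler_norm_sum _ _ _) _; apply: ler_sum => c _; rewrite mulr_suml.
apply: le_trans (ler_norm_sum _ _ _) _; apply: ler_sum => d _.
apply: le_trans (psd_CS_norm bes bep _ _) _.
have -> : `|u (munit oW) c d| * B x x = (`|u (munit oW) c d| * sqrtC (B x x)) * sqrtC (B x x).
  by rewrite -mulrA -expr2 sqrtCK.
apply: ler_pM; rewrite ?snorm_ge0//.
by apply: le_trans (be_mul _ _) _; rewrite ler_wpM2l.
Qed.

Lemma com_positive_functional : com_positive D -> 0 <= f (fun i j => X i j).
Proof.
move=> hD; pose one : V0 := fun i j => (i == j)%:R.
have [H [xi [phi [psi [h1 h2 h3 h4]]]]] :=
  commuting_representation hV hW Phis Phil Phi_pos Ll L_linear L_adj L_bound Phi_cp L_cp one.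
have := hD H phi psi h1 h2 h3 xi.
under eq_bigr do rewrite h4.
rewrite [X in 0 <= X -> _](_ : _ = f (fun i j => X i j))//.
have -> : (fun i j => X i j) = \sum_k (fun i j => dp_v D k ⊗ (u (dp_w D k) i j : A)).
  apply/funext => i; apply/funext => j; rewrite !fct_sumE.
  exact: (slice_span D (X i j)).
rewrite f_sum; apply: eq_bigr => k _.
rewrite /Phi /Psi; congr (f _); apply/funext => i; apply/funext => j; congr (_ ⊗ _).
rewrite /adjmul (bigD1 i)//= [X in _ + X]big1 ?addr0; last first.
  by move=> c ci; rewrite /one (negPf ci) cst0 mul0r.
rewrite /one eqxx cst1 mul1r /L (bigD1 j)//= big1 ?addr0; last first.
  by move=> d dj; rewrite (negPf dj) mulr0.
by rewrite eqxx mulr1.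
Qed.

End Functional.

Theorem com_positive_nuclear : com_positive D -> Cstar_nuclear oV.
Proof.
move=> hD A; split; last first.
  exists idfun; split=> //; split=> [a x y //|r Y hY].
  by rewrite map_mx_id//; exact: (max_min hV).
split=> [a x y //|r X hX]; rewrite map_mx_id//.
apply: contrapT => nX.
have [f [fl fs fp [e e0 fX]]] := max_separation hV (min_herm hV hW D hX) nX.
have := com_positive_functional hX fl fp hD.
move=> /le_trans/(_ fX); rewrite oppr_ge0 => /(lt_le_trans e0).
by rewrite ltxx.
Qed.

End ComPositiveNuclear.

(** * Commutants *)

Section Commutant.
Variables (R : realType) (H : hilbert R) (I : Type).
Local Notation C := R[i].
Variables (phi : I -> bounded_op H) (inv : I -> I).
Hypothesis phi_adj : forall s x y, hilb_dot H (phi s x) y = hilb_dot H x (phi (inv s) y).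
Local Notation "<< x , y >>" := (hilb_dot H x y) (at level 0, format "<< x ,  y >>").
Let hs := hdot_sesqui H.

(** The adjoint is demanded as a bare function. Its existence already makes [T] linear, and the
    involution is available without a representation theorem. *)
Let cdom (T : H -> H) : Prop :=
  (forall s x, T (phi s x) = phi s (T x)) /\
  exists S : H -> H, forall x y, <<T x, y>> = <<x, S y>>.

Let cdom0 : cdom 0.
Proof.
split=> [s x|]; first by rewrite /= bop0.
by exists 0 => x y; rewrite /= (sesqui0l hs) (sesqui0r hs).
Qed.

Let cdomP (a : C) f g : cdom f -> cdom g -> cdom (a *: f + g).
Proof.
move=> [fc [f' fa]] [gc [g' ga]]; split=> [s x|].
  by rewrite !fctE fc gc bop_linear.
exists (a^* *: f' + g') => x y; rewrite !fctE hs.1 fa ga hs.2 conjCK.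
by [].
Qed.

Let sq_bound (z t : C) : 0 <= z -> z ^+ 2 <= t * z -> 0 <= t -> z <= t.
Proof.
move=> z0 zt t0; have [->//|zn] := eqVneq z 0.
have zp : 0 < z by rewrite lt_def zn.
by rewrite -(ler_pM2r zp) -expr2.
Qed.

Let adjoint_bound (T S : H -> H) (M : C) : 0 <= M -> (forall x, `|T x| <= M * `|x|) ->
  (forall x y, <<T x, y>> = <<x, S y>>) -> forall y, `|S y| <= M * `|y|.
Proof.
move=> M0 TM TS y; apply: sq_bound => //; last exact: mulr_ge0.
rewrite hilb_normE -TS -[leLHS]ger0_norm; last by rewrite TS -hilb_normE exprn_ge0.
apply: le_trans (hdot_norm_le _ _) _.
by rewrite mulrAC ler_wpM2r.
Qed.

Let cdom_lim (u : nat -> H -> H) f : (forall n, cdom (u n)) ->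
  (forall x n, `|u n x - f x| <= `|x| * rate R n) -> cdom f.
Proof.
move=> ud uf; split=> [s x|].
  have [M M0 hM] := bop_bound (phi s).
  apply/eqP; rewrite -subr_eq0 -normr_le0.
  apply: (@ler_rate _ _ _ (`|phi s x| + M * `|x|)) => n; rewrite add0r.
  have -> : f (phi s x) - phi s (f x) = - (u n (phi s x) - f (phi s x)) + phi s (u n x - f x).
    by rewrite bopB (ud n).1 opprB addrA subrK.
  rewrite (le_trans (ler_normD _ _))// normrN mulrDl lerD ?uf//.
  by rewrite (le_trans (hM _))// -mulrA ler_wpM2l.
have [v hv] := choice (fun n => (ud n).2).
have ulin n a x y : u n (a *: x + y) = a *: u n x + u n y.
  by apply: hdot_ext => z; rewrite hs.1 !hv hs.1.
(* The bound on adjoints, applied to [u m - u n], transfers the Cauchy modulus to [v], whose limit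
   is the adjoint of [f]. *)
have vb m n y : `|v m y - v n y| <= `|y| * (rate R m + rate R n).
  rewrite [leRHS]mulrC.
  apply: (@adjoint_bound (fun x => u m x - u n x) (fun y => v m y - v n y)) => [|x|x z].
  - by rewrite addr_ge0 ?rate_ge0.
  - have -> : u m x - u n x = (u m x - f x) - (u n x - f x) by rewrite opprB addrA subrK.
    by rewrite mulrC mulrDr (le_trans (ler_normB _ _))// lerD ?uf.
  - by rewrite (sesquiBl hs) (sesquiBr hs) !hv.
have vl y : exists l, forall n, `|v n y - l| <= `|y| * rate R n.
  by apply: (seq_complete_scaled (@cauchy_seq_complete R H)) => // m n.
have [g hg] := choice vl; exists g => x y.
apply: (@eq_limit _ _ _ (`|x| * `|y| + `|x| * `|y|)) => n.
have -> : <<f x, y>> - <<x, g y>> = - <<u n x - f x, y>> + <<x, v n y - g y>>.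
  by rewrite (sesquiBl hs) (sesquiBr hs) hv opprB addrA subrK.
rewrite (le_trans (ler_normD _ _))// normrN mulrDl lerD// (le_trans (hdot_norm_le _ _))//.
  by rewrite mulrAC ler_wpM2r.
by rewrite -mulrA ler_wpM2l.
Qed.

Definition commutant_gauge : gauge H (H : normedModType C) :=
  Gauge (@cauchy_seq_complete R H) (fun x => normr_ge0 x) cdom0 cdomP cdom_lim.

Definition commutant := gspace commutant_gauge.
Implicit Types T S U : commutant.

Let cadj_ex T : exists S : commutant, forall x y, <<T x, y>> = <<x, S y>>.
Proof.
have [Tc [S TS]] := gspace_dom T.
have SM : forall y, `|S y| <= `|T| * `|y|.
  by apply: (@adjoint_bound T S) => // x; exact: gspace_normP.
have Sm : gmem commutant_gauge S.
  apply/asboolP; split; last by exists `|T|.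
  split=> [s x|]; last by exists T => x y; rewrite hdot_herm -TS -hdot_herm.
  (* The adjoint commutes with [phi s] because [T] commutes with [phi (inv s)], the adjoint of
     [phi s]. *)
  apply: hdot_ext => y; rewrite hdot_herm -TS -hdot_herm.
  by rewrite !phi_adj -Tc hdot_herm TS -hdot_herm.
by exists (GSpace Sm).
Qed.

Definition cadj T : commutant := xget 0 [set S : commutant | forall x y, <<T x, y>> = <<x, S y>>]%classic.

Lemma cadjP T x y : <<T x, y>> = <<x, cadj T y>>.
Proof.
rewrite /cadj; case: xgetP => [S -> //|h].
by have [S hS] := cadj_ex T; case: (h S).
Qed.

Lemma cadjPr T x y : <<cadj T x, y>> = <<x, T y>>.
Proof. by rewrite hdot_herm -cadjP -hdot_herm. Qed.

Lemma cadj_unique T S : (forall x y, <<T x, y>> = <<x, S y>>) -> cadj T = S.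
Proof.
move=> TS; apply: gspace_eq => y; apply: hdot_ext => x.
by rewrite hdot_herm -cadjP TS -hdot_herm.
Qed.

Lemma commutantP T (a : C) x y : T (a *: x + y) = a *: T x + T y.
Proof. by apply: hdot_ext => z; rewrite hs.1 !cadjP hs.1. Qed.

Let comp_mem T S : gmem commutant_gauge (fun x => T (S x)).
Proof.
apply/asboolP; split.
  have [[Tc _] [Sc _]] := (gspace_dom T, gspace_dom S).
  split=> [s x|]; first by rewrite Sc Tc.
  by exists (fun x => cadj S (cadj T x)) => x y; rewrite !cadjP.
exists (`|T| * `|S|) => [|x]; first exact: mulr_ge0.
rewrite -mulrA (le_trans (gspace_normP T _))// ler_wpM2l//.
exact: gspace_normP.
Qed.
Let cmul T S : commutant := GSpace (comp_mem T S).

Let id_mem : gmem commutant_gauge (fun x : H => x).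
Proof.
apply/asboolP; split; last by exists 1 => // x; rewrite mul1r.
by split=> //; exists id.
Qed.
Let cone : commutant := GSpace id_mem.

Let cmul_bilinear : bilinear_for *:%R *:%R cmul.
Proof.
split=> [T a S U|T a S U]; apply: gspace_eq => x; first by [].
exact: commutantP.
Qed.
Let cmulA : associative cmul.
Proof. by move=> T S U; apply: gspace_eq. Qed.
Let cmul1l : left_id cone cmul.
Proof. by move=> T; apply: gspace_eq. Qed.
Let cmul1r : right_id cone cmul.
Proof. by move=> T; apply: gspace_eq. Qed.
Let cadj_conjlinear a T S : cadj (a *: T + S) = a^* *: cadj T + cadj S.
Proof.
apply: cadj_unique => x y; rewrite !gfunD !gfunZ hs.1 hs.2 conjCK !cadjP.
by [].
Qed.
Let cadjK : involutive cadj.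
Proof. by move=> T; apply: cadj_unique => x y; rewrite cadjPr. Qed.
Let cadjM T S : cadj (cmul T S) = cmul (cadj S) (cadj T).
Proof. by apply: cadj_unique => x y; rewrite /= !cadjP. Qed.
Let cnormM T S : `|cmul T S| <= `|T| * `|S|.
Proof.
apply: gspace_norm_le => [|x]; first exact: mulr_ge0.
rewrite -mulrA (le_trans (gspace_normP T _))// ler_wpM2l//.
exact: gspace_normP.
Qed.
Let cadj_norm T : `|cadj T| <= `|T|.
Proof.
apply: gspace_norm_le => // x; apply: (@adjoint_bound T (cadj T)) => //.
  exact: gspace_normP.
exact: cadjP.
Qed.
Let cnormE T : `|cmul (cadj T) T| = `|T| ^+ 2.
Proof.
apply/eqP; rewrite eq_le; apply/andP; split.
  by rewrite (le_trans (cnormM _ _))// expr2 ler_wpM2r// cadj_norm.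
rewrite -[leRHS]sqrtCK ler_sqr ?nnegrE ?sqrtC_ge0//.
apply: gspace_norm_le => [|x]; first by rewrite sqrtC_ge0.
rewrite -[gw _ x]/(`|x|) -ler_sqr ?nnegrE//; last by rewrite mulr_ge0// sqrtC_ge0.
rewrite [leRHS]exprMn sqrtCK.
rewrite hilb_normE cadjP.
rewrite -[leLHS]ger0_norm; last by rewrite -cadjP -hilb_normE exprn_ge0.
rewrite (le_trans (hdot_norm_le _ _))// mulrC expr2 mulrA ler_wpM2r//.
exact: (gspace_normP (cmul (cadj T) T)).
Qed.

Definition commutant_cstar : cstarAlg R :=
  @CStarAlg R commutant cmul cone cadj cmul_bilinear cmulA cmul1l cmul1r
    cadj_conjlinear cadjK cadjM cnormM cnormE.

Lemma commutant_mulE T S x : (cstar_mul (c := commutant_cstar) T S : commutant) x = T (S x).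
Proof. by []. Qed.
Lemma commutant_oneE x : (cstar_one commutant_cstar : commutant) x = x.
Proof. by []. Qed.
Lemma commutant_comm T s x : T (phi s x) = phi s (T x).
Proof. by have [Tc _] := gspace_dom T; exact: Tc. Qed.

Lemma commutant_mem (T S : bounded_op H) : (forall x y, <<T x, y>> = <<x, S y>>) ->
  (forall s x, T (phi s x) = phi s (T x)) -> gmem commutant_gauge T.
Proof.
move=> TS Tc; apply/asboolP; split; first by split=> //; exists S.
by have [M M0 hM] := bop_bound T; exists M.
Qed.

End Commutant.

Lemma snorm_triangle (R : realType) (V : lmodType R[i]) (B : V -> V -> R[i])
  (hB : sesquiform B) (Bpos : psd B) x y : snorm B (x + y) <= snorm B x + snorm B y.
Proof.
rewrite -ler_sqr ?nnegrE ?addr_ge0 ?snorm_ge0// snormK sqrrD !snormK.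
rewrite (sesquiDl hB) !(sesquiDr hB).
have -> : B x x + B x y + (B y x + B y y) = B x x + (B x y + B y x) + B y y by ring.
rewrite lerD2r lerD2l.
have r : B x y + B y x \is Num.real.
  by apply/CrealP; rewrite rmorphD /= -(psd_herm hB Bpos x y) -(psd_herm hB Bpos y x) addrC.
apply: le_trans (real_ler_norm r) _; apply: le_trans (ler_normD _ _) _.
rewrite mulr2n lerD ?(psd_CS_norm hB Bpos)// mulrC.
exact: psd_CS_norm.
Qed.

(** * Square roots of positive matrices over a commutant *)

Section CommutantMatrices.
Variables (R : realType) (H : hilbert R) (I : Type).
Local Notation C := R[i].
Variables (phi : I -> bounded_op H) (inv : I -> I).
Hypothesis phi_adj : forall s x y,
  hilb_dot H (phi s x) y = hilb_dot H x (phi (inv s) y).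
Local Notation A := (commutant_cstar phi_adj).
Local Notation cA := (calg A).
Variable p : nat.
Local Notation Hp := ('I_p -> H).
Implicit Types (X Y : 'M[cA]_p) (v w : Hp).

Definition capp (T : cA) (x : H) : H := (T : commutant phi) x.

Let cappD T S x : capp (T + S) x = capp T x + capp S x. Proof. by []. Qed.
Let capp0 x : capp 0 x = 0. Proof. by []. Qed.
Let cappZ a T x : capp (a *: T) x = a *: capp T x. Proof. by []. Qed.
Let capp_sum J (r : seq J) (P : pred J) (F : J -> cA) x :
  capp (\sum_(j <- r | P j) F j) x = \sum_(j <- r | P j) capp (F j) x.
Proof. exact: (big_morph (capp^~ x) (fun T S => cappD T S x) (capp0 x)). Qed.
Let cappP T a x y : capp T (a *: x + y) = a *: capp T x + capp T y.
Proof. exact: commutantP. Qed.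
Let cappDr T x y : capp T (x + y) = capp T x + capp T y.
Proof. by have := cappP T 1 x y; rewrite !scale1r. Qed.
Let capp0r T : capp T 0 = 0.
Proof. by apply: (addrI (capp T 0)); rewrite -cappDr !addr0. Qed.
Let capp_sumr J (r : seq J) (P : pred J) (F : J -> H) T :
  capp T (\sum_(j <- r | P j) F j) = \sum_(j <- r | P j) capp T (F j).
Proof. exact: (big_morph (capp T) (cappDr T) (capp0r T)). Qed.
Let capp_norm T x : `|capp T x| <= `|T| * `|x|.
Proof. exact: (gspace_normP (T : commutant phi)). Qed.
Let capp_adj T x y : hilb_dot H (capp T x) y = hilb_dot H x (capp (cst T) y).
Proof. exact: cadjP. Qed.

Definition act X v : Hp := fun k => \sum_l capp (X k l) (v l).
Let B v w : C := \sum_k hilb_dot H (v k) (w k).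

Let hB : sesquiform B.
Proof.
split=> a x y z; rewrite /B mulr_sumr -big_split; apply: eq_bigr => k _ /=.
  exact: (hdot_sesqui H).1.
exact: (hdot_sesqui H).2.
Qed.
Let Bpos : psd B.
Proof. by move=> v; apply: sumr_ge0 => k _; exact: hdot_psd. Qed.
Local Notation nrm := (snorm B).
Let nrm_ge0 v : 0 <= nrm v. Proof. exact: snorm_ge0. Qed.

Let actD X Y v : act (X + Y) v = act X v + act Y v.
Proof.
apply/funext => k; rewrite /act fctE -big_split; apply: eq_bigr => l _.
by rewrite mxE cappD.
Qed.
Let actN X v : act (- X) v = - act X v.
Proof.
apply/funext => k; rewrite /act fctE -sumrN; apply: eq_bigr => l _.
by rewrite mxE -scaleN1r cappZ scaleN1r.
Qed.
Let actM X Y v : act (X * Y) v = act X (act Y v).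
Proof.
apply/funext => k; rewrite /act.
transitivity (\sum_l \sum_m capp (X k m * Y m l) (v l)).
  by apply: eq_bigr => l _; rewrite mxE capp_sum.
by rewrite exchange_big; apply: eq_bigr => m _; rewrite capp_sumr.
Qed.
Let actP X a v w : act X (a *: v + w) = a *: act X v + act X w.
Proof.
apply/funext => k; rewrite /act.
transitivity (\sum_l (a *: capp (X k l) (v l) + capp (X k l) (w l))).
  by apply: eq_bigr => l _; rewrite -cappP.
by rewrite big_split -scaler_sumr.
Qed.

Let smx X : 'M[cA]_p := (map_mx (@cst _ A) X)^T.

Let act_adj X v w : B (act X v) w = B v (act (smx X) w).
Proof.
rewrite /B /act.
under eq_bigr do rewrite (sesqui_suml (hdot_sesqui H)).
under [RHS]eq_bigr do rewrite (sesqui_sumr (hdot_sesqui H)).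
rewrite exchange_big; apply: eq_bigr => k _; apply: eq_bigr => l _.
by rewrite capp_adj !mxE.
Qed.

Let nrm_coord v k : `|v k| <= nrm v.
Proof.
rewrite -ler_sqr ?nnegrE ?nrm_ge0// snormK hilb_normE /B (bigD1 k)//= lerDl.
by apply: sumr_ge0 => l _; exact: hdot_psd.
Qed.

Let nrm_le v : nrm v <= \sum_k `|v k|.
Proof.
rewrite -ler_sqr ?nnegrE ?nrm_ge0 ?sumr_ge0// snormK /B expr2 mulr_suml.
apply: ler_sum => k _; rewrite -hilb_normE expr2 ler_wpM2l//.
by rewrite (bigD1 k)//= lerDl sumr_ge0.
Qed.

Let act_le X v : nrm (act X v) <= (\sum_k \sum_l `|X k l|) * nrm v.
Proof.
apply: le_trans (nrm_le _) _; rewrite mulr_suml; apply: ler_sum => k _.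
apply: le_trans (ler_norm_sum _ _ _) _; rewrite mulr_suml; apply: ler_sum => l _.
by apply: le_trans (capp_norm _ _) _; rewrite ler_wpM2l ?nrm_coord.
Qed.

Let delta (l : 'I_p) (x : H) : Hp := fun k => if k == l then x else 0.
Let act_delta X k l x : act X (delta l x) k = capp (X k l) x.
Proof.
rewrite /act (bigD1 l)//= /delta eqxx big1 ?addr0// => m ml.
by rewrite (negPf ml) capp0r.
Qed.
Let nrm_delta l x : nrm (delta l x) = `|x|.
Proof.
apply/eqP; rewrite -(@eqrXn2 _ 2) ?nrm_ge0// snormK /B hilb_normE (bigD1 l)//= /delta eqxx.
rewrite big1 ?addr0// => m ml.
by rewrite (negPf ml) (sesqui0l (hdot_sesqui H)).
Qed.

Let bnd (c : C) X : Prop := forall v, nrm (act X v) <= c * nrm v.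

Let bnd_entry c X k l : 0 <= c -> bnd c X -> `|X k l| <= c.
Proof.
move=> c0 h; apply: (@gspace_norm_le _ _ _ _ (X k l : commutant phi)) => // x.
rewrite -[_ x]/(capp (X k l) x) -act_delta (le_trans (nrm_coord _ _))//.
by rewrite (le_trans (h _))// nrm_delta.
Qed.

Let half : 'M[cA]_p := (2^-1 *: (1 : cA))%:M.

Let sqrt_mx (h : 'M[cA]_p) : smx h = h -> bnd 1 h ->
  exists z : 'M[cA]_p, h + z * z = z + z /\ smx z = z.
Proof.
move=> hh h1.
have smxK X : smx (smx X) = X by apply/matrixP => i j; rewrite !mxE cstK.
have smxD : {morph smx : x y / x + y} by move=> X Y; apply/matrixP => i j; rewrite !mxE cstD.
have smxM X Y : smx (X * Y) = smx Y * smx X.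
  apply/matrixP => i j; rewrite !mxE cst_sum; apply: eq_bigr => k _.
  by rewrite !mxE cstM.
have [||||||||||||||z [zE z1 zh _]] := @sqrt_iteration R 'M[cA]_p smx half bnd _ _ _ _ _ _ _ _ _ _ _ _ _ _ h h1.
- have e : 2^-1 + 2^-1 = 1 :> C by field.
  by rewrite /half -raddfD -scalerDl e scale1r.
- move=> X; rewrite /half -[LHS]/(_ *m _) -[RHS]/(_ *m _) mul_scalar_mx.
  apply/matrixP => i j; rewrite !mxE (bigD1 j)//= mxE eqxx mulr1n big1 ?addr0.
    by rewrite -calg_scaleAl -calg_scaleAr mul1r mulr1.
  by move=> k kj; rewrite mxE (negPf kj) mulr0n mulr0.
- apply/matrixP => i j; rewrite !mxE [j == i]eq_sym.
  case: (i == j); rewrite ?mulr1n ?mulr0n ?cst0//.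
  by rewrite cstZ cst1 fmorphV /= conjC_nat.
- exact: smxD.
- exact: smxM.
- move=> a b X Y hX hY v; rewrite actD mulrDl.
  by apply: le_trans (snorm_triangle hB Bpos _ _) _; apply: lerD.
- move=> a X hX v; rewrite actN -scaleN1r (snormZ hB Bpos) normrN1 mul1r.
  exact: hX.
- move=> a b X Y a0 b0 hX hY v; rewrite actM -mulrA.
  by apply: le_trans (hX _) _; rewrite ler_wpM2l.
- move=> a b X ab hX v; apply: le_trans (hX v) _.
  by rewrite ler_wpM2r.
- move=> v; rewrite mul0r; have -> : act 0 v = 0.
    by apply/funext => k; rewrite /act big1// => l _; rewrite mxE.
  by rewrite -(scale0r (0 : Hp)) (snormZ hB Bpos) normr0 mul0r.
- move=> v; have -> : act half v = (2^-1 : C) *: v.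
    apply/funext => k; rewrite /act (bigD1 k)//= big1 ?addr0 => [|l lk].
      by rewrite mxE eqxx mulr1n cappZ.
    by rewrite mxE eq_sym (negPf lk) mulr0n.
  by rewrite (snormZ hB Bpos) gtr0_norm ?invr_gt0 ?ltr0Sn.
- move=> a X hX v.
  have [n0|n0] := eqVneq (nrm (act (smx X) v)) 0.
    by rewrite n0; apply: le_trans (hX v); rewrite nrm_ge0.
  have np : 0 < nrm (act (smx X) v) by rewrite lt_def n0 nrm_ge0.
  rewrite -(ler_pM2r np) -expr2 snormK act_adj smxK.
  have r : B v (act X (act (smx X) v)) \is Num.real.
    by rewrite -[X in act X]smxK -act_adj; apply: ger0_real; exact: Bpos.
  apply: le_trans (real_ler_norm r) _.
  apply: le_trans (psd_CS_norm hB Bpos _ _) _.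
  by rewrite mulrC mulrAC ler_wpM2r ?nrm_ge0.
- move=> k X hX; apply/matrixP => i l; rewrite mxE; apply: gspace_eq => x.
  apply/eqP; rewrite -[gfun _ x]/(capp (X i l) x) -normr_le0.
  refine (@ler_rate R _ 0 (k * `|x|) _) => n; rewrite add0r mulrAC -(nrm_delta l x).
  by rewrite -act_delta (le_trans (nrm_coord _ _))// hX.
- move=> u d hd hu.
  have du n : 0 <= d n by have /andP[] := hd n.
  have ue m n i l : (m <= n)%N -> `|u m i l - u n i l| <= d m.
    move=> mn; rewrite distrC; have := bnd_entry i l (du m) (hu _ _ mn).
    by rewrite !mxE.
  have el i l : exists a : cA, forall n, `|u n i l - a| <= 2 * rate R n.
    apply: (@seq_complete_scaled R cA (@cauchy_seq_complete R A) 2 (fun n => u n i l)).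
      exact: ler0n.
    move=> m n; rewrite mulrDr.
    have [mn|nm] := leqP m n.
      rewrite (le_trans (ue _ _ _ _ mn))//; have /andP[_ dm] := hd m.
      by rewrite (le_trans dm)// lerDl mulr_ge0 ?ler0n ?rate_ge0.
    rewrite distrC (le_trans (ue _ _ _ _ (ltnW nm)))//; have /andP[_ dn] := hd n.
    by rewrite (le_trans dn)// lerDr mulr_ge0 ?ler0n ?rate_ge0.
  have [l hl] := choice (fun ij => el ij.1 ij.2).
  exists (\matrix_(i, j) l (i, j)) => n v.
  (* Entrywise convergence costs a constant depending on [p]. It multiplies [rate R m] for an
     auxiliary index m, so that the exact bound [d n] survives. *)
  apply: (@ler_rate _ _ _ ((\sum_(i < p) \sum_(j < p) 2) * nrm v)) => m.
  have -> : u n - \matrix_(i, j) l (i, j)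
      = - (u (maxn m n) - u n) + (u (maxn m n) - \matrix_(i, j) l (i, j)).
    by rewrite opprB addrA subrK.
  rewrite actD (le_trans (snorm_triangle hB Bpos _ _))// lerD//.
    rewrite actN -scaleN1r (snormZ hB Bpos) normrN1 mul1r.
    by apply: hu; rewrite leq_maxr.
  rewrite (le_trans (act_le _ _))// mulrAC ler_wpM2r ?nrm_ge0//.
  rewrite mulr_suml ler_sum// => i _; rewrite mulr_suml ler_sum// => j _.
  rewrite !mxE (le_trans (hl (i, j) _))// ler_wpM2l ?ler0n//.
  by rewrite le_rate_anti// leq_maxl.
by exists z; split=> //; exact: zh.
Qed.

Let act_inj X Y : (forall v, act X v = act Y v) -> X = Y.
Proof.
move=> h; apply/matrixP => k l; apply: gspace_eq => x.
by rewrite -[LHS]/(capp (X k l) x) -act_delta h act_delta.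
Qed.

(** Positivity over a C*-algebra asks for a factor with entries in that algebra. The iteration for 1
    - T / M stays among matrices over the commutant and yields a self-adjoint root q of T / M; the
    factor is q times the root of M. *)
Lemma commutant_mx_pos (T : 'M[A]_p) :
  (forall v : 'I_p -> H, 0 <= \sum_k \sum_l hilb_dot H ((T k l : commutant phi) (v l)) (v k)) ->
  mpos (cstar_cones A) T.
Proof.
move=> T0; pose X : 'M[cA]_p := T; pose F v w := B (act X v) w.
have hF : sesquiform F.
  split=> a v w z; rewrite /F; first by rewrite actP hB.1.
  exact: hB.2.
have Fpos : psd F.
  move=> v; rewrite /F /B /act (le_trans (T0 v))// le_eqVlt; apply/orP; left; apply/eqP.
  by apply: eq_bigr => k _; rewrite (sesqui_suml (hdot_sesqui H)).
have XX : smx X = X.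
  apply: act_inj => w; apply/funext => k; apply: hdot_ext => x.
  have e v : B (act (smx X) w) v = B (act X w) v.
    by rewrite (psd_herm hB Bpos) -act_adj -[B (act X v) w]/(F v w) -(psd_herm hF Fpos).
  have Be v : B v (delta k x) = hilb_dot H (v k) x.
    rewrite /B (bigD1 k)//= /delta eqxx big1 ?addr0// => m mk.
    by rewrite (negPf mk) (sesqui0r (hdot_sesqui H)).
  by rewrite -!Be e.
(* A bound for the operator norm of [X]; the summand 1 makes it invertible. *)
pose M : C := \sum_k \sum_l `|X k l| + 1.
have M0 : 0 < M.
  by rewrite ltr_wpDl// sumr_ge0// => k _; apply: sumr_ge0 => l _; exact: normr_ge0.
have FM v : F v v <= M * B v v.
  rewrite -[leLHS]ger0_norm ?Fpos// (le_trans (psd_CS_norm hB Bpos _ _))//.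
  rewrite -snormK expr2 mulrA ler_wpM2r ?nrm_ge0// (le_trans (act_le _ _))//.
  by rewrite ler_wpM2r ?nrm_ge0// lerDl.
pose h : 'M[cA]_p := \matrix_(i, j) ((1 : 'M[cA]_p) i j - M^-1 *: X i j).
have hE v : act h v = v - M^-1 *: act X v.
  apply/funext => k; rewrite /act !fctE scaler_sumr.
  transitivity (\sum_l (capp ((1 : 'M[cA]_p) k l) (v l) - M^-1 *: capp (X k l) (v l))).
    by apply: eq_bigr => l _; rewrite mxE.
  rewrite sumrB (bigD1 k)//= big1 ?addr0 => [|l lk]; first by rewrite mxE eqxx.
  by rewrite mxE eq_sym (negPf lk).
pose G v w := B (act h v) w.
have GE v : G v v = B v v - M^-1 * F v v by rewrite /G hE (sesquiBl hB) (sesquiZl hB).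
have hG : sesquiform G.
  split=> a v w z; rewrite /G; first by rewrite actP hB.1.
  exact: hB.2.
have Gpos : psd G by move=> v; rewrite GE subr_ge0 ler_pdivrMl.
have Gle v : snorm G v <= nrm v.
  rewrite -ler_sqr ?nnegrE ?snorm_ge0// !snormK// GE gerBl.
  by apply: mulr_ge0; [rewrite invr_ge0 ltW | exact: Fpos].
(* The form [G] of [h] lies between 0 and the inner product; Cauchy-Schwarz for [G] at v and h v
   turns this into a norm bound. *)
have h1 : bnd 1 h.
  move=> v; rewrite mul1r; have [->//|n0] := eqVneq (nrm (act h v)) 0.
  have np : 0 < nrm (act h v) by rewrite lt_def n0 nrm_ge0.
  rewrite -(ler_pM2r np) -expr2 snormK -[B _ _]/(G v (act h v)).
  rewrite -[leLHS]ger0_norm; last exact: Bpos.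
  by rewrite (le_trans (psd_CS_norm hG Gpos _ _))// ler_pM ?snorm_ge0.
have Mr : (M^-1)^* = M^-1 by apply: conj_Creal; rewrite realV gtr0_real.
have [|z [zE zz]] := sqrt_mx _ h1.
  apply/matrixP => i j; rewrite !mxE cstB cstZ Mr.
  have -> : X i j = cst (X j i) by rewrite -{1}XX !mxE.
  congr (_ - _).
  by rewrite eq_sym; case: (i == j); rewrite ?mulr1n ?mulr0n ?cst1 ?cst0.
pose q := 1 - z.
have qq : smx q = q.
  apply/matrixP => i j; rewrite !mxE cstB -[in RHS]zz !mxE; congr (_ - _).
  by rewrite eq_sym; case: (i == j); rewrite ?mulr1n ?mulr0n ?cst1 ?cst0.
have qE : q * q = 1 - h.
  have -> : q * q = 1 - (z + z - z * z).
    by rewrite mulrBl mul1r mulrBr mulr1 !opprD !opprK !addrA.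
  by rewrite -zE addrK.
exists (\matrix_(i, j) (sqrtC M *: q i j)).
apply/matrixP => i j; rewrite mxE.
have -> : T i j = M *: (q * q) i j.
  rewrite qE !mxE opprB addrCA subrr addr0 scalerA divff ?scale1r//.
  exact: lt0r_neq0.
rewrite mxE scaler_sumr; apply: eq_bigr => k _.
have qik : q i k = cst (q k i) by rewrite -{1}qq [LHS]mxE [LHS]mxE.
rewrite [X in cstar_star X]mxE [X in cstar_mul _ X]mxE.
rewrite -[RHS]/(cst (sqrtC M *: q k i) * (sqrtC M *: q k j)) cstZ -qik.
rewrite conj_Creal; last by rewrite ger0_real// sqrtC_ge0 ltW.
by rewrite -calg_scaleAl -calg_scaleAr scalerA -expr2 sqrtCK.
Qed.

End CommutantMatrices.

Lemma cp_bop_adj (R : realType) (V : lmodType R[i]) (oV : opsys_data V) (H : hilbert R)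
    (phi : V -> bounded_op H) : is_opsys oV -> cp oV (bop_cones H) phi ->
  forall s x y, hilb_dot H (phi s x) y = hilb_dot H x (phi (ops_star oV s) y).
Proof.
move=> hV [phil phip] s x y.
have hQ := @family_herm _ _ _ hV H (fun s x y => hilb_dot H (phi s x) y) _ _ _ (ops_star oV s) x y.
rewrite (ops_starK hV) in hQ; rewrite hQ -?hdot_herm//.
- by move=> t; exact: bop_sesqui.
- move=> a t t' u v; rewrite (phil a t t').
  exact: (hdot_sesqui H).1.
- move=> t pt; apply/bop_pos1E; rewrite -(map_const_mx phi); exact: phip.
Qed.

(** * From nuclearity to the maximally entangled element *)

Section NuclearComPositive.
Variables (R : realType) (V W : lmodType R[i]) (oV : opsys_data V) (oW : opsys_data W).
Hypotheses (hV : is_opsys oV) (hW : is_opsys oW).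
Variable D : dual_pair oV oW.
Local Notation C := R[i].
Variables (H : hilbert R) (phi : V -> bounded_op H) (psi : W -> bounded_op H).
Hypotheses (phi_ucp : ucp oV (bop_cones H) phi) (psi_ucp : ucp oW (bop_cones H) psi).
Hypothesis phi_psi : forall s t, bop_comp (phi s) (psi t) = bop_comp (psi t) (phi s).
Let phi_adj := cp_bop_adj hV phi_ucp.1.
Let psi_adj := cp_bop_adj hW psi_ucp.1.
Local Notation A := (commutant_cstar phi_adj).

Let psiA_mem t : gmem (commutant_gauge phi) (psi t).
Proof.
apply: (commutant_mem (psi_adj t)) => s x.
by rewrite -!bop_compE phi_psi.
Qed.
Let psiA t : A := GSpace (psiA_mem t).

Let psiA_cp : cp oW (cstar_cones A) psiA.
Proof.
split=> [a s t|r F hF].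
  by apply: gspace_eq => x; rewrite -[LHS]/(psi (a *: s + t) x) psi_ucp.1.1.
apply: commutant_mx_pos => v; have := psi_ucp.1.2 _ _ hF v.
move=> h; apply: (eq_ind _ (fun z => 0 <= z) h).
by apply: eq_bigr => k _; apply: eq_bigr => l _; rewrite !mxE.
Qed.

Let X : tensor V A := \sum_k dp_v D k ⊗ psiA (dp_w D k).

(** A map [chi] from V to p by p matrices is the same as a matrix [F] over W, positive when [chi] is
    cp. Under this identification the image of [X] by [chi] and [eta] is [eta] applied to the
    entries of [psiA] (F), which is positive because [psiA] and [eta] are cp. *)
Let X_min : mpos (min_tensor oV (cstar_cones A)) (const_mx X : 'M_1).
Proof.
move=> p q chi eta [cchi _] [ceta _] v.
have hb := tens_mx_bilinear cchi.1 ceta.1.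
have chi0 : chi 0 = 0.
  by have := cchi.1 (-1) 0 0; rewrite scaler0 addr0 scaleN1r addNr.
have chi_sum I (s : seq I) (F : I -> V) : chi (\sum_(i <- s) F i) = \sum_(i <- s) chi (F i).
  apply: (big_morph chi) => // x y.
  by have := cchi.1 1 x y; rewrite !scale1r.
have chiZ a x : chi (a *: x) = a *: chi x.
  by have := cchi.1 a x 0; rewrite chi0 !addr0.
pose F : 'M[W]_p := \matrix_(a, b) \sum_k chi (dp_v D k) a b *: dp_w D k.
have DF x a b : D x (F a b) = chi x a b.
  rewrite mxE (dp_basisl D x) chi_sum summxE.
  have Dl y k : D (\sum_k D x (dp_w D k) *: dp_v D k) y = D x y by rewrite -(dp_basisl D x).
  have Ds (s : seq 'I_(dp_size D)) (c : 'I_(dp_size D) -> C) :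
      D x (\sum_(k <- s) c k *: dp_w D k) = \sum_(k <- s) c k * D x (dp_w D k).
    elim: s => [|k s IH].
      rewrite !big_nil; have := dp_linr D (-1) 0 0 x.
      by rewrite scaler0 addr0 mulN1r addNr.
    by rewrite !big_cons dp_linr IH.
  rewrite -(dp_basisl D x) Ds; apply: eq_bigr => k _.
  by rewrite chiZ mxE mulrC.
have hF : mpos oW F.
  apply/(dp_posr D); split=> [c x y|r Y hY].
    by apply/matrixP => a b; rewrite !mxE dp_linl.
  have := cchi.2 _ _ hY; congr (mpos _ _); apply/matrixP => i j; rewrite !mxE.
  by apply/matrixP => a b; rewrite -DF !mxE.
have eta0 : eta 0 = 0.
  by have := ceta.1 (-1) 0 0; rewrite scaler0 addr0 scaleN1r addNr.
have psiA_sum a b : eta (psiA (F a b)) = \sum_k chi (dp_v D k) a b *: eta (psiA (dp_w D k)).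
  rewrite mxE; elim: (index_enum _) => [|k s IH].
    rewrite !big_nil; have := psiA_cp.1 (-1) 0 0.
    by rewrite scaler0 addr0 scaleN1r addNr => ->.
  by rewrite !big_cons psiA_cp.1 ceta.1 IH.
have := ceta.2 _ _ (psiA_cp.2 _ _ hF)
  (fun a => \col_c v ord0 (mxtens_index (a, c)) 0).
move=> h; apply: (eq_ind _ (fun z => 0 <= z) h).
rewrite !big_ord1 -/(qform _ _ _) qformE !mxE (lift_sum hb).
pose G (K L : 'I_p * 'I_q) := (v ord0 (mxtens_index K) 0)^* *
  eta (psiA (F K.1 L.1)) K.2 L.2 * v ord0 (mxtens_index L) 0.
transitivity (\sum_K \sum_L G (mxtens_unindex K) (mxtens_unindex L)); last first.
  apply: eq_bigr => K _; apply: eq_bigr => L _; rewrite /G !mxtens_unindexK psiA_sum.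
  congr (_ * _ * _); rewrite !summxE; apply: eq_bigr => k _.
  by rewrite (lift_tens hb) !mxE.
rewrite (sum_mxtens (fun k => \sum_L G k (mxtens_unindex L))); apply: eq_bigr => a _.
under [RHS]eq_bigr do rewrite sum_mxtens.
rewrite [RHS]exchange_big /=; apply: eq_bigr => b _.
rewrite -/(qform _ _ _) qformE; apply: eq_bigr => c _; apply: eq_bigr => d _.
by rewrite /G !mxE.
Qed.

Variable xi : H.

Let rho (s : V) (a : A) : C^o := hilb_dot H (phi s ((a : commutant phi) xi)) xi.

Let rho_bilinear : bilinear_for *:%R *:%R rho.
Proof.
split=> [a c s t|s c a b]; rewrite /rho.
  rewrite phi_ucp.1.1; exact: (hdot_sesqui H).1.
have -> : phi s ((c *: a + b : commutant phi) xi) =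
    c *: phi s ((a : commutant phi) xi) + phi s ((b : commutant phi) xi).
  exact: (bop_linear (phi s)).
exact: (hdot_sesqui H).1.
Qed.

(** The factor x_k^* commutes with [phi s] and moves to the other side of the inner product. What
    remains is complete positivity of [phi] at the vectors x_k xi. *)
Let rho_pos (Y : 'M[tensor V A]_1) : Dmax oV (cstar_cones A) Y ->
  0 <= (tensor_lift rho (Y 0 0) : C).
Proof.
move=> /(Dmax_simple hV)[p [S [x [hS ->]]]].
have := phi_ucp.1.2 _ _ hS (fun k => (x k 0 : commutant phi) xi).
move=> h; apply: (eq_ind _ (fun z => 0 <= z) h).
rewrite (lift_sum rho_bilinear); apply: eq_bigr => k _.
rewrite (lift_sum rho_bilinear); apply: eq_bigr => l _.
rewrite (lift_tens rho_bilinear) /rho mxE.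
rewrite (commutant_mulE phi_adj) -[in RHS]commutant_comm; apply/esym.
exact: cadjPr.
Qed.

Lemma nuclear_pairing_ge0 : Cstar_nuclear oV ->
  0 <= \sum_k hilb_dot H (phi (dp_v D k) (psi (dp_w D k) xi)) xi.
Proof.
move=> nV; have [[_ hmax] _] := nV A.
have := hmax _ _ X_min; rewrite map_mx_id// => Xmax.
set z := \sum_k _.
have zE : z = tensor_lift rho X.
  rewrite (lift_sum rho_bilinear); apply: eq_bigr => k _.
  by rewrite (lift_tens rho_bilinear).
apply: (@ge0_limit _ _ (hilb_dot H xi xi)) => n.
exists (z + rate R n * hilb_dot H xi xi); last first.
  rewrite opprD addNKr normrN ger0_norm ?mulr_ge0 ?rate_ge0 ?hdot_psd//.
  by rewrite mulrC.
have := rho_pos (Xmax _ (rate_gt0 R n)).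
rewrite !mxE eqxx mulr1n (liftD rho_bilinear) (liftZ rho_bilinear) (lift_tens rho_bilinear).
rewrite -zE /rho phi_ucp.2 commutant_oneE; exact.
Qed.

End NuclearComPositive.

Theorem nuclear_com_positive (R : realType) (V W : lmodType R[i]) (oV : opsys_data V)
    (oW : opsys_data W) (hV : is_opsys oV) (hW : is_opsys oW) (D : dual_pair oV oW) :
  Cstar_nuclear oV -> com_positive D.
Proof. by move=> nV H phi psi h1 h2 c xi; exact: nuclear_pairing_ge0. Qed.

(** * The dual operator system *)

Lemma linear_hom (K : fieldType) (V U : vectType K) (g : V -> U) : linear g ->
  exists h : 'Hom(V, U), forall x, h x = g x.
Proof.
move=> gl; pose G := HB.pack g (GRing.isLinear.Build _ _ _ _ g gl) : {linear V -> U}.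
by exists (linfun G) => x; exact: (lfunE G x).
Qed.

Section Separation.
Variables (R : realType) (S : vectType R[i]) (oS : opsys_data S).
Hypothesis hS : is_opsys oS.
Local Notation C := R[i].
Local Notation S' := 'Hom(S, C^o).

Definition pairing r (F : 'M[S']_r) (B : 'M[S]_r) : C := \sum_i \sum_j (F i j (B i j) : C).

(** The Archimedean axiom provides t > 0 with X + t 1 still outside the cone. Separating this
    element gives a functional with value at most - t at X, hence strict negativity. *)
Lemma opsys_separation r (X : 'M[S]_r) : star_mx (ops_star oS) X = X -> ~ mpos oS X ->
  exists F : 'M[S']_r, (forall B, mpos oS B -> 0 <= pairing F B) /\ pairing F X < 0.
Proof.
move=> hX nX; pose E := 'I_r -> 'I_r -> S.
pose mx (x : E) : 'M[S]_r := \matrix_(i, j) x i j.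
pose star (x : E) : E := fun i j => ops_star oS (x j i).
have starP a x y : star (a *: x + y) = a^* *: star x + star y.
  by apply/funext => i; apply/funext => j; rewrite /star !fctE (ops_star_conjlinear hS).
have starK : involutive star.
  by move=> x; apply/funext => i; apply/funext => j; rewrite /star (ops_starK hS).
have mx_star x : mx (star x) = star_mx (ops_star oS) (mx x).
  by apply/matrixP => i j; rewrite !mxE.
have mx_inj x y : mx x = mx y -> x = y.
  move=> /matrixP xy; apply/funext => i; apply/funext => j.
  by have := xy i j; rewrite !mxE.
have mxZD a x y : mx (a *: x + y) = scale_vmx a (mx x) + mx y.
  by apply/matrixP => i j; rewrite !mxE.
have scale1 (A : 'M[S]_r) : scale_vmx 1 A = A.
  by apply/matrixP => i j; rewrite mxE scale1r.
pose D : set E := [set x | mpos oS (mx x)]%classic.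
have mx0 : mx 0 = 0 by apply/matrixP => i j; rewrite !mxE.
have Dc : convex_cone star D.
  split=> [x Dx||x y Dx Dy|t x t0 Dx].
  - by apply: mx_inj; rewrite mx_star (ops_pos_herm hS).
  - by rewrite /D /= mx0; exact: ops_pos0.
  - by rewrite /D /= -[x in x + y]scale1r mxZD scale1; exact: ops_posD.
  - by rewrite /D /= -[t *: x]addr0 mxZD mx0 addr0; exact: ops_posZ.
pose e : E := fun i j => munit oS *+ (i == j).
have mxe : mx e = amp_mx r (munit oS) by apply/matrixP => i j; rewrite !mxE.
have unit h : star h = h -> exists2 t : C, 0 < t & D (t *: e - h).
  move=> hh; have [|t t0 ht] := @ops_order_unit _ _ _ hS r (mx h).
    by rewrite -mx_star hh.
  exists t => //; rewrite /D /= mxZD mxe; congr (mpos _ _): ht.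
  by congr (_ + _); apply/matrixP => i j; rewrite !mxE.
pose X0 : E := fun i j => X i j.
have mxX : mx X0 = X by apply/matrixP => i j; rewrite !mxE.
have [t [t0 nt]] : exists t : C, 0 < t /\ ~ D (t *: e + X0).
  apply: contrapT => h; apply: nX; apply: (ops_archimedean hS) => t t0.
  apply: contrapT => nt; apply: h; exists t; split=> //.
  by rewrite /D /= mxZD mxe mxX.
have hXt : star (t *: e + X0) = t *: e + X0.
  apply: mx_inj; rewrite starP !mxZD !mx_star mxX hX mxe.
  rewrite conj_Creal ?gtr0_real//; congr (_ + _); apply/matrixP => i j; rewrite !mxE.
  rewrite [j == i]eq_sym; case: (i == j); last by rewrite !mulr0n (ops_star0 hS).
  by rewrite !mulr1n (pos1_herm hS (pos1_unit hS)).
have [f [fl _ fe fD fX]] := cone_separation starP starK Dc unit hXt nt.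
have f0 : f 0 = 0.
  by have := fl (-1) 0 0; rewrite scaleN1r oppr0 addr0 mulN1r addNr.
have fDD x y : f (x + y) = f x + f y.
  by have := fl 1 x y; rewrite scale1r mul1r.
have fsum I (s : seq I) (G : I -> E) : f (\sum_(k <- s) G k) = \sum_(k <- s) f (G k).
  exact: (big_morph f fDD f0).
pose el i j (s : S) : E := fun a b => s *+ ((a == i) && (b == j)).
have elP i j : linear (fun s => f (el i j s) : C^o).
  move=> a x y; rewrite -[RHS]fl; congr f; apply/funext => k; apply/funext => l.
  by rewrite !fctE /el mulrnDl scalerMnr.
(* [F i j] is [f] on matrices supported at (i, j). The default 0 of [xget] never occurs, since
   [linear_hom] provides such a map. *)
pose F : 'M[S']_r := \matrix_(i, j) xget 0 [set h : S' | forall x, h x = f (el i j x)]%classic.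
have FE i j x : F i j x = f (el i j x).
  rewrite mxE; case: xgetP => [h -> //|no].
  by have [h hh] := linear_hom (elP i j); case: (no h).
have pE (B : 'M[S]_r) : pairing F B = f (fun i j => B i j).
  transitivity (f (\sum_i \sum_j el i j (B i j))).
    rewrite fsum; apply: eq_bigr => i _; rewrite fsum; apply: eq_bigr => j _.
    exact: FE.
  congr f; apply/funext => a; apply/funext => b.
  transitivity (\sum_i \sum_j el i j (B i j) a b).
    by rewrite !fct_sumE; apply: eq_bigr => i _; rewrite !fct_sumE.
  rewrite (bigD1 a)//= [X in _ + X]big1 ?addr0 => [|i ia]; last first.
    by rewrite big1// => j _; rewrite /el eq_sym (negPf ia) mulr0n.
  rewrite (bigD1 b)//= big1 ?addr0 => [|j jb]; first by rewrite /el !eqxx mulr1n.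
  by rewrite /el [b == j]eq_sym (negPf jb) andbF mulr0n.
exists F; split=> [B hB|].
  rewrite pE; apply: fD; rewrite /D /=.
  by congr (mpos _ _): hB; apply/matrixP => i j; rewrite mxE.
rewrite pE -[X in f X]/X0; move: fX; rewrite fl fe mulr1 => fX.
by rewrite (@le_lt_trans _ _ (- t)) ?oppr_lt0// -subr_le0 opprK addrC.
Qed.

End Separation.

Section PositiveFunctionals.
Variables (R : realType) (S : vectType R[i]) (oS : opsys_data S).
Hypothesis hS : is_opsys oS.
Local Notation C := R[i].
Local Notation S' := 'Hom(S, C^o).

Definition posf (h : S') : Prop := forall x, pos1 oS x -> 0 <= (h x : C).

Lemma posf_separation x : ops_star oS x = x -> ~ pos1 oS x ->
  exists h, posf h /\ (h x : C) < 0.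
Proof.
move=> hx nx; have [|F [Fp Fx]] := opsys_separation hS _ nx; first by rewrite star_const hx.
exists (F 0 0); split=> [y py|].
  by have := Fp _ py; rewrite /pairing !big_ord1 mxE.
by move: Fx; rewrite /pairing !big_ord1 mxE.
Qed.

Lemma posf_star h x : posf h -> (h (ops_star oS x) : C) = (h x : C)^*.
Proof.
move=> hp; move: x; apply: (opsys_span_ind hS) => [x px|a x y hx hy].
  by rewrite (pos1_herm hS px) conj_Creal// ger0_real// hp.
by rewrite (ops_star_conjlinear hS) !linearP rmorphD /= rmorphM hx hy.
Qed.

Let posf_pos1_herm x : ops_star oS x = x ->
  (forall h, posf h -> 0 <= (h x : C)) -> pos1 oS x.
Proof.
move=> hx xp; apply: contrapT => nx; have [h [hp hx0]] := posf_separation hx nx.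
by have := lt_le_trans hx0 (xp h hp); rewrite ltxx.
Qed.

Let posf_eq0_herm x : ops_star oS x = x ->
  (forall h, posf h -> (h x : C) = 0) -> x = 0.
Proof.
move=> hx x0; apply: const_mx1_inj; apply: (ops_proper hS).
  by apply: posf_pos1_herm => // h hp; rewrite x0.
have -> : - const_mx x = const_mx (- x) :> 'M[S]_1 by apply/matrixP => i j; rewrite !mxE.
by apply: posf_pos1_herm => [|h hp]; rewrite ?(ops_starN hS) ?hx// linearN /= x0 ?oppr0.
Qed.

Lemma posf_eq0 x : (forall h, posf h -> (h x : C) = 0) -> x = 0.
Proof.
have [y [z [hy hz ->]]] := herm_decomp hS x => h0.
have e h : posf h -> (h y : C) = 0 /\ (h z : C) = 0.
  move=> hp; have := h0 h hp; rewrite linearD linearZ /= => yz.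
  have ry : (h y : C)^* = h y by rewrite -posf_star// hy.
  have rz : (h z : C)^* = h z by rewrite -posf_star// hz.
  have := congr1 conjC yz; rewrite rmorph0 rmorphD /= rmorphM /= conjCi ry rz => yz'.
  have y0 : (h y : C) = 0.
    apply: (@mulfI _ 2); first by rewrite pnatr_eq0.
    by rewrite mulr0 -[RHS](addr0 0) -{1}yz -yz' /GRing.scale /=; ring.
  split=> //; move: yz; rewrite y0 add0r => /eqP; rewrite mulf_eq0.
  by rewrite (negPf (neq0Ci _)) => /eqP.
have -> : y = 0 by apply: (posf_eq0_herm hy) => h /e[].
have -> : z = 0 by apply: (posf_eq0_herm hz) => h /e[].
by rewrite scaler0 addr0.
Qed.

Lemma posf_pos1 x : (forall h, posf h -> 0 <= (h x : C)) -> pos1 oS x.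
Proof.
move=> xp; apply: posf_pos1_herm => //; apply/eqP; rewrite -subr_eq0; apply/eqP.
apply: posf_eq0 => h hp; rewrite linearB /= posf_star// conj_Creal ?subrr//.
by rewrite ger0_real// xp.
Qed.

(* A finite family of positive functionals whose common kernel has minimal
   dimension has kernel 0. *)
Lemma posf_span : exists k (h : 'I_k -> S'), (forall a, posf (h a)) /\
  forall F : S', exists c : 'I_k -> C, forall x, (F x : C) = \sum_a c a * (h a x : C).
Proof.
pose P d := exists k (h : 'I_k -> S') (U : {vspace S}),
  [/\ forall a, posf (h a), forall x, x \in U <-> forall a, h a x = 0 & \dim U = d].
have P0 : exists d, `[< P d >].
  exists (\dim (fullv : {vspace S})); apply/asboolP.
  exists 0, (fun=> 0), fullv; split=> // [[]//|x].
  by rewrite memvf; split=> // _ [].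
case: (ex_minnP P0) => d /asboolP[k [h [U [hp hU dU]]]] dmin.
have U0 x : x \in U -> x = 0.
  move=> xU; apply: posf_eq0 => g gp.
  pose h' (a : 'I_k.+1) := if unlift ord0 a is Some b then h b else g.
  have h'0 : h' ord0 = g by rewrite /h' unlift_none.
  have h'S b : h' (lift ord0 b) = h b by rewrite /h' liftK.
  have /dmin : `[< P (\dim (U :&: lker g)) >].
    apply/asboolP; exists k.+1, h', (U :&: lker g)%VS; split=> //.
      by move=> a; rewrite /h'; case: unliftP.
    move=> y; rewrite memv_cap memv_ker; split=> [/andP[/hU yU /eqP gy] a|h'y].
      by rewrite /h'; case: unliftP.
    rewrite -h'0 h'y eqxx andbT; apply/hU => a; by rewrite -h'S.
  rewrite -dU => Ud; have : (U <= lker g)%VS.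
    apply: subv_trans (capvSr U (lker g)).
    by rewrite -(geq_leqif (dimv_leqif_sup (capvSl U (lker g)))).
  by move=> /subvP/(_ x xU); rewrite memv_ker => /eqP.
exists k, h; split=> // F.
have gl : linear (fun x => \row_a (h a x : C)).
  by move=> a x y; apply/rowP => i; rewrite !mxE linearP.
have [G GE] := linear_hom gl.
(* The values of the [h a] determine x, so every functional factors through the row of these values;
   its coefficients are read off a left inverse of [G]. *)
have G0 : lker G == 0%VS.
  apply/lker0P => x y; rewrite !GE => xy; apply/eqP; rewrite -subr_eq0; apply/eqP.
  apply: U0; apply/hU => a; have := congr1 (fun z : 'rV_k => z 0 a) xy.
  by rewrite !mxE linearB /= => ->; rewrite subrr.
exists (fun a => F (G^-1%VF (delta_mx 0 a))) => x.
rewrite -{1}(lker0_lfunK G0 x) GE [\row_a _]row_sum_delta linear_sum linear_sum /=.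
by apply: eq_bigr => a _; rewrite mxE !linearZ /= mulrC.
Qed.

End PositiveFunctionals.

(** * The matrix cones of the dual *)

Section DualCones.
Variables (R : realType) (S : vectType R[i]) (oS : opsys_data S).
Hypothesis hS : is_opsys oS.
Local Notation C := R[i].
Local Notation S' := 'Hom(S, C^o).
Variable w : S'.

(** Completely positive maps into r by r matrices correspond to positive functionals on M_r(S): the
    standard basis vectors suffice as tests, because arbitrary vectors can be absorbed into the
    matrix by a compression. *)
Lemma dual_posP r (F : 'M[S']_r) :
  mpos (dual oS w) F <-> forall B, mpos oS B -> 0 <= pairing F B.
Proof.
split=> [[_ Fp] B hB|Fp].
  have := Fp _ _ hB (fun i => delta_mx i 0) => h; apply: (eq_ind _ (fun z => 0 <= z) h).
  apply: eq_bigr => i _; apply: eq_bigr => j _.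
  by rewrite trmx_delta map_delta_mx -colE -rowE !mxE.
split=> [a x y|m A hA v]; first by apply/matrixP => i j; rewrite !mxE linearP.
pose X : 'M[C]_(m, r) := \matrix_(a, i) v a i 0.
have h := Fp _ (ops_compress hS X hA); apply: (eq_ind _ (fun z => 0 <= z) h).
rewrite /pairing; transitivity (\sum_i \sum_j \sum_a \sum_b
    (v a i 0)^* * v b j 0 * (F i j (A a b) : C)).
  apply: eq_bigr => i _; apply: eq_bigr => j _; rewrite mxE linear_sum.
  apply: eq_bigr => a _; rewrite linear_sum; apply: eq_bigr => b _.
  by rewrite linearZ /= !mxE.
rewrite exchange_big4; apply: eq_bigr => a _; apply: eq_bigr => b _.
rewrite -/(qform _ _ _) qformE; apply: eq_bigr => i _; apply: eq_bigr => j _.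
by rewrite !mxE mulrAC.
Qed.

Lemma mpos_quadratic r (B : 'M[S]_r) (v : 'I_r -> C) : mpos oS B ->
  pos1 oS (\sum_i \sum_j ((v i)^* * v j) *: B i j).
Proof.
move=> hB; have := ops_compress hS (\matrix_(i < r, o < 1) v i) hB.
congr (mpos _ _); apply/matrixP => o o'; rewrite !mxE.
by apply: eq_bigr => i _; apply: eq_bigr => j _; rewrite !mxE.
Qed.

Lemma mpos_diag r (B : 'M[S]_r) k : mpos oS B -> pos1 oS (B k k).
Proof.
move=> hB; have := mpos_quadratic (fun i => (i == k)%:R) hB; congr (pos1 _ _).
rewrite (bigD1 k)//= [X in _ + X]big1 ?addr0 => [|i ik]; last first.
  by rewrite big1// => j _; rewrite (negPf ik) conjC0 mul0r scale0r.
rewrite (bigD1 k)//= big1 ?addr0 => [|j jk]; first by rewrite eqxx conjC1 mul1r scale1r.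
by rewrite (negPf jk) mulr0 scale0r.
Qed.

Lemma posf_entry r (B : 'M[S]_r) (h : S') i j : mpos oS B -> posf oS h ->
  `|h (B i j) : C| <= \sum_k (h (B k k) : C).
Proof.
move=> hB hp; pose M : 'M[C]_r := \matrix_(a, b) h (B a b).
have Mp : psd (qform M).
  move=> v; have := hp _ (mpos_quadratic (fun i => v i 0) hB).
  rewrite qformE linear_sum => hv; apply: (eq_ind _ (fun z => 0 <= z) hv).
  apply: eq_bigr => a _; rewrite linear_sum; apply: eq_bigr => b _.
  by rewrite linearZ /= mxE mulrAC.
have e a b : qform M (delta_mx a 0) (delta_mx b 0) = h (B b a).
  by rewrite /qform trmx_delta map_delta_mx -colE -rowE !mxE.
have T0 k : 0 <= (h (B k k) : C) by apply: hp; exact: mpos_diag.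
have sT k : snorm (qform M) (delta_mx k 0) <= sqrtC (\sum_k (h (B k k) : C)).
  rewrite -ler_sqr ?nnegrE ?snorm_ge0 ?sqrtC_ge0 ?sumr_ge0// snormK// e sqrtCK.
  by rewrite (bigD1 k)//= lerDl sumr_ge0.
rewrite -e -[leRHS]sqrtCK expr2 (le_trans (psd_CS_norm (qform_sesqui M) Mp _ _))//.
by rewrite ler_pM ?snorm_ge0.
Qed.

Lemma dual_star_posf h : posf oS h -> dual_star oS h = h.
Proof.
by move=> hp; apply/lfunP => x; rewrite dual_starE// posf_star// conjCK.
Qed.

Lemma dual_starP a f g : dual_star oS (a *: f + g) = a^* *: dual_star oS f + dual_star oS g.
Proof.
apply/lfunP => x; rewrite !(dual_starE, add_lfunE, scale_lfunE)//.
by rewrite rmorphD rmorphM.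
Qed.

Lemma dual_star0 : dual_star oS 0 = 0.
Proof.
by have := dual_starP (-1) 0 0; rewrite scaler0 addr0 rmorphN1 scaleN1r addNr.
Qed.
Lemma dual_starZ a f : dual_star oS (a *: f) = a^* *: dual_star oS f.
Proof. by have := dual_starP a f 0; rewrite dual_star0 !addr0. Qed.
Lemma dual_starD f g : dual_star oS (f + g) = dual_star oS f + dual_star oS g.
Proof. by have := dual_starP 1 f g; rewrite conjC1 !scale1r. Qed.
Lemma dual_starN f : dual_star oS (- f) = - dual_star oS f.
Proof. by rewrite -scaleN1r dual_starZ rmorphN1 scaleN1r. Qed.

Lemma dual_starK : involutive (dual_star oS).
Proof.
by move=> f; apply/lfunP => x; rewrite !dual_starE// conjCK (ops_starK hS).
Qed.

End DualCones.

Section DualSystem.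
Variables (R : realType) (S : vectType R[i]) (oS : opsys_data S).
Hypothesis hS : is_opsys oS.
Local Notation C := R[i].
Local Notation S' := 'Hom(S, C^o).
Variables (n : nat) (s : 'I_n -> S) (delta : 'I_n -> S').
Hypothesis basis : forall x, x = \sum_k (delta k x : C) *: s k.
Variable w : S'.
Hypothesis hw : faithful_state oS w.

Let wpos : posf oS w. Proof. by have [] := hw. Qed.

Lemma hom_basis (F : S') : F = \sum_k (F (s k) : C) *: delta k.
Proof.
apply/lfunP => x; rewrite {1}(basis x) linear_sum sum_lfunE.
by apply: eq_bigr => k _; rewrite linearZ scale_lfunE [LHS]mulrC.
Qed.

(* If the faithful state did not dominate the sum of the h_a, a functional on the
   dual would separate; it is the evaluation at some x in the cone killed by w. *)
Lemma faithful_dominates k (h : 'I_k -> S') : (forall a, posf oS (h a)) ->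
  (forall F : S', exists c : 'I_k -> C, forall x, (F x : C) = \sum_a c a * (h a x : C)) ->
  exists2 c : C, 0 <= c & forall x, pos1 oS x -> \sum_a (h a x : C) <= c * (w x : C).
Proof.
move=> hp hspan; pose u : S' := \sum_a h a.
have uE x : (u x : C) = \sum_a (h a x : C) by rewrite sum_lfunE.
have up : posf oS u by move=> x px; rewrite uE sumr_ge0// => a _; exact: hp.
(* Functionals that are positive up to a real multiple of [w]. Domination of [u] by a multiple of
   [w] amounts to [- u] being in [D], and both [w] and [- w] are in [D]. *)
pose D : set S' := [set g : S' | dual_star oS g = g /\ exists2 c : C, c \is Num.real &
  forall x, pos1 oS x -> 0 <= (g x : C) + c * (w x : C)]%classic.
have posD g : posf oS g -> D g.
  move=> gp; split; first exact: dual_star_posf.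
  by exists 0 => [|x px]; rewrite ?mul0r ?addr0 ?gp//; exact: real0.
apply: contrapT => nc.
have nD : ~ D (- u).
  case=> _ [c cr hc]; apply: nc; exists `|c| => // x px; rewrite -uE.
  have := hc x px; rewrite opp_lfunE addrC subr_ge0 => /le_trans; apply.
  by rewrite ler_wpM2r ?wpos// real_ler_norm.
have Dc : convex_cone (dual_star oS) D.
  split=> [g []//||g g' [hg [c cr hc]] [hg' [c' cr' hc']]|t g t0 [hg [c cr hc]]].
  - by apply: posD => x px; rewrite lfunE /= lexx.
  - split; first by rewrite dual_starD// hg hg'.
    exists (c + c') => [|x px]; first exact: realD.
    by rewrite add_lfunE mulrDl addrACA addr_ge0 ?hc ?hc'.
  - split; first by rewrite dual_starZ// hg conj_Creal ?ger0_real.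
    exists (t * c) => [|x px]; first by apply: realM => //; exact: ger0_real.
    by rewrite scale_lfunE -mulrA -[X in 0 <= X]mulrDr mulr_ge0 ?hc.
have Du g : dual_star oS g = g -> exists2 t : C, 0 < t & D (t *: u - g).
  move=> hg; have [c hc] := hspan g.
  have t0 : 0 < \sum_a `|c a| + 1 by rewrite ltr_wpDl// sumr_ge0.
  exists (\sum_a `|c a| + 1) => //; split.
    rewrite dual_starD// dual_starN// dual_starZ// hg (dual_star_posf hS up).
    by rewrite conj_Creal ?gtr0_real.
  exists 0 => [|x px]; first exact: real0.
  rewrite mul0r addr0 add_lfunE scale_lfunE opp_lfunE subr_ge0.
  have gr : (g x : C) \is Num.real.
    by apply/CrealP; rewrite -{2}hg dual_starE// (pos1_herm hS px).
  apply: le_trans (real_ler_norm gr) _; rewrite hc.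
  apply: le_trans (ler_norm_sum _ _ _) _.
  rewrite [leRHS]mulrDl mul1r uE mulr_suml.
  apply: (@le_trans _ _ (\sum_a `|c a| * \sum_b (h b x : C))); last first.
    by rewrite lerDl sumr_ge0// => a _; exact: hp.
  apply: ler_sum => a _; rewrite normrM ler_wpM2l//.
  rewrite ger0_norm ?hp// (bigD1 a)//= lerDl sumr_ge0// => b _; exact: hp.
have [f [fl _ fu fD]] := cone_functional (dual_starP hS) (dual_starK hS) Dc nD Du.
have f0 : f 0 = 0.
  by have := fl (-1) 0 0; rewrite scaleN1r oppr0 addr0 mulN1r addNr.
have fsum (r : seq 'I_n) (c : 'I_n -> C) :
    f (\sum_(a <- r) c a *: delta a) = \sum_(a <- r) c a * f (delta a).
  by elim: r => [|a r IH]; rewrite ?big_nil// !big_cons fl IH.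
pose x0 := \sum_a f (delta a) *: s a.
have fE g : f g = g x0.
  rewrite {1}(hom_basis g) fsum linear_sum; apply: eq_bigr => a _.
  by rewrite linearZ [RHS]mulrC.
have px0 : pos1 oS x0.
  by apply: (posf_pos1 hS) => g gp; rewrite -fE; apply: fD; exact: posD.
(* [f] is nonnegative at [- w], so the positive element [x0] is killed by the faithful state; this
   contradicts [f u = 1]. *)
have x00 : x0 = 0.
  have [_ _ w0] := hw; apply: w0 => //.
  apply/eqP; rewrite eq_le (wpos px0) andbT -oppr_ge0 -[X in - X]fE.
  have -> : - f w = f (- w).
    by have := fl (-1) w 0; rewrite scaleN1r !addr0 f0 addr0 mulN1r => ->.
  apply: fD; split; first by rewrite dual_starN// (dual_star_posf hS wpos).
  exists 1 => [|x px]; first exact: real1.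
  by rewrite opp_lfunE mul1r addNr.
by move/eqP: fu; rewrite fE x00 linear0 eq_sym oner_eq0.
Qed.

End DualSystem.

Section DualOpsys.
Variables (R : realType) (S : vectType R[i]) (oS : opsys_data S).
Hypothesis hS : is_opsys oS.
Local Notation C := R[i].
Local Notation S' := 'Hom(S, C^o).
Variables (n : nat) (s : 'I_n -> S) (delta : 'I_n -> S').
Hypothesis basis : forall x, x = \sum_k (delta k x : C) *: s k.
Variable w : S'.
Hypothesis hw : faithful_state oS w.

Let wpos : posf oS w. Proof. by have [] := hw. Qed.

Lemma pairingD r (F G : 'M[S']_r) B : pairing (F + G) B = pairing F B + pairing G B.
Proof.
rewrite /pairing -big_split; apply: eq_bigr => i _; rewrite -big_split.
by apply: eq_bigr => j _; rewrite mxE add_lfunE.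
Qed.

Lemma pairingZ r a (F : 'M[S']_r) B : pairing (scale_vmx a F) B = a * pairing F B.
Proof.
rewrite /pairing mulr_sumr; apply: eq_bigr => i _; rewrite mulr_sumr.
by apply: eq_bigr => j _; rewrite mxE scale_lfunE.
Qed.

Lemma pairingN r (F : 'M[S']_r) B : pairing (- F) B = - pairing F B.
Proof.
rewrite /pairing -sumrN; apply: eq_bigr => i _; rewrite -sumrN.
by apply: eq_bigr => j _; rewrite mxE opp_lfunE.
Qed.

Lemma pairing_amp r (h : S') (B : 'M[S]_r) :
  pairing (amp_mx r h) B = \sum_i (h (B i i) : C).
Proof.
apply: eq_bigr => i _; rewrite (bigD1 i)//= mxE eqxx mulr1n big1 ?addr0// => j ji.
by rewrite mxE eq_sym (negPf ji) mulr0n lfunE.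
Qed.

Lemma dual_pos_psd r (F : 'M[S']_r) x : mpos (dual oS w) F -> pos1 oS x ->
  psd (qform (\matrix_(i, j) (F i j x : C))).
Proof. by move=> [_ Fp] px; apply/mx_pos1; have := Fp _ _ px; rewrite map_const_mx. Qed.

Let qform_delta r (M : 'M[C]_r) a b : qform M (delta_mx a 0) (delta_mx b 0) = M b a.
Proof. by rewrite /qform trmx_delta map_delta_mx -colE -rowE !mxE. Qed.

Let dual_herm r (F : 'M[S']_r) : mpos (dual oS w) F -> star_mx (dual_star oS) F = F.
Proof.
move=> hF; apply/matrixP => i j; apply/lfunP => x; rewrite !mxE dual_starE//.
move: x; apply: (opsys_span_ind hS) => [x px|a x y hx hy].
  rewrite (pos1_herm hS px).
  have := psd_herm (qform_sesqui _) (dual_pos_psd hF px) (delta_mx j 0) (delta_mx i 0).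
  rewrite !qform_delta !mxE => ->.
  exact: conjCK.
by rewrite (ops_star_conjlinear hS) !linearP rmorphD rmorphM /= conjCK hx hy.
Qed.

Let dual_proper r (F : 'M[S']_r) : mpos (dual oS w) F -> mpos (dual oS w) (- F) -> F = 0.
Proof.
move=> hF hN; apply/matrixP => i j; rewrite mxE; apply/lfunP => x; rewrite lfunE /=.
move: x; apply: (opsys_span_ind hS) => [x px|a x y hx hy]; last first.
  by rewrite linearP /= hx hy scaler0 addr0.
pose M : 'M[C]_r := \matrix_(i, j) F i j x.
have Mp : psd (qform M) by exact: dual_pos_psd hF px.
have M0 k : snorm (qform M) (delta_mx k 0) = 0.
  apply/eqP; rewrite -sqrf_eq0 snormK// qform_delta mxE eq_le.
  have := Mp (delta_mx k 0); rewrite qform_delta mxE => ->; rewrite andbT.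
  have := dual_pos_psd hN px (delta_mx k 0); rewrite qform_delta !mxE opp_lfunE.
  by rewrite oppr_ge0.
apply/eqP; have := psd_CS_norm (qform_sesqui M) Mp (delta_mx j 0) (delta_mx i 0).
by rewrite qform_delta !M0 mul0r mxE normr_le0.
Qed.

Let dual_compress m r (X : 'M[C]_(m, r)) (F : 'M[S']_m) :
  mpos (dual oS w) F -> mpos (dual oS w) (compress X F).
Proof.
move=> /(dual_posP hS) Fp; apply/(dual_posP hS) => B hB.
have h := Fp _ (ops_compress hS X^T hB); apply: (eq_ind _ (fun z => 0 <= z) h).
transitivity (\sum_a \sum_b \sum_i \sum_j (X a i)^* * X b j * (F a b (B i j) : C)).
  apply: eq_bigr => a _; apply: eq_bigr => b _; rewrite mxE linear_sum.
  apply: eq_bigr => i _; rewrite linear_sum; apply: eq_bigr => j _.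
  by rewrite linearZ /= !mxE.
rewrite exchange_big4; apply: eq_bigr => i _; apply: eq_bigr => j _.
rewrite mxE sum_lfunE; apply: eq_bigr => a _; rewrite sum_lfunE.
by apply: eq_bigr => b _; rewrite scale_lfunE.
Qed.

Let pairing_real r (F : 'M[S']_r) B : star_mx (dual_star oS) F = F -> mpos oS B ->
  pairing F B \is Num.real.
Proof.
move=> hF hB; have e i j : (F i j (B i j) : C)^* = F j i (B j i).
  have -> : F j i = dual_star oS (F i j) by rewrite -{1}hF !mxE.
  have -> : B i j = ops_star oS (B j i) by rewrite -{1}(ops_pos_herm hS hB) !mxE.
  by rewrite dual_starE.
apply/CrealP; rewrite /pairing [LHS]rmorph_sum [RHS]exchange_big.
apply: eq_bigr => i _; rewrite [LHS]rmorph_sum.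
by apply: eq_bigr => j _; exact: e.
Qed.

Let dual_order_unit r (F : 'M[S']_r) : star_mx (dual_star oS) F = F ->
  exists2 t : C, 0 < t & mpos (dual oS w) (scale_vmx t (amp_mx r w) - F).
Proof.
move=> hF; have [k [h [hp hspan]]] := posf_span hS.
have [c c0 hc] := faithful_dominates hS basis hw hp hspan.
have [al hal] := choice (fun ij : 'I_r * 'I_r => hspan (F ij.1 ij.2)).
(* Each entry of [F] is expanded in the positive functionals [h a], whose values at entries of a
   positive [B] are bounded by their sums over the diagonal; [c] then compares these with [w]. *)
pose M := \sum_i \sum_j \sum_a `|al (i, j) a|.
have M0 : 0 <= M by do 3!(apply: sumr_ge0 => ? _).
exists (M * c + 1); first by rewrite ltr_wpDl// mulr_ge0.
apply/(dual_posP hS) => B hB; rewrite pairingD pairingN pairingZ pairing_amp subr_ge0.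
have W0 : 0 <= \sum_i (w (B i i) : C).
  by apply: sumr_ge0 => i _; apply: wpos; exact: mpos_diag.
rewrite mulrDl mul1r (@le_trans _ _ (M * c * \sum_i (w (B i i) : C)))//; last by rewrite lerDl.
rewrite (le_trans (real_ler_norm (pairing_real hF hB)))//.
rewrite -mulrA (@le_trans _ _ (M * \sum_a \sum_i (h a (B i i) : C)))//; last first.
  rewrite ler_wpM2l// exchange_big mulr_sumr ler_sum// => i _.
  by apply: hc; exact: mpos_diag.
have T0 a : 0 <= \sum_i (h a (B i i) : C).
  by apply: sumr_ge0 => i _; apply: hp; exact: mpos_diag.
rewrite /M mulr_suml (le_trans (ler_norm_sum _ _ _))// ler_sum// => i _.
rewrite mulr_suml (le_trans (ler_norm_sum _ _ _))// ler_sum// => j _.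
rewrite (hal (i, j)) mulr_suml (le_trans (ler_norm_sum _ _ _))// ler_sum// => a _.
rewrite normrM ler_wpM2l// (le_trans (posf_entry hS _ _ hB (hp a)))//.
by rewrite (bigD1 a)//= lerDl sumr_ge0.
Qed.

Lemma dual_is_opsys : is_opsys (dual oS w).
Proof.
split.
- exact: dual_starP.
- exact: dual_starK.
- exact: dual_herm.
- move=> r; apply/(dual_posP hS) => B hB.
  by rewrite /pairing big1// => i _; rewrite big1// => j _; rewrite mxE lfunE.
- move=> r F G /(dual_posP hS) hF /(dual_posP hS) hG; apply/(dual_posP hS) => B hB.
  by rewrite pairingD addr_ge0 ?hF ?hG.
- move=> r a F a0 /(dual_posP hS) hF; apply/(dual_posP hS) => B hB.
  by rewrite pairingZ mulr_ge0 ?hF.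
- exact: dual_proper.
- exact: dual_compress.
- exact: dual_order_unit.
- move=> r F hF; apply/(dual_posP hS) => B hB.
  have W0 : 0 <= \sum_i (w (B i i) : C).
    by apply: sumr_ge0 => i _; apply: wpos; exact: mpos_diag.
  apply: (@ge0_limit _ _ (\sum_i (w (B i i) : C))) => m.
  have /(dual_posP hS)/(_ B hB) := hF _ (rate_gt0 R m).
  rewrite pairingD pairingZ pairing_amp => h; exists (rate R m * \sum_i (w (B i i) : C) + pairing F B) => //.
  by rewrite opprD addrCA subrr addr0 normrN ger0_norm ?mulr_ge0 ?rate_ge0// mulrC.
Qed.

(** Reflexivity of the cones. Conversely, testing with positive functionals shows that [G] is
    self-adjoint, and if it were not positive, the separating matrix [F] would be positive over the
    dual and would contradict complete positivity at the standard basis vectors. *)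
Lemma bidual_posP r (G : 'M[S]_r) : mpos oS G <->
  cp (dual oS w) (mx_cones R r) (fun f : S' => \matrix_(i, j) (f (G i j) : C)).
Proof.
split=> [hG|hG].
  split=> [a f g|m F hF v].
    by apply/matrixP => i j; rewrite !mxE add_lfunE scale_lfunE.
  have h := hF.2 _ _ hG (fun i => \col_a v a i 0); apply: (eq_ind _ (fun z => 0 <= z) h).
  transitivity (\sum_i \sum_j \sum_a \sum_b (v a i 0)^* * (F a b (G i j) : C) * v b j 0).
    apply: eq_bigr => i _; apply: eq_bigr => j _; rewrite -/(qform _ _ _) qformE.
    by apply: eq_bigr => a _; apply: eq_bigr => b _; rewrite !mxE.
  rewrite exchange_big4; apply: eq_bigr => a _; apply: eq_bigr => b _.
  rewrite -/(qform _ _ _) qformE.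
  by apply: eq_bigr => i _; apply: eq_bigr => j _; rewrite !mxE.
have hh : star_mx (ops_star oS) G = G.
  apply/matrixP => i j; rewrite !mxE; apply/eqP; rewrite -subr_eq0; apply/eqP.
  apply: (posf_eq0 hS) => f fp; rewrite linearB /= posf_star//.
  have pf : mpos (dual oS w) (const_mx f : 'M_1).
    apply/(dual_posP hS) => B hB; rewrite /pairing !big_ord1 mxE.
    by apply: fp; exact: mpos_diag.
  have := hG.2 _ _ pf; rewrite map_const_mx => /mx_pos1 Mp.
  have := psd_herm (qform_sesqui _) Mp (delta_mx i 0) (delta_mx j 0).
  by rewrite !qform_delta !mxE => ->; rewrite subrr.
apply: contrapT => nG; have [F [Fp FG]] := opsys_separation hS hh nG.
have := hG.2 _ _ ((dual_posP hS w F).2 Fp) (fun i => delta_mx i 0).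
rewrite [X in 0 <= X](_ : _ = pairing F G) => [/(lt_le_trans FG)|]; first by rewrite ltxx.
apply: eq_bigr => i _; apply: eq_bigr => j _.
by rewrite trmx_delta map_delta_mx -colE -rowE !mxE.
Qed.

Definition canonical_pair : dual_pair oS (dual oS w).
Proof.
refine (@DualPair R S S' oS (dual oS w) (fun x f => f x) n s delta _ _ basis _
  bidual_posP _).
- by move=> a x y f; rewrite linearP.
- by move=> a f g x; rewrite add_lfunE scale_lfunE.
- exact: hom_basis.
- by [].
Defined.

Lemma com_positiveE : mpos (com_tensor oS (dual oS w))
    (const_mx (\sum_k (s k ⊗ delta k)) : 'M_1) <-> com_positive canonical_pair.
Proof.
have e (H : hilbert R) (phi : S -> bounded_op H) (psi : S' -> bounded_op H)
    (v : H) : linear phi -> linear psi ->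
  hilb_dot H (tensor_lift (fun x f => bop_comp (phi x) (psi f)) (\sum_k (s k ⊗ delta k)) v) v =
  \sum_k hilb_dot H (phi (s k) (psi (delta k) v)) v.
  move=> phil psil.
  have hb : bilinear_for *:%R *:%R (fun x f => bop_comp (phi x) (psi f)).
    split=> [f a x y|x a f g]; apply: bop_ext => z; first by rewrite /= phil.
    by rewrite /= psil [LHS](bop_linear (phi x)).
  rewrite (lift_sum hb) -(sesqui_suml (hdot_sesqui H)); congr (hilb_dot H _ v).
  elim/big_rec2: _ => [//|k y T _ <-].
  by rewrite (lift_tens hb).
split=> [h H phi psi hphi hpsi c xi|h].
  have := h H phi psi hphi hpsi c (fun=> xi).
  by rewrite !big_ord1 !mxE e//; [exact: hphi.1.1 | exact: hpsi.1.1].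
move=> /= H phi psi hphi hpsi c v; rewrite !big_ord1 !mxE e; [exact: h | exact: hphi.1.1 | exact: hpsi.1.1].
Qed.

End DualOpsys.

Lemma dual_basisE (R : realType) (S : vectType R[i]) (n : nat) (s : n.-tuple S)
    (delta : 'I_n -> 'Hom(S, R[i]^o)) : basis_of fullv s ->
  (forall i j : 'I_n, delta i (tnth s j) = (i == j)%:R) ->
  forall x, x = \sum_k (delta k x : R[i]) *: tnth s k.
Proof.
move=> hs hdelta x.
have sum_s (c : 'I_n -> R[i]) i : (delta i (\sum_k c k *: tnth s k) : R[i]) = c i.
  rewrite linear_sum (bigD1 i)//= linearZ /= hdelta eqxx big1 ?addr0 => [|k ki].
    exact: mulr1.
  by rewrite linearZ /= hdelta eq_sym (negPf ki) scaler0.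
have xE : x = \sum_k coord s k x *: tnth s k.
  rewrite {1}(coord_basis hs (memvf x)); apply: eq_bigr => k _.
  by rewrite (tnth_nth 0).
by rewrite {1}xE; apply: eq_bigr => k _; rewrite [in RHS]xE sum_s.
Qed.

Theorem theorem4p1 (R : realType) (S : vectType R[i])
    (oS : opsys_data S) (hS : is_opsys oS)
    (n : nat) (s : n.-tuple S) (hs : basis_of fullv s)
    (delta : 'I_n -> 'Hom(S, R[i]^o))
    (hdelta : forall i j : 'I_n, delta i (tnth s j) = (i == j)%:R)
    (w : 'Hom(S, R[i]^o)) (hw : faithful_state oS w) :
  [<-> Cstar_nuclear oS;
       mpos (com_tensor oS (dual oS w))
         (const_mx (\sum_(i < n) (tnth s i ⊗ delta i)) : 'M_1);
       Cstar_nuclear (dual oS w)].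
Proof.
have basis := dual_basisE hs hdelta.
have hD := dual_is_opsys hS basis hw.
have comE := com_positiveE hS basis w.
tfae.
- by move=> nS; apply/comE; exact: nuclear_com_positive.
- by move=> /comE/com_positive_sym; exact: com_positive_nuclear.
(* Nuclearity of the dual concerns the pair with its members exchanged; symmetry of the pairing
   brings positivity back to the original order. *)
- move=> nD; apply: (com_positive_nuclear hS hD (D := canonical_pair hS basis w)).
  apply: (com_positive_sym (D := dual_pair_sym (canonical_pair hS basis w))).
  exact: (nuclear_com_positive hD hS).
Qed.
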